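(* Let $n,k\geq 1$ be integers and let $\alpha(k)$ denote the number of $1$'s in the dyadic (base $2$) expansion of $k$. Then $$(k-\alpha(k))\cdot(n-1)\leq \mathrm{secat}(\pi^n_k)\leq \mathrm{cat}(B(\mathbb{R}^n,k))\leq (k-1)\cdot(n-1).$$
   Context: $F(\mathbb{R}^n,k)=\{(x_1,\dots,x_k)\in (\mathbb{R}^n)^k : x_i\neq x_j \text{ for } i\neq j\}$, $B(\mathbb{R}^n,k)=F(\mathbb{R}^n,k)/\Sigma_k$ with $\Sigma_k$ acting freely by permuting coordinates, and $\pi^n_k\colon F(\mathbb{R}^n,k)\to B(\mathbb{R}^n,k)$ is the quotient covering. $\mathrm{secat}(p)$ of a fibration $p\colon E\to B$ is the least $m$ such that $B$ can be covered by $m+1$ open sets each admitting a local section of $p$. $\mathrm{cat}(X)$ is the least $m$ such that $X$ can be covered by $m+1$ open sets each contractible in $X$. *)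

(* Defs.v *)
From Stdlib Require Import Reals.
From Stdlib Require Fin.
Open Scope R_scope.

Fixpoint alpha_aux (fuel k : nat) : nat :=
  match fuel with
  | O => O
  | S f => match k with O => O | _ => (Nat.modulo k 2 + alpha_aux f (Nat.div k 2))%nat end
  end.
Definition alpha (k : nat) : nat := alpha_aux k k.

Definition Pt (n : nat) := Fin.t n -> R.
Definition Conf (n k : nat) := Fin.t k -> Pt n.

Definition inj_conf {n k} (x : Conf n k) : Prop :=
  forall i j : Fin.t k, x i = x j -> i = j.

(* Euclidean (product) topology on (R^n)^k; F(R^n,k) carries the subspace
   topology (it is an open subset). *)
Definition open_conf {n k} (O : Conf n k -> Prop) : Prop :=
  forall x, O x -> exists eps, 0 < eps /\
    forall y : Conf n k, (forall i j, Rabs (y i j - x i j) < eps) -> O y.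

(* Unordered configuration space B(R^n,k) = F(R^n,k)/Sigma_k, realised as the
   set of underlying k-element subsets; pi^n_k sends x to {x_1,...,x_k}. *)
Definition pset {n k} (x : Conf n k) : Pt n -> Prop := fun p => exists i, x i = p.
Definition UConf (n k : nat) :=
  { S : Pt n -> Prop | exists x : Conf n k, inj_conf x /\ S = pset x }.
Definition piB {n k} (x : Conf n k) (h : inj_conf x) : UConf n k :=
  exist _ (pset x) (ex_intro _ x (conj h eq_refl)).

Definition openB {n k} (W : UConf n k -> Prop) : Prop :=
  exists O : Conf n k -> Prop, open_conf O /\
    forall (x : Conf n k) (h : inj_conf x), (O x <-> W (piB x h)).

Definition openBR {n k} (W : UConf n k -> R -> Prop) : Prop :=
  forall b t, W b t -> exists (V : UConf n k -> Prop) eps,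
    openB V /\ V b /\ 0 < eps /\
    forall b' t', V b' -> Rabs (t' - t) < eps -> W b' t'.

Definition cont_on_BF {n k} (U : UConf n k -> Prop) (s : UConf n k -> Conf n k) : Prop :=
  forall O, open_conf O -> exists V, openB V /\ forall b, U b -> (O (s b) <-> V b).

Definition cont_on_BRB {n k} (D : UConf n k -> R -> Prop)
  (H : UConf n k -> R -> UConf n k) : Prop :=
  forall W, openB W -> exists O, openBR O /\
    forall b t, D b t -> (W (H b t) <-> O b t).

Definition local_section {n k} (U : UConf n k -> Prop) : Prop :=
  exists s : UConf n k -> Conf n k, cont_on_BF U s /\
    forall b, U b -> inj_conf (s b) /\ proj1_sig b = pset (s b).

Definition contractible_in {n k} (U : UConf n k -> Prop) : Prop :=
  exists (H : UConf n k -> R -> UConf n k) (c : UConf n k),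
    cont_on_BRB (fun b t => U b /\ 0 <= t <= 1) H /\
    forall b, U b -> H b 0 = b /\ H b 1 = c.

Definition cover_by {n k} (P : (UConf n k -> Prop) -> Prop) (m : nat) : Prop :=
  exists U : nat -> (UConf n k -> Prop),
    (forall i, (i <= m)%nat -> openB (U i) /\ P (U i)) /\
    forall b, exists i, (i <= m)%nat /\ U i b.

Definition is_secat (n k s : nat) : Prop :=
  cover_by (n:=n) (k:=k) local_section s /\
  forall m, cover_by (n:=n) (k:=k) local_section m -> (s <= m)%nat.
Definition is_cat (n k c : nat) : Prop :=
  cover_by (n:=n) (k:=k) contractible_in c /\
  forall m, cover_by (n:=n) (k:=k) contractible_in m -> (c <= m)%nat.

(* Main.v *)
(* Upper bound.  The lexicographic order of R^n stratifies B(R^n,k) by codimension (the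
   Fox-Neuwirth strata), with codimensions between 0 and (k-1)(n-1).  Strata of equal codimension
   are separated from each other, so a neighbourhood of their union carries a section of the
   covering; lexicographically ordered configurations form a convex set, hence this neighbourhood
   contracts along straight lines to the configuration (0, e_1, 2 e_1, ...).

   secat <= cat.  Lifting a contraction of U to the covering, starting from a fixed point of the
   fibre over the end point, gives a section over U.

   Lower bound.  Starting from one point, repeatedly replace every point y by the pair y + x, y - x
   with x in a small sphere, adding a distant point when the binary digits of k ask for one.
   This embeds (S^(n-1))^V into F(R^n,k), equivariantly for a 2-group G of signed permutations of
   the k - alpha(k) factors acting freely.  Local sections over m+1 open sets label the points of
   this product by m+1 colours and permutations; on a fine subdivision the labels give a
   G-equivariant chain map over F_2 from the cells of (S^(n-1))^V to a free complex of dimension m,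
   and then to the cellular chains of the contractible free G-space (S^oo)^V.  This map is
   equivariantly chain homotopic to the inclusion.  The number of cells of type (n-1, ..., n-1)
   modulo 2 is a G-invariant cocycle which is 1 on the top cell and vanishes on the boundary terms
   of the homotopy, so the image of the top cell is nonzero, whence m >= (k - alpha(k))(n-1). *)
Require Import Defs.
From Stdlib Require Import Reals.
From Stdlib Require Lra Lia.
From HB Require structures.
From mathcomp Require all_boot fingroup perm ssralg zmodp boolp functions zify.

(** A binary tree with 2^a leaves has 2^a - 1 inner nodes. A forest whose trees correspond to the
    powers of two in the binary expansion of k has k leaves and k - alpha(k) nodes, and each node
    carries one sphere. Besides freeness, the symmetries must provide, for every node, an element
    that fixes the node and negates its sphere alone, possibly permuting the others: it exchanges
    the two faces of the top cell in that sphere, so their contributions to an invariant count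
    cancel modulo 2. The labels are the vertices of the (m+1)-fold join of the symmetric group, a
    free complex of dimension m. Colours give simplices only if points of one small cube with equal
    colour also have equal permutation; a Lebesgue number of the cover secures this. The spheres of
    the target are infinite because the maps are built by solving boundary equations, which requires
    an acyclic complex. Over F_2 there are no orientations, and repeating a term an odd number of
    times is harmless. The spheres are parametrised by cubes through polynomials, so that cells are
    subdivided by grids and all estimates are elementary. *)

Module ConfigurationSpaces.

Import Lra Lia HB.structures all_boot fingroup perm ssralg zmodp boolp functions zify.

Set Implicit Arguments.
Unset Strict Implicit.
Unset Printing Implicit Defensive.

Delimit Scope R_scope with re.

(** * Sums in characteristic two *)

Section CharacteristicTwo.
Import GRing.Theory.
Local Open Scope ring_scope.
Variable C : zmodType.
Hypothesis char2 : forall x : C, x + x = 0.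

(** Off the diagonal the terms [G v w] and [G w v] cancel; ranks in the enumeration select one of
    each pair. This is how faces of codimension two cancel below. *)
Lemma sum_symmetric (T : finType) (P : pred T) (G : T -> T -> C) :
  (forall v w, v != w -> G v w = G w v) ->
  \sum_(v | P v) \sum_(w | P w) G v w = \sum_(v | P v) G v v.
Proof.
move=> Gsym.
rewrite (eq_bigr (fun v => G v v + (\sum_(w | P w && (enum_rank v < enum_rank w)%N) G v w +
   \sum_(w | P w && (enum_rank w < enum_rank v)%N) G v w))); last first.
  move=> v Pv; rewrite (bigD1 v) //=; congr (_ + _).
  rewrite (bigID (fun w => (enum_rank v < enum_rank w)%N)) /=; congr (_ + _).
    apply: eq_bigl => w; rewrite -andbA; congr andb.
    by rewrite -(inj_eq enum_rank_inj) -val_eqE /=; lia.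
  apply: eq_bigl => w; rewrite -andbA; congr andb.
  by rewrite -(inj_eq enum_rank_inj) -val_eqE /=; lia.
rewrite big_split /= big_split /=.
set a := (X in _ + (X + _)).
suff -> : \sum_(v | P v) \sum_(w | P w && (enum_rank w < enum_rank v)%N) G v w = a.
  by rewrite char2 addr0.
rewrite /a (exchange_big_dep P) /=; last by move=> v w _ /andP[].
apply: eq_bigr => v Pv; apply: eq_big => [w|w /and3P[_ _ lt]]; first by rewrite Pv.
by apply: Gsym; apply: contraTneq lt => ->; rewrite ltnn.
Qed.

(** [P] holds at exactly one point of each orbit of [h], so the terms cancel in pairs. *)
Lemma sum_involution0 (T : finType) (P : pred T) (h : T -> T) (F : T -> C) :
  involutive h -> (forall x, P (h x) = ~~ P x) -> (forall x, F (h x) = F x) ->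
  \sum_x F x = 0.
Proof.
move=> hK hP hF; rewrite (bigID P) /=.
rewrite (reindex_inj (inv_inj hK)) /=.
rewrite (eq_bigr F); last by move=> x _; apply: hF.
by rewrite (eq_bigl (fun x => ~~ P x)) ?char2 // => x; rewrite hP.
Qed.

Lemma sum_const_odd (T : finType) (x : C) : odd #|T| -> \sum_(i : T) x = x.
Proof.
move=> oT; rewrite sumr_const -(odd_double_half #|T|) oT mulrnDr -mul2n mulrnA.
by rewrite mulr2n char2 mul0rn addr0.
Qed.

End CharacteristicTwo.

(** * Equivariant choices over a free action *)

Section EquivariantChoice.
Variables (T X C : Type) (GP : T -> Prop) (one : T) (mul : T -> T -> T) (inv : T -> T).
Variables (aX : T -> X -> X) (aC : T -> C -> C) (D : X -> Prop).
Hypothesis GP1 : GP one.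
Hypothesis GPM : forall g h, GP g -> GP h -> GP (mul g h).
Hypothesis GPV : forall g, GP g -> GP (inv g).
Hypothesis aX1 : forall x, aX one x = x.
Hypothesis aXM : forall g h x, aX (mul g h) x = aX g (aX h x).
Hypothesis aCM : forall g h x, aC (mul g h) x = aC g (aC h x).
Hypothesis aXV : forall g x, aX (inv g) (aX g x) = x.
Hypothesis aCV : forall g x, aC g (aC (inv g) x) = x.
Hypothesis DG : forall g x, GP g -> D x -> D (aX g x).
Hypothesis free : forall g x, GP g -> D x -> aX g x = x -> forall z, aC g z = z.

(** A solution is chosen at one representative of each orbit and carried along by the action. It is
    well defined because a symmetry fixing a point of [D] acts trivially on [C]; symmetries need not
    be compared as records. *)
Lemma equivariant_choice (c0 : C) (Q : X -> C -> Prop) :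
  (forall g x z, GP g -> D x -> Q x z -> Q (aX g x) (aC g z)) ->
  (forall x, D x -> exists z, Q x z) ->
  exists H : X -> C, forall x, D x ->
    Q x (H x) /\ forall g, GP g -> H (aX g x) = aC g (H x).
Proof.
move=> Qg Qex.
pose orb x := fun y => exists2 g, GP g & y = aX g x.
have orbx x : exists y, orb x y by exists x, one.
have orbE g x : GP g -> orb (aX g x) = orb x.
  move=> gG; apply/funext => y; apply/propext; split=> -[h hG ->].
    by exists (mul h g); [exact: GPM | rewrite aXM].
  exists (mul h (inv g)); first by apply: GPM => //; apply: GPV.
  by rewrite aXM aXV.
(* Points of one orbit have equal predicates [orb], so the choice operator returns the same
   representative for all of them. *)
pose rep x := sval (cid (orbx x)).
have repP x : orb x (rep x) by rewrite /rep; case: cid.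
have repE g x : GP g -> rep (aX g x) = rep x.
  rewrite /rep => gG; move: (orbx (aX g x)); rewrite (orbE _ _ gG) => e.
  by rewrite (Prop_irrelevance e (orbx x)).
have gamP x : exists g, GP g /\ aX g (rep x) = x.
  have [g gG ->] := repP x; exists (inv g); split; [exact: GPV|exact: aXV].
pose gam x := sval (cid (gamP x)).
have gamG x : GP (gam x) by rewrite /gam; case: cid => g [].
have gamK x : aX (gam x) (rep x) = x by rewrite /gam; case: cid => g [].
have Zex x : exists z, D x -> Q x z.
  by have [/Qex[z Qz]|nD] := pselect (D x); [exists z | exists c0].
pose Z x := sval (cid (Zex x)).
have ZP x : D x -> Q x (Z x) by rewrite /Z; case: cid.
have Drep x : D x -> D (rep x) by have [g gG ->] := repP x; apply: DG.
exists (fun x => aC (gam x) (Z (rep x))) => x Dx; split.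
  by rewrite -{1}(gamK x); apply: Qg; [exact: gamG|exact: Drep|apply: ZP; exact: Drep].
move=> g gG; rewrite repE //.
(* [k] compares two ways from the representative to [aX g x]; it fixes the representative, hence
   acts trivially on [C]. *)
pose k := mul (inv (gam (aX g x))) (mul g (gam x)).
have kG : GP k by apply: GPM; [apply: GPV|apply: GPM].
have kx : aX k (rep x) = rep x.
  rewrite /k !aXM gamK -{2}(gamK (aX g x)) aXV repE //.
have := free kG (Drep _ Dx) kx (Z (rep x)).
by rewrite /k !aCM => {1}<-; rewrite aCV.
Qed.

End EquivariantChoice.

(** * Cellular chains of a product of infinite spheres over F_2 *)

Record symmetry (V I : finType) := Symmetry
  { node_perm : {perm V}; node_sign : V -> bool; leaf_perm : {perm I} }.

Section SphereProduct.
Import GRing.Theory.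
Local Open Scope ring_scope.
Variables (V I : finType).

(** Each infinite sphere has two hemispheres in every dimension; a cell of the product records
    dimension and hemisphere in each factor. *)
Definition cell := {ffun V -> nat * bool}.
Local Notation chain := (cell -> 'F_2).
Implicit Types (e : cell) (z : chain) (v w : V) (g h : symmetry V I).

Definition set_cell e v (x : nat * bool) : cell :=
  [ffun w => if w == v then x else e w].
Definition coface e v (s : bool) : cell := set_cell e v ((e v).1.+1, s).
Definition face e v (s : bool) : cell := set_cell e v ((e v).1.-1, s).
Definition degree e : nat := (\sum_v (e v).1)%N.
Definition basis_chain e : chain := fun e' => (e' == e)%:R.
(** Chains are arbitrary functions, so the boundary is written through the finitely many cofaces of
    a cell. A hemisphere is bounded by both hemispheres one dimension below. *)
Definition boundary z : chain := fun e => \sum_v \sum_(s : bool) z (coface e v s).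
Definition homogeneous (j : nat) z := forall e, z e != 0 -> degree e = j.
Definition level_cell (j : nat) (s : {ffun V -> bool}) : cell := [ffun v => (j, s v)].
(** For [j = 0] this is the augmentation; for larger [j] it is the invariant cocycle that detects a
    top cell. *)
Definition level_sum (j : nat) z : 'F_2 := \sum_(s : {ffun V -> bool}) z (level_cell j s).

Lemma F2_addxx (x : 'F_2) : x + x = 0.
Proof. by case: x => [[|[|m]] //= i]; apply/val_inj. Qed.

Lemma chain_addxx z : z + z = 0.
Proof. by apply/funext => e; apply: F2_addxx. Qed.

Lemma chain_sumE (J : Type) (r : seq J) (P : pred J) (F : J -> chain) e :
  (\sum_(i <- r | P i) F i) e = \sum_(i <- r | P i) F i e.
Proof. by rewrite fct_sumE. Qed.

Lemma chain_addE z1 z2 e : (z1 + z2) e = z1 e + z2 e.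
Proof. by []. Qed.

Lemma boundary0 : boundary 0 = 0.
Proof. by apply/funext => e; rewrite /boundary big1 // => v _; rewrite big1. Qed.

Lemma boundaryD z1 z2 : boundary (z1 + z2) = boundary z1 + boundary z2.
Proof.
apply/funext => e; rewrite /boundary chain_addE -big_split; apply: eq_bigr => v _.
by rewrite -big_split.
Qed.

Lemma boundary_sum (J : Type) (r : seq J) (P : pred J) (F : J -> chain) :
  boundary (\sum_(i <- r | P i) F i) = \sum_(i <- r | P i) boundary (F i).
Proof. exact: (big_morph _ boundaryD boundary0). Qed.

Lemma set_cellxx e v x : set_cell e v x v = x.
Proof. by rewrite ffunE eqxx. Qed.

Lemma set_cell_neq e v w x : w != v -> set_cell e v x w = e w.
Proof. by rewrite ffunE => /negbTE->. Qed.

Lemma set_cellK e v x y : set_cell (set_cell e v x) v y = set_cell e v y.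
Proof. by apply/ffunP => w; rewrite !ffunE; case: eqP. Qed.

Lemma set_cell_id e v : set_cell e v (e v) = e.
Proof. by apply/ffunP => w; rewrite !ffunE; case: eqP => // ->. Qed.

Lemma set_cellC e v w x y : v != w ->
  set_cell (set_cell e v x) w y = set_cell (set_cell e w y) v x.
Proof.
move=> vw; apply/ffunP => u; rewrite !ffunE.
by case: (eqVneq u w) => // ->; rewrite eq_sym (negbTE vw).
Qed.

Lemma cofaceC e v w s t : v != w ->
  coface (coface e v s) w t = coface (coface e w t) v s.
Proof.
by move=> vw; rewrite /coface !set_cell_neq // 1?eq_sym // set_cellC.
Qed.

Lemma faceC e v w s t : v != w -> face (face e v s) w t = face (face e w t) v s.
Proof. by move=> vw; rewrite /face !set_cell_neq // 1?eq_sym // set_cellC. Qed.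

Lemma degree_set_cell e v x : (degree (set_cell e v x) + (e v).1 = degree e + x.1)%N.
Proof.
rewrite /degree (bigD1 v) //= [X in (_ = X + _)%N](bigD1 v) //= set_cellxx.
rewrite (eq_bigr (fun w => (e w).1)) => [|w wv]; last by rewrite set_cell_neq.
lia.
Qed.

Lemma degree_coface e v s : degree (coface e v s) = (degree e).+1.
Proof. by have := degree_set_cell e v ((e v).1.+1, s); rewrite -/(coface _ _ _) /=; lia. Qed.

Lemma degree_face e v s : (0 < (e v).1)%N -> (degree (face e v s)).+1 = degree e.
Proof. by have := degree_set_cell e v ((e v).1.-1, s); rewrite -/(face _ _ _) /=; lia. Qed.

(** Steps in different factors commute and cancel by symmetry; of two steps in one factor the first
    sign is forgotten, so each term occurs twice. *)
Lemma boundary_boundary z : boundary (boundary z) = 0.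
Proof.
apply/funext => e; rewrite /boundary.
under eq_bigr => v _ do rewrite exchange_big /=.
rewrite (sum_symmetric F2_addxx predT
  (G := fun v w => \sum_(s : bool) \sum_(t : bool) z (coface (coface e v s) w t))); last first.
  move=> v w vw; rewrite exchange_big /=; apply: eq_bigr => t _; apply: eq_bigr => s _.
  by rewrite cofaceC.
rewrite big1 // => v _; rewrite big_bool /= /coface.
by under eq_bigr => t _ do rewrite set_cellxx set_cellK;
  under [X in _ + X]eq_bigr => t _ do rewrite set_cellxx set_cellK; rewrite F2_addxx.
Qed.

Lemma homogeneous0 j : homogeneous j 0.
Proof. by move=> e; rewrite eqxx. Qed.

Lemma homogeneousD j z1 z2 : homogeneous j z1 -> homogeneous j z2 -> homogeneous j (z1 + z2).
Proof.
move=> h1 h2 e; rewrite chain_addE; case: (eqVneq (z1 e) 0) => [->|/h1 //].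
by rewrite add0r; apply: h2.
Qed.

Lemma homogeneous_sum (J : eqType) (r : seq J) (P : pred J) (F : J -> chain) j :
  (forall i, i \in r -> P i -> homogeneous j (F i)) -> homogeneous j (\sum_(i <- r | P i) F i).
Proof.
move=> h; rewrite big_seq_cond; apply: (big_ind (homogeneous j)).
- exact: homogeneous0.
- exact: homogeneousD.
- by move=> i /andP[ir Pi]; apply: h.
Qed.

Lemma sum_neq0 (J : finType) (F : J -> 'F_2) : \sum_i F i != 0 -> exists i, F i != 0.
Proof.
move=> h; apply/existsP; apply: contraNT h => /existsPn h.
by rewrite big1 // => i _; apply/eqP; rewrite -[_ == _]negbK.
Qed.

Lemma homogeneous_boundary j z : homogeneous j.+1 z -> homogeneous j (boundary z).
Proof.
move=> h e /sum_neq0[v /sum_neq0[s /h]]; rewrite degree_coface; lia.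
Qed.

Lemma homogeneous_basis e : homogeneous (degree e) (basis_chain e).
Proof. by rewrite /basis_chain => e'; case: (eqVneq e' e) => [->//|_]; rewrite eqxx. Qed.

Lemma boundary_basis e :
  boundary (basis_chain e) = \sum_(v | (0 < (e v).1)%N) \sum_(s : bool) basis_chain (face e v s).
Proof.
apply/funext => e'; rewrite /boundary chain_sumE [RHS]big_mkcond; apply: eq_bigr => v _.
have cf s : (0 < (e v).1)%N -> coface (face e v s) v (e v).2 = e.
  move=> e0; rewrite /coface /face set_cellxx set_cellK /= prednK //.
  by rewrite -surjective_pairing set_cell_id.
case: ifP => e0.
  rewrite chain_sumE /basis_chain.
  have [->|ne] := eqVneq e' (face e v (e' v).2).
    rewrite !big_bool.
    have E1 s t : (coface (face e v s) v t == e) = (t == (e v).2).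
      apply/eqP/eqP => [<-|->]; last exact: cf.
      by rewrite /coface set_cellxx.
    have E2 s t : (face e v s == face e v t) = (s == t).
      by apply/eqP/eqP => [/ffunP/(_ v)|->//]; rewrite /face !set_cellxx => -[].
    by rewrite !E1 !E2; case: (e v).2; case: (e' v).2; rewrite //= addrC.
  rewrite big1 => [|s _]; last first.
    case: eqP => // E; case/eqP: ne; rewrite -E /face /coface set_cellxx set_cellK /=.
    by rewrite -surjective_pairing set_cell_id.
  rewrite big1 // => s _.
  by case: eqP => // E; case/eqP: ne; rewrite {1 2}E /face set_cellxx.
rewrite big1 // => s _; rewrite /basis_chain; case: eqP => // ce.
by move: e0; rewrite -ce /coface set_cellxx.
Qed.

Lemma level_sumD j z1 z2 : level_sum j (z1 + z2) = level_sum j z1 + level_sum j z2.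
Proof. exact: big_split. Qed.

Lemma level_sum0 j : level_sum j 0 = 0.
Proof. by rewrite /level_sum big1. Qed.

Lemma level_sum_sum j (J : Type) (r : seq J) (P : pred J) (F : J -> chain) :
  level_sum j (\sum_(i <- r | P i) F i) = \sum_(i <- r | P i) level_sum j (F i).
Proof. exact: (big_morph _ (level_sumD j) (level_sum0 j)). Qed.

(** A coface in direction [v] forgets the sign at [v], so changing that sign is a free involution on
    the terms. *)
Lemma level_sum_boundary j z : level_sum j (boundary z) = 0.
Proof.
rewrite /level_sum /boundary exchange_big big1 //= => v _.
pose flip (s : {ffun V -> bool}) := [ffun w => if w == v then ~~ s w else s w].
apply: (sum_involution0 F2_addxx (P := fun s : {ffun V -> bool} => s v) (h := flip)).
- by move=> s; apply/ffunP => w; rewrite !ffunE; case: eqP; rewrite ?negbK.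
- by move=> s; rewrite ffunE eqxx.
move=> s; apply: eq_bigr => t _; congr z; apply/ffunP => w; rewrite !ffunE /=.
by case: eqP.
Qed.

Lemma level_sum_basis j s : level_sum j (basis_chain (level_cell j s)) = 1.
Proof.
rewrite /level_sum (bigD1 s) //= /basis_chain eqxx big1 ?addr0 // => t ts.
case: eqP => // /ffunP E; case/eqP: ts; apply/ffunP => v.
by have := E v; rewrite !ffunE => -[].
Qed.

(* Each cell of the [v]-th sphere in a [false] hemisphere is coned off by the [true] hemisphere
   of the next dimension. *)
Definition cone v z : chain := fun e =>
  if (e v).2 && (0 < (e v).1)%N then z (set_cell e v ((e v).1.-1, false)) else 0.
Definition collapse v z : chain := fun e =>
  if e v == (0%N, true) then \sum_(s : bool) z (set_cell e v (0%N, s)) else 0.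

(** An algebraic contraction of the [v]-th sphere onto its vertex [(0, true)], with the other
    factors left alone. *)
Lemma cone_homotopy v z : boundary (cone v z) + cone v (boundary z) = z + collapse v z.
Proof.
apply/funext => e; rewrite !chain_addE {1}/boundary (bigD1 v) //= big_bool /cone /coface /=.
rewrite !set_cellxx !set_cellK /= addr0.
set j := (e v).1; set A := \sum_(i | i != v) _.
have -> : A = if (e v).2 && (0 < j)%N then
     \sum_(w | w != v) \sum_(s : bool) z (coface (set_cell e v (j.-1, false)) w s) else 0.
  rewrite /A; case: ifP => c; last first.
    by rewrite big1 // => w wv; rewrite big1 // => s _; rewrite !set_cell_neq 1?eq_sym // c.
  apply: eq_bigr => w wv; apply: eq_bigr => s _.
  rewrite !set_cell_neq 1?eq_sym // c /coface set_cell_neq // set_cellC //.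
have -> : (if (e v).2 && (0 < j)%N then boundary z (set_cell e v (j.-1, false)) else 0)
   = if (e v).2 && (0 < j)%N then \sum_(s : bool) z (set_cell e v (j, s)) +
     \sum_(w | w != v) \sum_(s : bool) z (coface (set_cell e v (j.-1, false)) w s) else 0.
  case: ifP => // /andP[_ j0]; rewrite /boundary (bigD1 v) //=; congr (_ + _).
  by apply: eq_bigr => s _; rewrite /coface set_cellxx set_cellK /= prednK.
rewrite /collapse; have := set_cell_id e v; rewrite /j.
case: (e v) => [[|i] [|]] /= E; rewrite ?big_bool ?E /= ?addr0 ?eqxx /=.
- by rewrite addrA F2_addxx add0r.
- by [].
- by rewrite addrACA F2_addxx addr0 addrCA F2_addxx addr0.
- by [].
Qed.

Lemma homogeneous_cone v j z : homogeneous j z -> homogeneous j.+1 (cone v z).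
Proof.
move=> h e; rewrite /cone; case: ifP => [/andP[_ e0] /h|_]; last by rewrite eqxx.
by have := degree_set_cell e v ((e v).1.-1, false) => /=; lia.
Qed.

Lemma collapse_all (vs : seq V) j z : homogeneous j z -> boundary z = 0 ->
  exists y z', [/\ homogeneous j.+1 y, homogeneous j z', z = boundary y + z', boundary z' = 0 &
    forall v e, v \in vs -> z' e != 0 -> e v = (0%N, true)].
Proof.
elim: vs z => [|v vs IH] z hz dz.
  by exists 0, z; split; rewrite ?boundary0 ?add0r //; apply: homogeneous0.
have [y [z' [hy hz' zE dz' sz']]] := IH z hz dz.
have hc : boundary (cone v z') = z' + collapse v z'.
  rewrite -cone_homotopy dz'; have -> : cone v 0 = 0; last by rewrite addr0.
  by apply/funext => e; rewrite /cone; case: ifP.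
have cE : collapse v z' = z' + boundary (cone v z') by rewrite hc addrA chain_addxx add0r.
exists (y + cone v z'), (collapse v z'); split.
- by apply: homogeneousD => //; apply: homogeneous_cone.
- rewrite cE; apply: homogeneousD => //; apply: homogeneous_boundary.
  exact: homogeneous_cone.
- by rewrite cE boundaryD zE -!addrA; congr (_ + _); rewrite addrCA chain_addxx addr0.
- by rewrite cE boundaryD dz' boundary_boundary addr0.
move=> w e; rewrite inE /collapse; case: (eqVneq (e v) (0%N, true)) => [ev|]; last by rewrite eqxx.
case: (eqVneq w v) => [-> //|wv] /= wvs /sum_neq0[s /(sz' w)].
by rewrite set_cell_neq //; apply.
Qed.

(** After all factors are contracted only a multiple of one vertex can remain; then [j = 0], and the
    multiple is the augmentation of [z]. *)
Lemma chain_exact j z : homogeneous j z -> boundary z = 0 ->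
  (j = 0%N -> level_sum 0 z = 0) -> exists2 y, homogeneous j.+1 y & boundary y = z.
Proof.
move=> hz dz ez; have [y [z' [hy hz' zE dz' sz']]] := collapse_all (enum V) hz dz.
exists y => //; suff z'0 : z' = 0 by rewrite zE z'0 addr0.
apply/funext => e; case: (eqVneq (z' e) 0) => [//|znz]; exfalso.
have eE e' : z' e' != 0 -> e' = level_cell 0 [ffun => true].
  move=> e'0; apply/ffunP => v; rewrite (sz' v e') ?mem_enum // !ffunE //.
have j0 : j = 0%N.
  rewrite -(hz' _ znz) (eE _ znz) /degree big1 // => v _; by rewrite ffunE.
have := ez j0; rewrite zE level_sumD level_sum_boundary add0r /level_sum.
rewrite (bigD1 [ffun => true]) //= big1 ?addr0 => [z0|s sn].
  by have := znz; rewrite (eE _ znz) z0 eqxx.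
apply/eqP; apply: contraNT sn => /eE /ffunP E; apply/eqP/ffunP => v.
by have := E v; rewrite !ffunE => -[].
Qed.

Definition sym_one : symmetry V I := Symmetry 1%g (fun=> false) 1%g.
Definition sym_mul g h := Symmetry (node_perm g * node_perm h)%g
  (fun v => node_sign g v (+) node_sign h (node_perm g v)) (leaf_perm g * leaf_perm h)%g.
Definition sym_inv g := Symmetry ((node_perm g)^-1)%g
  (fun v => node_sign g ((node_perm g)^-1%g v)) ((leaf_perm g)^-1)%g.

(** Products of permutations apply the left factor first, so precomposition with [node_perm g] is a
    left action. *)
Definition cell_act g e : cell :=
  [ffun v => ((e (node_perm g v)).1, (e (node_perm g v)).2 (+) node_sign g v)].
Definition chain_act g z : chain := fun e => z (cell_act (sym_inv g) e).

Lemma cell_act1 e : cell_act sym_one e = e.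
Proof. by apply/ffunP => v; rewrite !ffunE perm1 addbF -surjective_pairing. Qed.

Lemma cell_actM g h e : cell_act (sym_mul g h) e = cell_act g (cell_act h e).
Proof.
apply/ffunP => v; rewrite !ffunE /= permM -addbA; congr (_, _ (+) _).
by rewrite addbC.
Qed.

Lemma cell_actK g e : cell_act (sym_inv g) (cell_act g e) = e.
Proof. by apply/ffunP => v; rewrite !ffunE /= permKV addbK -surjective_pairing. Qed.

Lemma cell_actKV g e : cell_act g (cell_act (sym_inv g) e) = e.
Proof. by apply/ffunP => v; rewrite !ffunE /= permK addbK -surjective_pairing. Qed.

Lemma chain_actM g h z : chain_act (sym_mul g h) z = chain_act g (chain_act h z).
Proof.
apply/funext => e; rewrite /chain_act; congr z.
apply/ffunP => v; rewrite !ffunE /= invMg permM permKV.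
by congr (_, _); rewrite -addbA.
Qed.

Lemma chain_actKV g z : chain_act g (chain_act (sym_inv g) z) = z.
Proof.
apply/funext => e; rewrite /chain_act; congr z.
apply/ffunP => v; rewrite !ffunE /= invgK permK.
by rewrite addbK -surjective_pairing.
Qed.

Lemma chain_actD g z1 z2 : chain_act g (z1 + z2) = chain_act g z1 + chain_act g z2.
Proof. by []. Qed.

Lemma chain_act_sum g (J : Type) (r : seq J) (P : pred J) (F : J -> chain) :
  chain_act g (\sum_(i <- r | P i) F i) = \sum_(i <- r | P i) chain_act g (F i).
Proof. by apply/funext => e; rewrite chain_sumE /chain_act chain_sumE. Qed.

Lemma degree_act g e : degree (cell_act g e) = degree e.
Proof.
rewrite /degree [RHS](reindex_inj (@perm_inj _ (node_perm g))) /=.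
by apply: eq_bigr => v _; rewrite ffunE.
Qed.

Lemma homogeneous_act g j z : homogeneous j z -> homogeneous j (chain_act g z).
Proof. by move=> h e /h; rewrite degree_act. Qed.

Lemma chain_act_basis g e : chain_act g (basis_chain e) = basis_chain (cell_act g e).
Proof.
apply/funext => e'; rewrite /chain_act /basis_chain; congr (nat_of_bool _)%:R.
by apply/eqP/eqP => [<-|->]; rewrite ?cell_actKV ?cell_actK.
Qed.

Lemma coface_act g e v s :
  cell_act g (coface e (node_perm g v) (s (+) node_sign g v)) = coface (cell_act g e) v s.
Proof.
apply/ffunP => w; rewrite !ffunE /= (inj_eq (@perm_inj _ _)).
by case: eqP => [->|//] /=; rewrite addbK.
Qed.

Lemma face_act g e v s :
  cell_act g (face e (node_perm g v) (s (+) node_sign g v)) = face (cell_act g e) v s.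
Proof.
apply/ffunP => w; rewrite !ffunE /= (inj_eq (@perm_inj _ _)).
by case: eqP => [->|//] /=; rewrite addbK.
Qed.

Lemma sum_addb (b : bool) (F : bool -> 'F_2) : \sum_(s : bool) F (s (+) b) = \sum_(s : bool) F s.
Proof. by rewrite !big_bool; case: b => //=; rewrite addrC. Qed.

Lemma boundary_act g z : boundary (chain_act g z) = chain_act g (boundary z).
Proof.
apply/funext => e; rewrite /boundary /chain_act.
rewrite (reindex_inj (@perm_inj _ (node_perm (sym_inv g)))) /=; apply: eq_bigr => v _.
rewrite -(sum_addb (node_sign (sym_inv g) v)); apply: eq_bigr => s _; congr z.
exact: (coface_act (sym_inv g)).
Qed.

Lemma level_sum_act g j z : level_sum j (chain_act g z) = level_sum j z.
Proof.
rewrite /level_sum /chain_act.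
pose th (s : {ffun V -> bool}) := [ffun v => s (node_perm g v) (+) node_sign g v].
have thI : injective th.
  move=> s t /ffunP E; apply/ffunP => v; have := E ((node_perm g)^-1%g v).
  by rewrite !ffunE permKV; apply: addIb.
rewrite (reindex_inj thI) /=; apply: eq_bigr => s _; congr z.
by apply/ffunP => v; rewrite !ffunE /= permKV addbK.
Qed.

End SphereProduct.

(** * Equivariant maps into an acyclic complex *)

Section EquivariantExtension.
Import GRing.Theory.
Local Open Scope ring_scope.
Variables (V I : finType) (GP : symmetry V I -> Prop).
Local Notation chain := (cell V -> 'F_2).
Hypothesis GP1 : GP (sym_one V I).
Hypothesis GPM : forall g h, GP g -> GP h -> GP (sym_mul g h).
Hypothesis GPV : forall g, GP g -> GP (sym_inv g).
Variables (X : eqType) (dim : X -> nat) (bd : X -> seq X) (D : X -> Prop).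
Variable aX : symmetry V I -> X -> X.
Hypothesis aX1 : forall x, aX (sym_one V I) x = x.
Hypothesis aXM : forall g h x, aX (sym_mul g h) x = aX g (aX h x).
Hypothesis aXV : forall g x, aX (sym_inv g) (aX g x) = x.
Hypothesis DG : forall g x, GP g -> D x -> D (aX g x).
Hypothesis dimG : forall g x, dim (aX g x) = dim x.
Hypothesis free : forall g x, GP g -> D x -> aX g x = x -> forall z : chain, chain_act g z = z.
Hypothesis bdD : forall x y, D x -> y \in bd x -> D y /\ dim x = (dim y).+1.
Hypothesis bdG : forall g x (F : X -> chain), GP g -> D x ->
  \sum_(y <- bd (aX g x)) F y = \sum_(y <- bd x) F (aX g y).
Hypothesis bdbd : forall x, D x -> forall H : X -> chain,
  \sum_(y <- bd x) \sum_(y' <- bd y) H y' = 0.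
(** [dl] is the degree of the map to be built: [dl = 0] with [f = 0] yields an augmented chain map,
    [dl = 1] a chain homotopy from zero to the chain map [f]. *)
Variables (dimmax : nat) (f : X -> chain) (dl : nat).
Hypothesis dim_le : forall x, D x -> (dim x <= dimmax)%N.
Hypothesis fG : forall g x, GP g -> D x -> f (aX g x) = chain_act g (f x).
Hypothesis f_hom : forall x, D x -> (0 < dim x + dl)%N -> homogeneous (dim x + dl).-1 (f x).
Hypothesis f_bd : forall x, D x -> boundary (f x) = \sum_(y <- bd x) f y.
Hypothesis f0 : forall x, D x -> (dim x + dl = 0)%N -> f x = 0.
Hypothesis f_level : forall x, D x -> (dim x + dl = 1)%N ->
  level_sum 0 (f x) + (if dl == 0%N then (size (bd x))%:R else 0) = 0.

(* Since the product of infinite spheres is acyclic and the action on [X] is free, [f] can be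
   killed one dimension at a time, choosing primitives on orbit representatives. *)
Lemma equivariant_extension : exists H : X -> chain, forall x, D x ->
  [/\ homogeneous (dim x + dl) (H x), boundary (H x) = f x + \sum_(y <- bd x) H y,
      (dim x + dl = 0)%N -> level_sum 0 (H x) = 1 &
      forall g, GP g -> H (aX g x) = chain_act g (H x)].
Proof.
suff [H HP] : exists H : X -> chain, forall x, D x -> (dim x < dimmax.+1)%N ->
  [/\ homogeneous (dim x + dl) (H x), boundary (H x) = f x + \sum_(y <- bd x) H y,
      (dim x + dl = 0)%N -> level_sum 0 (H x) = 1 &
      forall g, GP g -> H (aX g x) = chain_act g (H x)].
  by exists H => x Dx; apply: HP => //; rewrite ltnS; apply: dim_le.
elim: dimmax.+1 => [|j [H HP]]; first by exists (fun=> 0).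
have bd_dim x y : D x -> dim x = j -> y \in bd x -> D y /\ (dim y < j)%N.
  by move=> Dx dx /(bdD Dx)[Dy]; rewrite dx => ->.
have bd0 x : D x -> dim x = 0%N -> bd x = [::].
  move=> Dx dx; case E: (bd x) => [//|y s].
  have [|_] := bdD (y := y) Dx; first by rewrite E mem_head.
  by rewrite dx.
pose Q x z := [/\ homogeneous (dim x + dl) z, boundary z = f x + \sum_(y <- bd x) H y &
  (dim x + dl = 0)%N -> level_sum 0 z = 1].
have [||||K KP] := @equivariant_choice _ _ _ GP _ _ _ aX (@chain_act V I) (fun x => D x /\ dim x = j)
  GP1 GPM GPV aX1 aXM (@chain_actM V I) aXV (@chain_actKV V I) _ _ 0 Q.
- by move=> g x gG [Dx dx]; split; [exact: DG|rewrite dimG].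
- by move=> g x gG [Dx dx]; apply: free.
- move=> g x z gG [Dx dx] [Q1 Q2 Q3]; split.
  + by rewrite dimG; apply: homogeneous_act.
  + rewrite boundary_act Q2 chain_actD fG // chain_act_sum; congr (_ + _).
    rewrite bdG // [LHS]big_seq [RHS]big_seq; apply: eq_bigr => y yx.
    by have [Dy dy] := bd_dim _ _ Dx dx yx; have [_ _ _ ->] := HP y Dy dy.
  + by rewrite dimG => /Q3; rewrite level_sum_act.
- move=> x [Dx dx]; case: (posnP (dim x + dl)) => [d0|dpos].
    exists (basis_chain (level_cell 0 [ffun => true])).
    have hl : degree (level_cell (V := V) 0 [ffun => true]) = 0%N.
      by rewrite /degree big1 // => v _; rewrite ffunE.
    split.
    + by have := @homogeneous_basis V (level_cell 0 [ffun => true]); rewrite hl d0.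
    + have dx0 : dim x = 0%N by move: d0; clear; lia.
      rewrite f0 // bd0 // big_nil addr0 boundary_basis big1 // => v.
      by rewrite ffunE.
    + by rewrite level_sum_basis.
  have [||dpred|z hz dz] := @chain_exact V (dim x + dl).-1 (f x + \sum_(y <- bd x) H y).
  + apply: homogeneousD; first exact: f_hom.
    apply: homogeneous_sum => y yx _; have [Dy dy] := bd_dim _ _ Dx dx yx.
    have [h _ _ _] := HP y Dy dy; have [_ dxy] := bdD Dx yx.
    by rewrite dxy addSn.
  + rewrite boundaryD boundary_sum f_bd // -big_split /= -[RHS](bdbd Dx H).
    rewrite big_seq [RHS]big_seq; apply: eq_bigr => y yx.
    have [Dy dy] := bd_dim _ _ Dx dx yx; have [_ -> _ _] := HP y Dy dy.
    by rewrite addrA chain_addxx add0r.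
  (* The augmentation must vanish: for [dl = 0] every endpoint of an edge contributes one, for
     [dl = 1] a vertex has no faces and only [f x] remains. *)
  + have d1 : (dim x + dl = 1)%N by lia.
    rewrite level_sumD level_sum_sum -[RHS](f_level Dx d1); congr (_ + _).
    case: eqP => dl0.
      rewrite -(count_predT (bd x)) -sum1_count natr_sum big_seq [RHS]big_seq.
      apply: eq_bigr => y yx; have [Dy dy] := bd_dim _ _ Dx dx yx.
      by have [_ _ h _] := HP y Dy dy; have [_ dxy] := bdD Dx yx; apply: h; lia.
    by rewrite bd0 ?big_nil //; lia.
  exists z; split=> //; first by rewrite -(prednK dpos).
  by move=> d0; rewrite d0 in dpos.
exists (fun x => if dim x == j then K x else H x) => x Dx; rewrite ltnS leq_eqVlt.
have sumE : (dim x <= j)%N ->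
  \sum_(y <- bd x) (if dim y == j then K y else H y) = \sum_(y <- bd x) H y.
  move=> dx; rewrite big_seq [RHS]big_seq; apply: eq_bigr => y /(bdD Dx)[_ dy].
  by rewrite ifN //; lia.
case: (eqVneq (dim x) j) => [dx _|_ /= dx].
  have [[K1 K2 K3] K4] := KP x (conj Dx dx).
  split=> //; first by rewrite K2 sumE // dx.
  by move=> g gG; rewrite dimG dx eqxx; apply: K4.
have [H1 H2 H3 H4] := HP x Dx dx; split=> //; first by rewrite H2 sumE // ltnW.
by move=> g gG; rewrite dimG ifN ?H4 //; lia.
Qed.

End EquivariantExtension.

(** * The join of copies of the symmetric group *)

Section LabelSimplices.
Import GRing.Theory.
Local Open Scope ring_scope.
Variables (V I : finType) (GP : symmetry V I -> Prop) (m : nat).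
Local Notation chain := (cell V -> 'F_2).
Hypothesis GP1 : GP (sym_one V I).
Hypothesis GPM : forall g h, GP g -> GP h -> GP (sym_mul g h).
Hypothesis GPV : forall g, GP g -> GP (sym_inv g).
Hypothesis faithful : forall g, GP g -> leaf_perm g = 1%g -> forall z : chain, chain_act g z = z.

Definition label := ('I_m * {perm I})%type.
Definition label_act (g : symmetry V I) (p : label) : label := (p.1, (p.2 * (leaf_perm g)^-1)%g).
Definition simplex_act g (A : {set label}) : {set label} := label_act g @: A.
(** These are the simplices of the [m]-fold join of the discrete set of permutations of [I], a
    complex of dimension [m - 1]. *)
Definition simplex (A : {set label}) : Prop := A != set0 /\ {in A &, injective fst}.
(** A vertex gets no faces, which excludes the empty simplex. *)
Definition simplex_faces (A : {set label}) : seq {set label} :=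
  if (#|A| == 1)%N then [::] else [seq A :\ p | p <- enum A].

Lemma label_act_inj g : injective (label_act g).
Proof. by move=> [c s] [c' s'] [-> /mulIg ->]. Qed.

Lemma label_actM g h p : label_act (sym_mul g h) p = label_act g (label_act h p).
Proof. by rewrite /label_act /= invMg mulgA. Qed.

Lemma label_actK g p : label_act (sym_inv g) (label_act g p) = p.
Proof. by case: p => c s; rewrite /label_act /= invgK mulgKV. Qed.

(** The extension with [dl = 0] and [f = 0]. Symmetries keep colours and a simplex has distinct
    ones, so a symmetry fixing a simplex fixes its labels; it is then trivial on leaves and, by
    [faithful], on chains. *)
Lemma label_chain_map : exists Psi : {set label} -> chain, forall A, simplex A ->
  [/\ homogeneous #|A|.-1 (Psi A), boundary (Psi A) = \sum_(B <- simplex_faces A) Psi B,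
      #|A| = 1%N -> level_sum 0 (Psi A) = 1 &
      forall g, GP g -> Psi (simplex_act g A) = chain_act g (Psi A)].
Proof.
have cardA A : simplex A -> (0 < #|A|)%N by case; rewrite card_gt0.
have [|||||||||||||||H HP] := @equivariant_extension V I GP GP1 GPM GPV {set label} (fun A => #|A|.-1) simplex_faces
  simplex simplex_act _ _ _ _ _ _ _ _ _ #|{: 'I_m * {perm I}}| (fun=> 0) 0%N.
- move=> A; rewrite /simplex_act -[RHS]imset_id; apply: eq_imset => -[c s].
  by rewrite /label_act /= invg1 mulg1.
- move=> g h A; rewrite /simplex_act -imset_comp; apply: eq_imset => p.
  exact: label_actM.
- move=> g A; rewrite /simplex_act -imset_comp -[RHS]imset_id; apply: eq_imset => p.
  exact: label_actK.
- move=> g A _ [A0 Ai]; split.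
    by rewrite -card_gt0 card_imset ?card_gt0 //; apply: label_act_inj.
  by move=> _ _ /imsetP[p pA ->] /imsetP[q qA ->] /= /Ai ->.
- by move=> g A; rewrite card_imset //; apply: label_act_inj.
- move=> g A gG [A0 Ai] gA; apply: faithful => //.
  have /set0Pn[[c s] pA] := A0.
  have gp : label_act g (c, s) \in A by rewrite -gA; apply: imset_f.
  have /(Ai _ _ gp pA)[] : (label_act g (c, s)).1 = (c, s).1 by [].
  move=> E; apply/invg_inj; apply: (mulgI s); by rewrite E invg1 mulg1.
- move=> A B SA; rewrite /simplex_faces; case: eqP => // A1 /mapP[p].
  rewrite mem_enum => pA ->; have := cardsD1 p A; rewrite pA => cA.
  have := cardA A SA; split; last by lia.
  split; first by rewrite -card_gt0; lia.
  case: SA => _ Ai q r; rewrite !inE => /andP[_ qA] /andP[_ rA]; exact: Ai.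
- move=> g A F gG SA.
  rewrite -(big_map (simplex_act g) xpredT F); apply: perm_big.
  rewrite /simplex_faces /simplex_act card_imset; last exact: label_act_inj.
  case: eqP => // _; rewrite -map_comp.
  apply: (@perm_trans _ [seq (label_act g @: A) :\ label_act g p | p <- enum A]).
    have -> : [seq (label_act g @: A) :\ label_act g p | p <- enum A] =
      [seq (label_act g @: A) :\ q | q <- [seq label_act g p | p <- enum A]] by rewrite -map_comp.
    apply: perm_map.
    apply: uniq_perm; rewrite ?enum_uniq ?map_inj_uniq ?enum_uniq //; first exact: label_act_inj.
    by move=> q; rewrite mem_enum; apply/imsetP/mapP => -[p]; rewrite ?mem_enum => pA ->;
      exists p; rewrite ?mem_enum.
  have -> : [seq (label_act g @: A) :\ label_act g p | p <- enum A] =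
    [seq simplex_act g (A :\ p) | p <- enum A]; last exact: perm_refl.
  apply: eq_map => p; apply/setP => q; rewrite !inE /=.
  apply/andP/imsetP => [[qp /imsetP[r rA qE]]|[r]].
    exists r => //; rewrite !inE rA andbT; apply: contra qp => /eqP rp.
    by rewrite qE rp.
  rewrite !inE => /andP[rp rA] ->; split; last exact: imset_f.
  by rewrite (inj_eq (@label_act_inj g)).
- move=> A SA H; rewrite /simplex_faces; case: eqP => A1; first by rewrite big_nil.
  rewrite big_map.
  (* The vertices of an edge have no faces, so here the inner sums are empty instead of
     cancelling. *)
  have [A2|A2] := eqVneq #|A| 2%N.
    rewrite big_seq big1 // => p; rewrite mem_enum => pA.
    have cA : #|A :\ p| = 1%N by have := cardsD1 p A; rewrite pA A2; lia.
    by rewrite cA eqxx big_nil.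
  rewrite big_seq (eq_bigr (fun p => \sum_(q in A | q != p) H (A :\ p :\ q))); last first.
    move=> p; rewrite mem_enum => pA; have := cardsD1 p A; rewrite pA => cA.
    rewrite ifN; last by have := cardA A SA; lia.
    rewrite big_map big_enum /=; apply: eq_bigl => q.
    by rewrite !inE andbC.
  rewrite -big_seq big_enum /=.
  pose G p q := if q != p then H (A :\ p :\ q) else 0.
  rewrite (eq_bigr (fun p => \sum_(q in A) G p q)); last first.
    by move=> p pA; rewrite -big_mkcondr.
  rewrite (sum_symmetric (@chain_addxx V)); last first.
    move=> p q pq; by rewrite /G eq_sym pq setDDl setUC -setDDl.
  by rewrite big1 // => p _; rewrite /G eqxx.
- by move=> A _; apply: leq_trans (leq_pred _) (max_card _).
- by [].
- by move=> A _ _; apply: homogeneous0.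
- by move=> A _; rewrite boundary0 big1.
- by [].
- move=> A SA; rewrite addn0 level_sum0 add0r /simplex_faces => cA.
  have -> : #|A| = 2%N by have := cardA A SA; lia.
  rewrite /= size_map -cardE; have -> : #|A| = 2%N by have := cardA A SA; lia.
  exact/val_inj.
exists H => A SA; have [H1 H2 H3 H4] := HP A SA; rewrite addn0 in H1 H3; split=> //.
  by rewrite H2 add0r.
by move=> cA; apply: H3; rewrite cA.
Qed.

End LabelSimplices.

(** * Boundaries of ordered tuples *)

Section Deletions.
Import GRing.Theory.
Local Open Scope ring_scope.

(** The simplicial boundary modulo 2 on ordered tuples. Entries are removed by position, so equal
    entries count separately. *)
Fixpoint deletions (P : Type) (C : zmodType) (F : seq P -> C) (l : seq P) : C :=
  if l is p :: l' then F l' + deletions (fun s => F (p :: s)) l' else 0.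

Lemma deletions_eq0 (P : Type) (C : zmodType) (F : seq P -> C) l :
  (forall s, F s = 0) -> deletions F l = 0.
Proof. by elim: l F => //= p l IH F F0; rewrite F0 add0r IH. Qed.

Lemma deletions_cat (P : Type) (C : zmodType) (F : seq P -> C) a b :
  deletions F (a ++ b) = deletions (fun s => F (s ++ b)) a + deletions (fun s => F (a ++ s)) b.
Proof. by elim: a F => [|p a IH] F /=; rewrite ?add0r // IH addrA. Qed.

Lemma deletions_sum (P : Type) (C : zmodType) (J : Type) (r : seq J) (Q : pred J)
    (F : J -> seq P -> C) l :
  deletions (fun s => \sum_(i <- r | Q i) F i s) l = \sum_(i <- r | Q i) deletions (F i) l.
Proof.
elim: l F => [|p l IH] F /=; first by rewrite big1.
by rewrite (IH (fun i s => F i (p :: s))) big_split.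
Qed.

Lemma deletions_map (P Q : Type) (C : zmodType) (f : P -> Q) (F : seq Q -> C) l :
  deletions F (map f l) = deletions (fun s => F (map f s)) l.
Proof. by elim: l F => //= p l IH F; rewrite IH. Qed.

Lemma deletions_uniq (P : eqType) (C : zmodType) (F : seq P -> C) l :
  uniq l -> deletions F l = \sum_(p <- l) F (rem p l).
Proof.
elim: l F => [|p l IH] F /=; first by rewrite big_nil.
move=> /andP[pl ul]; rewrite big_cons eqxx IH //; congr (_ + _).
rewrite [LHS]big_seq [RHS]big_seq; apply: eq_bigr => q ql.
by case: eqP => // E; rewrite E ql in pl.
Qed.

End Deletions.

(** * Chains of tuples of labels *)

Section LabelLists.
Import GRing.Theory.
Local Open Scope ring_scope.
Variables (V I : finType) (GP : symmetry V I -> Prop) (m : nat).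
Local Notation chain := (cell V -> 'F_2).
Local Notation label := (label I m).
Variable Psi : {set label} -> chain.
Hypothesis PsiP : forall A, simplex A ->
  [/\ homogeneous #|A|.-1 (Psi A), boundary (Psi A) = \sum_(B <- simplex_faces A) Psi B,
      #|A| = 1%N -> level_sum 0 (Psi A) = 1 &
      forall g, GP g -> Psi (simplex_act g A) = chain_act g (Psi A)].

(** Tuples with a repeated colour are degenerate and vanish, as in normalised simplicial chains. *)
Definition label_chain (l : seq label) : chain :=
  if (l != [::]) && uniq (map fst l) then Psi [set p in l] else 0.
Definition consistent (l : seq label) := forall p q, p \in l -> q \in l -> p.1 = q.1 -> p = q.

Lemma uniq_keys_simplex (l : seq label) : l != [::] -> uniq (map fst l) -> simplex (I := I) (m := m) [set p in l].
Proof.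
move=> l0 ul; split.
  by case: l l0 {ul} => // p l _; apply/set0Pn; exists p; rewrite !inE eqxx.
move=> p q; rewrite !inE => pl ql E.
have ip : (index p l < size (map fst l))%N by rewrite size_map index_mem.
have iq : (index q l < size (map fst l))%N by rewrite size_map index_mem.
have := nth_uniq p.1 ip iq ul; rewrite !(nth_map p) ?index_mem // !nth_index // E eqxx.
by move=> /esym /eqP i_eq; rewrite -(nth_index p pl) i_eq nth_index.
Qed.

Lemma card_keys (l : seq label) : uniq (map fst l) -> #|[set p in l]| = size l.
Proof. by move=> /map_uniq /card_uniqP <-; rewrite cardsE. Qed.

Lemma label_chain_homogeneous l : homogeneous (size l).-1 (label_chain l).
Proof.
rewrite /label_chain; case: ifP => [/andP[l0 ul]|_]; last exact: homogeneous0.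
by have [h _ _ _] := PsiP (uniq_keys_simplex l0 ul); rewrite -card_keys.
Qed.

Lemma label_chain_act g l : GP g ->
  label_chain (map (label_act g) l) = chain_act g (label_chain l).
Proof.
move=> gG; rewrite /label_chain.
have -> : map fst (map (label_act g) l) = map fst l by rewrite -map_comp.
have -> : (map (label_act g) l != [::]) = (l != [::]) by case: l.
case: ifP => [/andP[l0 ul]|_] //.
have [_ _ _ /(_ g gG) <-] := PsiP (uniq_keys_simplex l0 ul); congr Psi.
apply/setP => q; rewrite inE; apply/mapP/imsetP => -[p pl ->]; exists p => //.
  by rewrite inE.
by rewrite inE in pl.
Qed.

(** Pigeonhole on the [m] colours; here the dimension of the join enters. *)
Lemma label_chain_long l : (m < size l)%N -> label_chain l = 0.
Proof.
move=> ml; rewrite /label_chain; case: ifP => // /andP[_ ul].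
have sub : {subset map fst l <= enum 'I_m} by move=> c _; rewrite mem_enum.
by have := uniq_leq_size ul sub; rewrite size_map size_enum_ord leqNgt ml.
Qed.

Lemma label_chain1 p : level_sum 0 (label_chain [:: p]) = 1.
Proof.
rewrite /label_chain /=; have [_ _ h _] := PsiP (uniq_keys_simplex (l := [:: p]) isT isT).
by apply: h; rewrite card_keys.
Qed.

Lemma label_chain_perm l l' : perm_eq l l' -> label_chain l = label_chain l'.
Proof.
move=> pl; rewrite /label_chain (perm_uniq (perm_map fst pl)) -!size_eq0 (perm_size pl).
by case: ifP => // _; congr Psi; apply/setP => p; rewrite !inE (perm_mem pl).
Qed.

Lemma dup_key_split (l : seq label) : consistent l -> ~~ uniq (map fst l) ->
  exists p l1 l2 l3, l = l1 ++ p :: l2 ++ p :: l3.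
Proof.
elim: l => //= p l IH cl; rewrite negb_and negbK => /orP[/mapP[q ql pq]|ul].
  have E : p = q by apply: cl => //; rewrite !inE ?eqxx ?ql ?orbT.
  case/splitPr: ql => l2 l3; exists p, [::], l2, l3; by rewrite E.
have [|q [l1 [l2 [l3 ->]]]] := IH _ ul; last by exists q, (p :: l1), l2, l3.
by move=> x y xl yl; apply: cl; rewrite inE ?xl ?yl orbT.
Qed.

Lemma label_chain_dup p a b c : label_chain (a ++ p :: b ++ p :: c) = 0.
Proof.
rewrite /label_chain ifF //; apply/negbTE; rewrite negb_and; apply/orP; right.
rewrite map_cat cat_uniq /= map_cat /= mem_cat !inE eqxx !orbT /=.
by rewrite !andbF.
Qed.

(** In a degenerate tuple, consistency turns a repeated colour into a repeated label [p]. Deleting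
    either copy of [p] leaves the same tuple up to order, and every other deletion is still
    degenerate, so the two remaining terms cancel. *)
Lemma boundary_label_chain l : consistent l -> boundary (label_chain l) = deletions label_chain l.
Proof.
move=> cl; have [ul|nul] := boolP (uniq (map fst l)); last first.
  have [p [a [b [c E]]]] := dup_key_split cl nul.
  rewrite E label_chain_dup boundary0 deletions_cat /= deletions_cat /=.
  rewrite deletions_eq0 ?add0r => [|s]; last exact: label_chain_dup.
  rewrite (deletions_eq0 (F := fun s => label_chain (a ++ p :: s ++ p :: c))) => [|s]; last first.
    exact: label_chain_dup.
  rewrite (deletions_eq0 (F := fun s => label_chain (a ++ p :: b ++ p :: s))) => [|s]; last first.
    exact: label_chain_dup.
  rewrite addr0 add0r (@label_chain_perm (a ++ b ++ p :: c) (a ++ p :: b ++ c)) ?chain_addxx //.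
  by rewrite perm_cat2l perm_catC /= perm_cons perm_catC.
case: (posnP (size l)) => [/size0nil ->|l0]; first by rewrite /label_chain /= boundary0.
have lnil : l != [::] by rewrite -size_eq0 -lt0n.
rewrite deletions_uniq; last exact: map_uniq ul.
rewrite {1}/label_chain lnil ul /=.
have [_ -> _ _] := PsiP (uniq_keys_simplex lnil ul); rewrite /simplex_faces card_keys //.
case: eqP => sl.
  rewrite big_nil; case: l sl {cl ul l0 lnil} => // p [] // _.
  by rewrite big_seq1 /= eqxx.
rewrite big_map.
have pe : perm_eq (enum [set p in l]) l.
  apply: uniq_perm; rewrite ?enum_uniq ?(map_uniq ul) // => p.
  by rewrite mem_enum inE.
rewrite (perm_big _ pe) /= [LHS]big_seq [RHS]big_seq; apply: eq_bigr => p pl.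
rewrite /label_chain ifT.
  by congr Psi; apply/setP => q; rewrite !inE mem_rem_uniq ?inE // (map_uniq ul).
rewrite -size_eq0 size_rem // -lt0n; apply/andP; split; first by case: (size l) sl l0 => [|[|]].
exact: subseq_uniq (map_subseq _ (rem_subseq p l)) ul.
Qed.

End LabelLists.

(** * Subdivided cubes as sums over flags *)

Section Walks.
Import GRing.Theory.
Local Open Scope ring_scope.
Variables (V T : finType) (P : Type).
Local Notation chain := (cell V -> 'F_2).
Variable mv : T -> bool -> P -> P.

(* The sum of [F] over all flags that start at [p] and successively perturb each of the [j]
   coordinates of [A] once, in all possible orders and both directions. *)
Fixpoint walk (F : seq P -> chain) j (A : {set T}) p l : chain :=
  if j is j'.+1 then \sum_(c in A) \sum_(b : bool) walk F j' (A :\ c) (mv c b p) (p :: l)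
  else F (p :: l).
(** Flags without their first point [p]; they subdivide the facets of the cube about [p]. *)
Definition walk_tail (F : seq P -> chain) j (A : {set T}) p l : chain :=
  if j is j'.+1 then \sum_(c in A) \sum_(b : bool) walk F j' (A :\ c) (mv c b p) l else F l.

Lemma walk_ind (Z : chain -> Prop) (F : seq P -> chain) n j (A : {set T}) p l :
  Z 0 -> (forall x y, Z x -> Z y -> Z (x + y)) ->
  (forall s, size s = n -> Z (F s)) -> (size l + j.+1 = n)%N -> Z (walk F j A p l).
Proof.
move=> Z0 ZD ZF; elim: j A p l => [|j IH] A p l E /=; first by apply: ZF => /=; lia.
apply: (big_ind Z) => // c _; apply: (big_ind Z) => // b _; apply: IH => /=; lia.
Qed.

Variables (K : P -> Prop) (Inv : {set T} -> P -> Prop).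
Hypothesis InvK : forall A p, Inv A p -> K p.
Hypothesis Inv_mv : forall A p c b, Inv A p -> c \in A -> Inv (A :\ c) (mv c b p).

(** Omitting an inner point of a flag pairs the two orders of the perturbations around it, and
    omitting the last point pairs the two directions of the last perturbation. What survives is the
    removal of [p] and of the earlier points [l]. *)
Lemma boundary_walk (F : seq P -> chain) j (A : {set T}) p l :
  (forall c c' b b' q, c != c' -> mv c' b' (mv c b q) = mv c b (mv c' b' q)) ->
  (forall s, List.Forall K s -> boundary (F s) = deletions F s) ->
  #|A| = j -> Inv A p -> List.Forall K l ->
  boundary (walk F j A p l) = walk_tail F j A p l + deletions (walk F j A p) l.
Proof.
move=> mvC dF; elim: j A p l => [|j IH] A p l cA iA Kl /=.
  by rewrite dF //; constructor => //; apply: InvK iA.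
rewrite boundary_sum.
rewrite (eq_bigr (fun c => \sum_(b : bool) walk_tail F j (A :\ c) (mv c b p) (p :: l) +
   \sum_(b : bool) (walk F j (A :\ c) (mv c b p) l +
     deletions (fun s => walk F j (A :\ c) (mv c b p) (p :: s)) l))); last first.
  move=> c cIA; rewrite boundary_sum -big_split; apply: eq_bigr => b _ /=.
  have := cardsD1 c A; rewrite cIA cA => -[cA'].
  by rewrite IH /=; [|by rewrite cA'|exact: Inv_mv|constructor=> //; apply: InvK iA].
rewrite big_split /= [X in X + _](_ : _ = 0) ?add0r; last first.
  case: j cA {IH} => [|j] cA /=.
    by rewrite big1 // => c _; rewrite big_bool /= chain_addxx.
  pose G c c' := if c' != c then \sum_(b : bool) \sum_(b' : bool)
     walk F j (A :\ c :\ c') (mv c' b' (mv c b p)) (p :: l) else 0.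
  rewrite (eq_bigr (fun c => \sum_(c' in A) G c c')); last first.
    move=> c cIA; rewrite exchange_big /= [RHS](bigD1 c) //= {1}/G eqxx add0r.
    apply: eq_big => [c'|c']; first by rewrite !inE andbC.
    by rewrite !inE => /andP[nc _]; rewrite /G nc.
  rewrite (sum_symmetric (@chain_addxx V)).
    by rewrite big1 // => c _; rewrite /G eqxx.
  move=> c c' cc'; rewrite /G eq_sym cc' exchange_big /=; apply: eq_bigr => b _.
  by apply: eq_bigr => b' _; rewrite setDDl setUC -setDDl mvC // eq_sym.
rewrite deletions_sum -big_split; apply: eq_bigr => c _ /=.
by rewrite deletions_sum -big_split.
Qed.

Lemma walk_transport (F F2 : seq P -> chain) (th : P -> P) (ph : T -> T) (r : T -> bool)
    j (A : {set T}) p l :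
  injective ph ->
  (forall B q c b, Inv B q -> c \in B -> th (mv c b q) = mv (ph c) (b (+) r c) (th q)) ->
  (forall s, List.Forall K s -> F s = F2 (map th s)) ->
  Inv A p -> List.Forall K l ->
  walk F j A p l = walk F2 j (ph @: A) (th p) (map th l).
Proof.
move=> phI thmv FF; elim: j A p l => [|j IH] A p l iA Kl /=.
  by rewrite FF //; constructor=> //; apply: InvK iA.
rewrite big_imset /=; last by move=> x y _ _; apply: phI.
apply: eq_bigr => c cA.
have -> : (ph @: A) :\ ph c = ph @: (A :\ c).
  apply/setP => x; rewrite !inE; apply/andP/imsetP => [[xc /imsetP[y yA xE]]|[y]].
    exists y => //; rewrite !inE yA andbT; by apply: contra xc => /eqP yc; rewrite xE yc.
  by rewrite !inE => /andP[yc yA] ->; rewrite (inj_eq phI) yc imset_f.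
have -> (f : bool -> chain) : \sum_(b : bool) f b = \sum_(b : bool) f (b (+) r c).
  by rewrite !big_bool; case: (r c) => //=; rewrite addrC.
apply: eq_bigr => b _.
rewrite IH /=; [|exact: Inv_mv|by constructor=> //; apply: InvK iA].
by rewrite (thmv A) //; case: b; case: (r c).
Qed.

End Walks.

(** * Grid subdivisions of a cube *)

Lemma INR_addn (m n : nat) : INR (m + n) = (INR m + INR n)%re.
Proof. exact: plus_INR. Qed.

Lemma INR_muln (m n : nat) : INR (m * n) = (INR m * INR n)%re.
Proof. exact: mult_INR. Qed.

Lemma INR_subn (m n : nat) : (n <= m)%N -> INR (m - n) = (INR m - INR n)%re.
Proof. by move=> /leP; apply: minus_INR. Qed.

Section Grid.
Import GRing.Theory.
Local Open Scope ring_scope.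
Variables (V T : finType) (M : nat).
Local Notation chain := (cell V -> 'F_2).
Local Notation point := (T -> R).
Hypothesis M_odd : odd M.

Definition set_coord (t : point) (c : T) (r : R) : point := fun d => if d == c then r else t d.
(** Half the side of a grid cube: centres are odd multiples of [mesh], walls are even ones. *)
Definition mesh : R := (/ (2 * INR M))%re.
Definition shift (c : T) (b : bool) (t : point) : point :=
  set_coord t c (if b then (t c + mesh)%re else (t c - mesh)%re).
Definition center (i : nat) : R := (INR (2 * i + 1) * mesh)%re.
Definition grid_point (A : {set T}) (t0 : point) (q : {ffun T -> 'I_M}) : point :=
  fun c => if c \in A then center (q c) else t0 c.
(** [q] also ranges over the coordinates outside [A], which [grid_point] ignores. Each term is
    repeated a power of [M] times, an odd number, and all faces share one index set. *)
Definition grid_sum (F : seq point -> chain) (A : {set T}) (t0 : point) : chain :=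
  \sum_(q : {ffun T -> 'I_M}) walk shift F #|A| A (grid_point A t0 q) [::].
Definition unit_cube (t : point) := forall c, (0 <= t c <= 1)%re.
Definition near_center (b p : point) :=
  unit_cube p /\ forall c, (Rabs (p c - b c) <= mesh)%re.

Lemma M_pos : (0 < INR M)%re.
Proof. by apply: lt_0_INR; case: M M_odd => // m _; lia. Qed.

Lemma mesh_pos : (0 < mesh)%re.
Proof. by apply: Rinv_0_lt_compat; have := M_pos; lra. Qed.

Lemma meshM : (2 * INR M * mesh = 1)%re.
Proof. by rewrite /mesh; field; have := M_pos; lra. Qed.

Lemma centerE i : center i = ((2 * INR i + 1) * mesh)%re.
Proof. by rewrite /center INR_addn INR_muln. Qed.

Lemma center_bound (i : 'I_M) : (mesh <= center i <= 1 - mesh)%re.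
Proof.
have h := mesh_pos; rewrite centerE.
have i0 := pos_INR i.
have iM : (INR i + 1 <= INR M)%re.
  by rewrite -S_INR; apply: le_INR; apply/leP.
have E := meshM; split; first by nra.
suff : ((2 * (INR i + 1)) * mesh <= 1)%re by lra.
by rewrite -E; apply: Rmult_le_compat_r; lra.
Qed.

Lemma center_rev (i : 'I_M) : (1 - center i)%re = center (rev_ord i).
Proof.
rewrite !centerE (_ : nat_of_ord (rev_ord i) = (M - i.+1)%N) //.
by rewrite INR_subn // S_INR -meshM /=; ring.
Qed.

Lemma shiftC c c' b b' t : c != c' -> shift c' b' (shift c b t) = shift c b (shift c' b' t).
Proof.
move=> cc'; apply/funext => d; rewrite /shift /set_coord.
case: (eqVneq d c') => [->|dc']; first by rewrite [c' == c]eq_sym (negbTE cc').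
by case: eqP => // _; rewrite (negbTE cc').
Qed.

(** Isolates the grid index in direction [c] at the price of an [M]-fold repetition: exchanging [i]
    with [q c] leaves constant inner sums of odd length. *)
Lemma sum_set_coord (C : zmodType) (c : T) (G : {ffun T -> 'I_M} -> C) :
  (forall x : C, x + x = 0) ->
  \sum_q G q = \sum_(q : {ffun T -> 'I_M}) \sum_(i : 'I_M) G [ffun d => if d == c then i else q d].
Proof.
move=> char2; rewrite pair_big /=.
pose h (x : {ffun T -> 'I_M} * 'I_M) := ([ffun d => if d == c then x.2 else x.1 d], x.1 c).
have hK : involutive h.
  move=> [q i]; rewrite /h /= ffunE eqxx; congr (_, _); apply/ffunP => d; rewrite !ffunE.
  by case: eqP => [->|].
rewrite (reindex_inj (inv_inj hK)) /= -(pair_bigA _ (fun (q : {ffun T -> 'I_M}) i => G [ffun d => if d == c then q c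
   else [ffun d0 => if d0 == c then i else q d0] d])) /=.
apply: eq_bigr => q _; rewrite -[LHS](sum_const_odd char2 (T := 'I_M)) ?card_ord //.
apply: eq_bigr => i _; congr G; apply/ffunP => d; rewrite !ffunE.
by case: eqP => [->|].
Qed.

Lemma telescope (C : zmodType) (g : nat -> C) n : (forall x : C, x + x = 0) ->
  \sum_(i < n) (g i + g i.+1) = g 0%N + g n.
Proof.
move=> char2; elim: n => [|n IH]; first by rewrite big_ord0 char2.
by rewrite big_ord_recr /= IH addrA -[X in X + _]addrA char2 addr0.
Qed.

(** Neighbouring grid cubes share a facet, so in each direction the sum over grid positions
    telescopes to the two outer facets. *)
Lemma grid_sum_boundary (F : seq point -> chain) A t0 : unit_cube t0 -> F [::] = 0 ->
  (forall b s, List.Forall (near_center b) s -> boundary (F s) = deletions F s) ->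
  boundary (grid_sum F A t0) = \sum_(c in A)
    (grid_sum F (A :\ c) (set_coord t0 c 0%re) + grid_sum F (A :\ c) (set_coord t0 c 1%re)).
Proof.
move=> t01 F0 dF; rewrite /grid_sum boundary_sum.
rewrite (eq_bigr (fun q => \sum_(c in A) \sum_(b : bool)
   walk shift F #|A :\ c| (A :\ c) (shift c b (grid_point A t0 q)) [::])); last first.
  move=> q _; pose bp := grid_point A t0 q.
  (* Directions still to be perturbed are at their central value, so a flag stays in the unit cube
     and within [mesh] of the centre. *)
  pose Inv (B : {set T}) (p : point) := [/\ B \subset A, near_center bp p & forall c, c \in B -> p c = bp c].
  have bpA c : c \in A -> (mesh <= bp c <= 1 - mesh)%re.
    by rewrite /bp /grid_point => ->; apply: center_bound.
  have h := mesh_pos.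
  rewrite (boundary_walk (K := near_center bp) (Inv := Inv)) //=.
  - rewrite addr0 /walk_tail; case E: #|A| => [|j].
      by rewrite F0 (cards0_eq E) big_set0.
    apply: eq_bigr => c cA; have -> // : #|A :\ c| = j.
    by have := cardsD1 c A; rewrite cA E => -[].
  - by move=> B p [].
  - move=> B p c b [BA [pc pb] pB] cB; split.
    + by apply: subset_trans BA; apply: subsetDl.
    + have cE := bpA c (subsetP BA _ cB); have pcE := pB c cB.
      split=> d; rewrite /shift /set_coord; case: eqP => [E|_] //.
        by case: b; lra.
      by rewrite pcE E; case: b; apply: Rabs_le; lra.
    + move=> d; rewrite !inE => /andP[dc dB]; rewrite /shift /set_coord (negbTE dc).
      exact: pB.
  - exact: shiftC.
  - exact: dF.
  - split=> // ; split=> c; last by rewrite Rminus_diag Rabs_R0; lra.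
    rewrite /bp /grid_point; case: ifP => // cA.
    by have := center_bound (q c); lra.
rewrite exchange_big /=; apply: eq_bigr => c cA.
rewrite (sum_set_coord c _ (@chain_addxx V)) -big_split; apply: eq_bigr => q _ /=.
(* The contribution of the wall at height [2 * i * mesh] in direction [c]. *)
pose g i := walk shift F #|A :\ c| (A :\ c)
  (grid_point (A :\ c) (set_coord t0 c (2 * INR i * mesh)%re) q) [::].
have g0 : set_coord t0 c 0%re = set_coord t0 c (2 * INR 0 * mesh)%re.
  by rewrite /= Rmult_0_r Rmult_0_l.
have gM : set_coord t0 c 1%re = set_coord t0 c (2 * INR M * mesh)%re.
  by rewrite meshM.
rewrite g0 gM -/(g 0%N) -/(g M) -(telescope g M (@chain_addxx V)).
apply: eq_bigr => i _; rewrite big_bool /= addrC; congr (_ + _); rewrite /g ?S_INR; congr walk;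
  apply/funext => d; rewrite /shift /set_coord /grid_point !inE !ffunE eqxx cA;
  case: eqP => //= _; rewrite ?centerE; ring.
Qed.

Lemma grid_sum_ind (Z : chain -> Prop) (F : seq point -> chain) (A : {set T}) t0 :
  Z 0 -> (forall x y, Z x -> Z y -> Z (x + y)) ->
  (forall s, size s = #|A|.+1 -> Z (F s)) -> Z (grid_sum F A t0).
Proof.
move=> Z0 ZD ZF; apply: (big_ind Z) => // q _.
exact: (@walk_ind V T _ shift Z F #|A|.+1).
Qed.

Lemma grid_sum0 (F : seq point -> chain) t0 : grid_sum F set0 t0 = F [:: t0].
Proof.
rewrite /grid_sum cards0 /=.
rewrite (eq_bigr (fun=> F [:: t0])) => [|q _]; last first.
  by congr (F [:: _]); apply/funext => c; rewrite /grid_point inE.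
by rewrite (sum_const_odd (@chain_addxx V)) // card_ffun card_ord oddX M_odd orbT.
Qed.

(* Symmetries of the cube: permuting coordinates by [ph] and reflecting those with [r] set. *)
Lemma grid_sum_transport (F F2 : seq point -> chain) (A : {set T}) (t0 t2 : point)
    (ph : {perm T}) (r : T -> bool) (th : point -> point) : unit_cube t0 ->
  (forall p, th p = fun d => let c := (ph^-1)%g d in
     if c \in A then (if r c then (1 - p c)%re else p c) else t2 d) ->
  (forall s, List.Forall (fun p => unit_cube p /\ forall c, c \notin A -> p c = t0 c) s ->
     F s = F2 (map th s)) ->
  grid_sum F A t0 = grid_sum F2 (ph @: A) t2.
Proof.
move=> t01 thE FF; rewrite /grid_sum card_imset; last exact: perm_inj.
pose k (q : {ffun T -> 'I_M}) : {ffun T -> 'I_M} :=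
  [ffun d => let c := (ph^-1)%g d in if r c then rev_ord (q c) else q c].
have kI : injective k.
  move=> q q' /ffunP E; apply/ffunP => c; have := E (ph c); rewrite !ffunE /= permK.
  by case: ifP => // _; apply: rev_ord_inj.
rewrite [RHS](reindex_inj kI); apply: eq_bigr => q _.
pose K (p : point) := unit_cube p /\ forall c, c \notin A -> p c = t0 c.
pose Inv (B : {set T}) (p : point) := [/\ B \subset A, K p &
  forall c, c \in B -> (mesh <= p c <= 1 - mesh)%re].
have h := mesh_pos.
rewrite (@walk_transport V T _ shift K Inv _ _ F F2 th ph r) //.
- congr walk; rewrite thE; apply/funext => d /=; rewrite /grid_point ffunE /=.
  have -> : (d \in ph @: A) = ((ph^-1)%g d \in A).
    by rewrite -{1}(permKV ph d) (mem_imset _ _ (@perm_inj _ ph)).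
  by case: ifP => // cA; case: (r _); rewrite ?cA ?center_rev.
- by move=> B p [].
- move=> B p c b [BA [p1 pA] pB] cB; have cA := subsetP BA _ cB; have pc := pB c cB; split.
  + by apply: subset_trans BA; apply: subsetDl.
  + split=> d; rewrite /shift /set_coord; case: eqP => [E|_] //; try by case: b; lra.
      by rewrite E cA.
    exact: pA.
  + move=> d; rewrite !inE => /andP[dc dB]; rewrite /shift /set_coord (negbTE dc).
    exact: pB.
- exact: perm_inj.
- move=> B p c b [BA [p1 pA] pB] cB; have cA := subsetP BA _ cB.
  rewrite !thE; apply/funext => d /=; rewrite /shift /set_coord permK cA.
  have -> : (d == ph c) = ((ph^-1)%g d == c).
    by rewrite -{1}(permKV ph d) (inj_eq perm_inj).
  case: (eqVneq ((ph^-1)%g d) c) => [->|//]; rewrite cA.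
  by case: (r c); case: b => /=; ring.
split=> //; last by move=> c cA; rewrite /grid_point cA; exact: center_bound.
split=> c; rewrite /grid_point; last by move=> /negbTE ->.
by case: ifP => // _; have [? ?] := center_bound (q c); split; apply: Rle_trans; eauto; lra.
Qed.

End Grid.

(** * Polynomial coordinates on spheres *)

Section SphereCoordinates.
Local Open Scope R_scope.

Lemma Rabs_le_inv a b : Rabs a <= b -> - b <= a <= b.
Proof. by have := Rle_abs a; have := Rle_abs (- a); rewrite Rabs_Ropp; lra. Qed.

(* Half-turn coordinates: the [i]-th angle runs over [0, 1], and the vector of the first [N]
   angles is rotated half a turn about the new axis as the next angle runs from 0 to 1. *)
Fixpoint sphere_coord (N : nat) (u : nat -> R) (l : nat) : R :=
  match N with
  | 0%N => if l is 0%N then 1 else 0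
  | N'.+1 => if l == N'.+1 then 1 - (1 - 2 * u N') * (1 - 2 * u N')
             else (1 - 2 * u N') * sphere_coord N' u l
  end.

Lemma sphere_coord_ext N u u' l : (forall i, (i < N)%N -> u i = u' i) ->
  sphere_coord N u l = sphere_coord N u' l.
Proof.
elim: N => //= N IH E; rewrite E // IH // => i iN; apply: E; exact: ltnW.
Qed.

(** Passing from [u i = 0] to [u i = 1] negates the vector built so far; complementing the next
    angle negates it again and leaves the entry containing a square unchanged. *)
Lemma sphere_coord_reflect N u u' i l : (i.+1 < N)%N -> u i = 0 -> u' i = 1 ->
  u' i.+1 = 1 - u i.+1 -> (forall d, d != i -> d != i.+1 -> u' d = u d) ->
  sphere_coord N u' l = sphere_coord N u l.
Proof.
move=> iN ui u'i ui1 E; elim: N iN => // N IH; rewrite ltnS leq_eqVlt => /orP[/eqP <-|iN] /=.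
  rewrite ui u'i ui1 (@sphere_coord_ext i u' u); last by move=> d di; apply: E; lia.
  case: eqP => _; first by ring.
  by case: eqP => _; ring.
by rewrite IH // E //; lia.
Qed.

(** The later angles vanish, so nothing compensates the sign acquired at angle [i]. *)
Lemma sphere_coord_flip N u u' i l : (i < N)%N -> u i = 0 -> u' i = 1 ->
  (forall d, d != i -> u' d = u d) -> (forall d, (i < d < N)%N -> u d = 0) ->
  sphere_coord N u' l = - sphere_coord N u l.
Proof.
move=> iN ui u'i E E0; elim: N iN E0 => // N IH; rewrite ltnS leq_eqVlt => /orP[/eqP <-|iN] /= E0.
  rewrite ui u'i (@sphere_coord_ext i u' u); last by move=> d di; apply: E; lia.
  by case: eqP => _; ring.
rewrite IH // => [|d dN]; last by apply: E0; lia.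
rewrite E ?E0; [|lia|lia].
by case: eqP => _; ring.
Qed.

Lemma sphere_coord_le1 N u l : (forall i, 0 <= u i <= 1) -> Rabs (sphere_coord N u l) <= 1.
Proof.
move=> u1; elim: N => [|N IH] /=; first by case: l => [|l]; rewrite ?Rabs_R1 ?Rabs_R0; lra.
have [uN0 uN1] := u1 N; have u_sq := Rmult_le_pos _ _ uN0 (Rge_le _ _ (Rge_minus _ _ (Rle_ge _ _ uN1))).
case: eqP => _.
  by have := Rle_0_sqr (1 - 2 * u N); rewrite /Rsqr => sq; apply: Rabs_le; lra.
rewrite Rabs_mult; have h : Rabs (1 - 2 * u N) <= 1 by apply: Rabs_le; lra.
have c0 := Rabs_pos (1 - 2 * u N); have s0 := Rabs_pos (sphere_coord N u l); nra.
Qed.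

(** The vectors are not normalised. Each angle either keeps at least half of the old entry, or makes
    the new entry at least 3/4; this is the origin of [(/ 2) ^ N]. *)
Lemma sphere_coord_ge N u : (forall i, 0 <= u i <= 1) ->
  exists2 l, (l <= N)%N & (/ 2) ^ N <= Rabs (sphere_coord N u l).
Proof.
move=> u1; elim: N => [|N [l lN IH]]; first by exists 0%N => //=; rewrite Rabs_R1; lra.
have p2 : 0 < (/ 2) ^ N <= 1.
  split; first by apply: pow_lt; lra.
  by elim: (N) => /= [|j]; lra.
have [uN0 uN1] := u1 N; have [p20 p21] := p2; case: (Rle_lt_dec (/ 2) (Rabs (1 - 2 * u N))) => h.
  exists l; first exact: ltnW.
  rewrite /= ifN; last by lia.
  rewrite Rabs_mult; have s0 := Rabs_pos (sphere_coord N u l); nra.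
exists N.+1 => //=; rewrite eqxx; have [h1 h2] := Rabs_def2 _ _ h.
by apply: Rle_trans (Rle_abs _); nra.
Qed.

(** One more angle adds at most [2 * d] to the error of an old entry, and the new entry varies by at
    most [4 * d]. *)
Lemma sphere_coord_lipschitz N u u' l d : (forall i, 0 <= u i <= 1) -> (forall i, 0 <= u' i <= 1) ->
  (forall i, Rabs (u i - u' i) <= d) ->
  Rabs (sphere_coord N u l - sphere_coord N u' l) <= (4 * INR N + 4) * d.
Proof.
move=> u1 u1' ud; have d0 : 0 <= d by apply: Rle_trans (Rabs_pos _) (ud 0%N).
elim: N => [|N IH]; first by rewrite Rminus_diag Rabs_R0 /=; lra.
rewrite S_INR /=; have N0 := pos_INR N; have [uN0 uN1] := u1 N; have [uN0' uN1'] := u1' N.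
have [h1 h2] : -d <= u N - u' N <= d by apply: Rabs_le_inv.
case: eqP => _.
  by apply: Rabs_le; split; nra.
have := sphere_coord_le1 N l u1'; move: IH.
set a := sphere_coord N u l; set b := sphere_coord N u' l => IH b1.
have -> : (1 - 2 * u N) * a - (1 - 2 * u' N) * b = (1 - 2 * u N) * (a - b) - 2 * (u N - u' N) * b.
  by ring.
have [i1 i2] := Rabs_le_inv IH; have [b2 b3] := Rabs_le_inv b1.
have k0 : 0 <= (4 * INR N + 4) * d by nra.
set k := (4 * INR N + 4) * d in k0 i1 i2 *.
have e1 : Rabs ((1 - 2 * u N) * (a - b)) <= k.
  rewrite Rabs_mult; have c1 : Rabs (1 - 2 * u N) <= 1 by apply: Rabs_le; lra.
  have ab : Rabs (a - b) <= k by apply: Rabs_le.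
  have c0 := Rabs_pos (1 - 2 * u N); have s0 := Rabs_pos (a - b); nra.
have e2 : Rabs (2 * (u N - u' N) * b) <= 2 * d.
  rewrite !Rabs_mult (Rabs_right 2); last by lra.
  have dN := ud N; have s0 := Rabs_pos (u N - u' N); have b0 := Rabs_pos b; nra.
have := Rabs_triang ((1 - 2 * u N) * (a - b)) (- (2 * (u N - u' N) * b)).
rewrite Rabs_Ropp /Rminus => e3.
by move: e1 e2 e3; rewrite /k /Rminus; lra.
Qed.

End SphereCoordinates.

(** * Families of configurations over products of spheres *)

Definition coord_index n (c : Fin.t n) : nat := proj1_sig (Fin.to_nat c).

Lemma coord_index_lt n (c : Fin.t n) : (coord_index c < n)%N.
Proof. by rewrite /coord_index; case: (Fin.to_nat c) => i /= /leP. Qed.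

Lemma coord_indexK n l : (l < n)%N -> exists c : Fin.t n, coord_index c = l.
Proof. by move=> /ltP ln; exists (Fin.of_nat_lt ln); rewrite /coord_index Fin.to_nat_of_nat. Qed.

Lemma coord_index_inj n : injective (@coord_index n).
Proof. by move=> c d; apply: Fin.to_nat_inj. Qed.

(** A substitute for unit length, satisfied by the vectors of [sphere_coord] with [beta] equal to
    [(/ 2) ^ N]. *)
Definition admissible (n : nat) (beta : R) (V : Type) (x : V -> Pt n) :=
  forall v, (forall c, (Rabs (x v c) <= 1)%re) /\ exists c, (beta <= Rabs (x v c))%re.

Definition node_act (n : nat) (V I : finType) (g : symmetry V I) (x : V -> Pt n) : V -> Pt n :=
  fun v c => if node_sign g v then (- x (node_perm g v) c)%re else x (node_perm g v) c.

(* A family of configurations of [I] parametrised by one sphere for each node of a binary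
   forest with leaves [I]. *)
Record model (n : nat) (beta : R) (I V : finType) := Model {
  configuration :> (V -> Pt n) -> I -> Pt n;
  separation : R;
  lipschitz : R;
  radius : R;
  separation_pos : (0 < separation)%re;
  lipschitz_pos : (0 < lipschitz)%re;
  separationP : forall x, admissible beta x -> forall i j, i != j ->
    exists c, (separation <= Rabs (configuration x i c - configuration x j c))%re;
  lipschitzP : forall x x' d, (forall v c, (Rabs (x v c - x' v c) <= d)%re) -> (0 <= d)%re ->
    forall i c, (Rabs (configuration x i c - configuration x' i c) <= lipschitz * d)%re;
  radiusP : forall x, admissible beta x -> forall i c, (Rabs (configuration x i c) <= radius)%re;
  configuration_inj : injective configuration;
  flipP : forall v, exists g : symmetry V I,
    [/\ forall x i, configuration (node_act g x) i = configuration x (leaf_perm g i),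
        node_perm g v = v & forall w, node_sign g w = (w == v)] }.

Definition model_symmetry n beta I V (Phi : model n beta I V) (g : symmetry V I) :=
  forall x i, Phi (node_act g x) i = Phi x (leaf_perm g i).

(** * Symmetries of a model and freeness *)

Section ModelSymmetries.
Variables (n : nat) (beta : R) (I V : finType) (Phi : model n.+1 beta I V).
Hypothesis beta_le1 : (beta <= 1)%re.
Local Notation GP := (model_symmetry Phi).

Lemma node_actM (g h : symmetry V I) (x : V -> Pt n.+1) :
  node_act (sym_mul g h) x = node_act g (node_act h x).
Proof.
apply/funext => v; apply/funext => c; rewrite /node_act /= permM.
by case: (node_sign g v); case: (node_sign h _) => //=; rewrite Ropp_involutive.
Qed.

Lemma node_actKV (g : symmetry V I) (x : V -> Pt n.+1) : node_act g (node_act (sym_inv g) x) = x.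
Proof.
apply/funext => v; apply/funext => c; rewrite /node_act /= permK.
by case: (node_sign g v) => //=; rewrite Ropp_involutive.
Qed.

Lemma model_symmetry1 : GP (sym_one V I).
Proof.
move=> x i; rewrite /= perm1; congr (Phi _ i).
by apply/funext => v; apply/funext => c; rewrite /node_act /= perm1.
Qed.

Lemma model_symmetryM g h : GP g -> GP h -> GP (sym_mul g h).
Proof. by move=> Gg Gh x i; rewrite node_actM Gg Gh /= permM. Qed.

Lemma model_symmetryV g : GP g -> GP (sym_inv g).
Proof.
move=> Gg x i; rewrite -{2}(node_actKV g x) Gg /=.
by rewrite permKV.
Qed.

(** Injectivity of the configuration is applied to positive constant vectors that differ from node
    to node: any sign or permutation of nodes would move them. These vectors need not be
    admissible. *)
Lemma leaf_trivial g : GP g -> leaf_perm g = 1%g ->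
  node_perm g = 1%g /\ forall v, node_sign g v = false.
Proof.
move=> Gg g1.
pose x : V -> Pt n.+1 := fun v _ => (INR (enum_rank v) + 1)%re.
have E : node_act g x = x.
  by apply: (@configuration_inj _ _ _ _ Phi); apply/funext => i; rewrite Gg g1 perm1.
have Ev v : node_sign g v = false /\ node_perm g v = v.
  have := congr1 (fun y => y v Fin.F1) E; rewrite /node_act /x.
  have p1 := pos_INR (enum_rank v); have p2 := pos_INR (enum_rank (node_perm g v)).
  case: (node_sign g v); first by lra.
  by move=> h; split=> //; apply: enum_rank_inj; apply/val_inj/INR_eq; exact: Rplus_eq_reg_r h.
by split=> [|v]; [apply/permP => v; rewrite perm1|]; case: (Ev v).
Qed.

Lemma leaf_trivial_chain g : GP g -> leaf_perm g = 1%g ->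
  forall z : cell V -> 'F_2, chain_act g z = z.
Proof.
move=> Gg g1 z; have [q1 s1] := leaf_trivial Gg g1.
apply/funext => e; rewrite /chain_act; congr z.
by apply/ffunP => v; rewrite !ffunE /= q1 invg1 perm1 s1 addbF -surjective_pairing.
Qed.

(** The vectors with all entries 1 or -1, according to the signs of the cell, are fixed by [g], and
    their configuration has separated leaves. *)
Lemma cell_act_free g (e : cell V) : GP g -> cell_act g e = e -> leaf_perm g = 1%g.
Proof.
move=> Gg ge.
pose x : V -> Pt n.+1 := fun v _ => if (e v).2 then 1%re else (- 1)%re.
have ax : admissible beta x.
  by move=> v; split=> [c|]; [|exists Fin.F1]; rewrite /x; case: (e v).2;
    rewrite ?Rabs_Ropp Rabs_R1; lra.
have gx : node_act g x = x.
  apply/funext => v; apply/funext => c; have := congr1 (fun e' : cell V => (e' v).2) ge.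
  rewrite ffunE /= /node_act /x => <-.
  by case: (e _).2; case: (node_sign g v) => //=; rewrite Ropp_involutive.
apply/permP => i; rewrite perm1; apply/eqP; apply: contraT => ni.
have [c] := separationP Phi ax ni; rewrite -Gg gx Rminus_diag Rabs_R0.
by have := separation_pos Phi; lra.
Qed.

End ModelSymmetries.

(** * The obstruction to having few colours *)

Section Obstruction.
Import GRing.Theory.
Local Open Scope ring_scope.
Variables (N m M : nat) (I V : finType).
Local Notation beta := ((/ 2) ^ N)%re.
Variable Phi : model N.+1 beta I V.
Hypothesis M_odd : odd M.
Local Notation T := (V * 'I_N)%type.
Local Notation chain := (cell V -> 'F_2).
Local Notation GP := (model_symmetry Phi).

Definition angles (t : T -> R) (v : V) (i : nat) : R :=
  if insub i is Some i' then t (v, i') else 0%re.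
Definition node_points (s : V -> bool) (t : T -> R) : V -> Pt N.+1 := fun v c =>
  if s v then sphere_coord N (angles t v) (coord_index c)
  else (- sphere_coord N (angles t v) (coord_index c))%re.

Variable lam : (I -> Pt N.+1) -> label I m.
Hypothesis lamG : forall g s t, GP g -> unit_cube t ->
  lam (fun i => Phi (node_points s t) (leaf_perm g i)) = label_act g (lam (Phi (node_points s t))).
(** Points of one grid cube differ by at most [2 * mesh M], so labels are consistent within a
    cube. *)
Hypothesis lam_near : forall s t t', unit_cube t -> unit_cube t' ->
  (forall c, (Rabs (t c - t' c) <= 2 * mesh M)%re) ->
  (lam (Phi (node_points s t))).1 = (lam (Phi (node_points s t'))).1 ->
  lam (Phi (node_points s t)) = lam (Phi (node_points s t')).

Lemma anglesE t v (i : 'I_N) : angles t v i = t (v, i).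
Proof. by rewrite /angles valK. Qed.

Lemma angles_ge t v i : (N <= i)%N -> angles t v i = 0%re.
Proof. by move=> iN; rewrite /angles insubF // ltnNge iN. Qed.

Lemma angles_unit t v i : unit_cube t -> (0 <= angles t v i <= 1)%re.
Proof. by rewrite /angles => t1; case: insubP => [j _ _|_]; [apply: t1|lra]. Qed.

Lemma node_points_admissible s t : unit_cube t -> admissible beta (node_points s t).
Proof.
move=> t1 v; have u1 i := angles_unit v i t1; rewrite /node_points; split=> [c|].
  by case: (s v); rewrite ?Rabs_Ropp; apply: sphere_coord_le1.
have [l lN h] := sphere_coord_ge N u1; have [c cl] := @coord_indexK N.+1 l lN.
by exists c; rewrite cl; case: (s v); rewrite ?Rabs_Ropp.
Qed.

Variable Psi : {set label I m} -> chain.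
Hypothesis PsiP : forall A, simplex A ->
  [/\ homogeneous #|A|.-1 (Psi A), boundary (Psi A) = \sum_(B <- simplex_faces A) Psi B,
      #|A| = 1%N -> level_sum 0 (Psi A) = 1 &
      forall g, GP g -> Psi (simplex_act g A) = chain_act g (Psi A)].

(** A cell is parametrised by the first [(e v).1] angles at each node [v]; the remaining angles are
    zero. *)
Definition active (e : cell V) : {set T} := [set c : T | (c.2 < (e c.1).1)%N].
Definition signs (e : cell V) : V -> bool := fun v => (e v).2.
Definition cube_chain (s : V -> bool) (ps : seq (T -> R)) : chain :=
  label_chain Psi (map (fun t => lam (Phi (node_points s t))) ps).
Definition cell_image (e : cell V) : chain := grid_sum M (cube_chain (signs e)) (active e) (fun=> 0%re).
Definition small (e : cell V) := forall v, ((e v).1 <= N)%N.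

Lemma cube_chain_boundary s b ps : List.Forall (near_center M b) ps ->
  boundary (cube_chain s ps) = deletions (cube_chain s) ps.
Proof.
move=> psb; rewrite (boundary_label_chain PsiP) ?deletions_map //.
have h := @mesh_pos M M_odd.
have near p q : near_center M b p -> near_center M b q ->
  forall c, (Rabs (p c - q c) <= 2 * mesh M)%re.
  move=> [_ pb] [_ qb] c; have [p1 p2] := Rabs_le_inv (pb c).
  by have [q1 q2] := Rabs_le_inv (qb c); apply: Rabs_le; lra.
have memP x : x \in [seq lam (Phi (node_points s t)) | t <- ps] ->
  exists2 t, near_center M b t & x = lam (Phi (node_points s t)).
  elim: ps psb => //= t ps IH tps; rewrite inE; inversion_clear tps.
  by move=> /orP[/eqP ->|/IH]; [exists t|apply].
move=> p q /memP[t tb ->] /memP[t' t'b ->]; apply: lam_near; [by case: tb|by case: t'b|exact: near].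
Qed.

(** For an angle that is not the last active one, reflecting the next angle carries one facet to the
    other without changing the points on the spheres. *)
Lemma face_cube_cancel (e : cell V) (v : V) (i : 'I_N) (c := (v, i)) : (i.+1 < (e v).1)%N -> small e ->
  grid_sum M (cube_chain (signs e)) (active e :\ c) (set_coord (fun=> 0%re) c 0%re) =
  grid_sum M (cube_chain (signs e)) (active e :\ c) (set_coord (fun=> 0%re) c 1%re).
Proof.
move=> iv se; have i1N : (i.+1 < N)%N by apply: leq_trans iv (se v).
pose c' : T := (v, Ordinal i1N); pose A := active e :\ c.
have cc' : c' != c by apply/eqP => /(congr1 (fun d : T => nat_of_ord d.2)) /=; lia.
have c'A : c' \in A by rewrite !inE cc'.
pose th (p : T -> R) : T -> R := fun d => let d' := ((1%g : {perm T})^-1)%g d in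
  if d' \in A then (if d' == c' then (1 - p d')%re else p d') else set_coord (fun=> 0%re) c 1%re d.
rewrite (@grid_sum_transport V _ M M_odd _ (cube_chain (signs e)) A _ (set_coord (fun=> 0%re) c 1%re)
  1%g (fun d => d == c') th) //.
- by congr grid_sum; rewrite (eq_imset _ (@perm1 _)) imset_id.
- by move=> d; rewrite /set_coord; case: eqP => _; lra.
move=> ps Kps; rewrite /cube_chain -map_comp; congr label_chain.
elim: ps Kps => //= p ps IH pps; inversion_clear pps; rewrite IH //; congr (lam (Phi _) :: _).
case: H => p1 pA; apply/funext => w; apply/funext => l; rewrite /node_points.
suff -> : sphere_coord N (angles p w) (coord_index l) =
          sphere_coord N (angles (th p) w) (coord_index l) by [].
have thE d : d != c -> d != c' -> th p d = p d.
  move=> dc dc'; rewrite /th invg1 perm1 /= (negbTE dc'); case: ifP => // /negbT dA.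
  by rewrite pA // /set_coord (negbTE dc).
have pc : p c = 0%re by rewrite pA ?inE ?eqxx // /set_coord eqxx.
have [wv|wv] := eqVneq w v; last first.
  apply: sphere_coord_ext => d dN; rewrite -[d]/(nat_of_ord (Ordinal dN)) !anglesE thE //.
    by apply: contra wv => /eqP[->].
  by apply: contra wv => /eqP[->].
rewrite wv; apply/esym/(@sphere_coord_reflect N _ _ i) => //.
- by rewrite anglesE.
- rewrite anglesE /th invg1 perm1 /= !inE eqxx /= /set_coord eqxx //.
- by rewrite -[i.+1]/(nat_of_ord (Ordinal i1N)) !anglesE /th invg1 perm1 c'A eqxx.
move=> d di di1; case: (ltnP d N) => dN; last by rewrite !angles_ge.
rewrite -[d]/(nat_of_ord (Ordinal dN)) !anglesE thE //.
  by apply: contra di => /eqP /(congr1 (fun c0 : T => nat_of_ord c0.2)) /= ->.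
by apply: contra di1 => /eqP /(congr1 (fun c0 : T => nat_of_ord c0.2)) /= ->.
Qed.

Lemma active_face (e : cell V) v s (i : 'I_N) : (e v).1 = i.+1 -> active (face e v s) = active e :\ (v, i).
Proof.
move=> ei; apply/setP => -[w j]; rewrite !inE /= /face /=.
have [->|wv] := eqVneq w v.
  rewrite set_cellxx /= ei /= ltnS xpair_eqE eqxx /= -val_eqE /=; lia.
by rewrite set_cell_neq // xpair_eqE (negbTE wv).
Qed.

Lemma face_cube_same (e : cell V) v (i : 'I_N) : (e v).1 = i.+1 ->
  grid_sum M (cube_chain (signs e)) (active e :\ (v, i)) (set_coord (fun=> 0%re) (v, i) 0%re) =
  cell_image (face e v (e v).2).
Proof.
move=> ei; rewrite /cell_image (active_face _ ei).
have -> : signs (face e v (e v).2) = signs e.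
  by apply/funext => w; rewrite /signs /face ffunE; case: eqP => [->|].
by congr grid_sum; apply/funext => d; rewrite /set_coord; case: ifP.
Qed.

(** The last active angle at 1 gives the antipodes of its value 0, so the sign of the node
    changes. *)
Lemma face_cube_opposite (e : cell V) v (i : 'I_N) : (e v).1 = i.+1 -> small e ->
  grid_sum M (cube_chain (signs e)) (active e :\ (v, i)) (set_coord (fun=> 0%re) (v, i) 1%re) =
  cell_image (face e v (~~ (e v).2)).
Proof.
move=> ei se; rewrite /cell_image (active_face _ ei); pose A := active e :\ (v, i).
pose th (p : T -> R) : T -> R := fun d => let d' := ((1%g : {perm T})^-1)%g d in
  if d' \in A then (if false then (1 - p d')%re else p d') else 0%re.
rewrite (@grid_sum_transport V _ M M_odd _ (cube_chain (signs (face e v (~~ (e v).2)))) A _ (fun=> 0%re)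
  1%g (fun=> false) th) //.
- by congr grid_sum; rewrite (eq_imset _ (@perm1 _)) imset_id.
- by move=> d; rewrite /set_coord; case: eqP => _; lra.
move=> ps Kps; rewrite /cube_chain -map_comp; congr label_chain.
elim: ps Kps => //= p ps IH pps; inversion_clear pps; rewrite IH //; congr (lam (Phi _) :: _).
case: H => p1 pA; apply/funext => w; apply/funext => l; rewrite /node_points.
have thE d : d != (v, i) -> th p d = p d.
  move=> dc; rewrite /th invg1 perm1 /=; case: ifP => // /negbT dA.
  by rewrite pA // /set_coord (negbTE dc).
have [wv|wv] := eqVneq w v; last first.
  rewrite /signs /face set_cell_neq //.
  rewrite (@sphere_coord_ext N (angles p w) (angles (th p) w)) // => d dN.
  rewrite -[d]/(nat_of_ord (Ordinal dN)) !anglesE thE //.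
  by apply: contra wv => /eqP[->].
rewrite wv (@sphere_coord_flip N (angles (th p) v) (angles p v) i) //.
- by rewrite /signs /face set_cellxx /=; case: (e v).2 => //=; rewrite Ropp_involutive.
- by rewrite anglesE /th invg1 perm1 /A !inE eqxx.
- by rewrite anglesE pA ?inE ?eqxx // /set_coord eqxx.
- move=> d di; case: (ltnP d N) => dN; last by rewrite !angles_ge.
  rewrite -[d]/(nat_of_ord (Ordinal dN)) !anglesE thE //.
  by apply: contra di => /eqP /(congr1 (fun c0 : T => nat_of_ord c0.2)) /= ->.
move=> d /andP[di dN]; rewrite -[d]/(nat_of_ord (Ordinal dN)) anglesE /th invg1 perm1 /A ifN //.
by rewrite !inE /= ei; lia.
Qed.

(** In each factor only the last active angle survives, and its two ends are the two hemispheres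
    below. *)
Lemma cell_image_boundary (e : cell V) : small e ->
  boundary (cell_image e) = \sum_(v | (0 < (e v).1)%N) \sum_(s : bool) cell_image (face e v s).
Proof.
move=> se; rewrite /cell_image grid_sum_boundary //; first last.
- exact: cube_chain_boundary.
- by move=> c; lra.
pose G (v : V) (i : 'I_N) := grid_sum M (cube_chain (signs e)) (active e :\ (v, i))
    (set_coord (fun=> 0%re) (v, i) 0%re) + grid_sum M (cube_chain (signs e)) (active e :\ (v, i))
    (set_coord (fun=> 0%re) (v, i) 1%re).
rewrite (eq_bigr (fun c : T => G c.1 c.2)); last by case.
rewrite (eq_bigl (fun c : T => true && (c.2 < (e c.1).1)%N)); last by move=> c; rewrite inE.
rewrite -(pair_big_dep (fun=> true) (fun v (i : 'I_N) => (i < (e v).1)%N) G) /= [RHS]big_mkcond.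
apply: eq_bigr => v _; case: ifP => [ev0|]; last first.
  by rewrite lt0n => /negbFE/eqP ->; rewrite big1.
have eN : ((e v).1.-1 < N)%N by have := se v; lia.
have ei : (e v).1 = (Ordinal eN).+1 by rewrite /=; lia.
rewrite (bigD1 (Ordinal eN)) /=; last by lia.
rewrite big1 ?addr0 => [|i /andP[iv ni]]; last first.
  rewrite /G face_cube_cancel ?chain_addxx //.
  by move: ni; rewrite -val_eqE /=; lia.
rewrite /G face_cube_same // face_cube_opposite // big_bool.
by case: (e v).2 => //=; rewrite addrC.
Qed.

Lemma chain_act_walk (P : Type) (T' : finType) (mv : T' -> bool -> P -> P) g
    (F : seq P -> chain) j (A : {set T'}) p l :
  chain_act (I := I) g (walk mv F j A p l) = walk mv (fun s => chain_act g (F s)) j A p l.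
Proof.
elim: j A p l => //= j IH A p l; rewrite chain_act_sum; apply: eq_bigr => c _.
by rewrite chain_act_sum; apply: eq_bigr => b _; rewrite IH.
Qed.

Lemma cell_image_act g (e : cell V) : GP g -> cell_image (cell_act g e) = chain_act g (cell_image e).
Proof.
move=> Gg; rewrite /cell_image {2}/grid_sum chain_act_sum.
rewrite (eq_bigr (fun q => walk (shift M) (fun s => chain_act g (cube_chain (signs e) s)) #|active e|
   (active e) (grid_point (active e) (fun=> 0%re) q) [::])); last first.
  by move=> q _; rewrite chain_act_walk.
pose f (c : T) : T := (((node_perm g)^-1)%g c.1, c.2).
have fI : injective f by move=> [v i] [w j] [/perm_inj -> ->].
pose ph := perm fI.
have phV d : (ph^-1)%g d = (node_perm g d.1, d.2).
  by apply: (@perm_inj _ ph); rewrite permKV permE /f /= permK; case: d.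
have phA : ph @: active e = active (cell_act g e).
  apply/setP => d; rewrite -{1}(permKV ph d) (mem_imset _ _ (@perm_inj _ ph)) phV !inE /= ffunE //.
pose th (p : T -> R) : T -> R := fun d => let d' := (ph^-1)%g d in
  if d' \in active e then (if false then (1 - p d')%re else p d') else 0%re.
rewrite -/(grid_sum M (fun s => chain_act g (cube_chain (signs e) s)) (active e) (fun=> 0%re)).
rewrite (@grid_sum_transport V _ M M_odd _ (cube_chain (signs (cell_act g e))) (active e) _ (fun=> 0%re)
  ph (fun=> false) th) ?phA //.
- by move=> d; lra.
move=> ps Kps; rewrite /cube_chain -(label_chain_act PsiP) // -!map_comp; congr label_chain.
elim: ps Kps => //= p ps IH pps; inversion_clear pps; rewrite IH //; congr cons.
case: H => p1 pA; rewrite -lamG //.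
congr lam; apply/funext => i; rewrite -Gg; congr (Phi _ i).
have thE d : th p d = p (node_perm g d.1, d.2).
  by rewrite /th phV /=; case: ifP => // /negbT /pA.
apply/funext => v; apply/funext => c; rewrite /node_act /node_points /signs ffunE /=.
rewrite (@sphere_coord_ext N (angles (th p) v) (angles p (node_perm g v))) => [|d dN]; last first.
  by rewrite -[d]/(nat_of_ord (Ordinal dN)) !anglesE thE.
by case: (e _).2; case: (node_sign g v) => //=; rewrite Ropp_involutive.
Qed.

Lemma card_active (e : cell V) : small e -> #|active e| = degree e.
Proof.
move=> se; rewrite -sum1_card (eq_bigl (fun c : T => true && (c.2 < (e c.1).1)%N)); last first.
  by move=> c; rewrite inE.
rewrite -(pair_big_dep (fun=> true) (fun v (i : 'I_N) => (i < (e v).1)%N) (fun _ _ => 1%N)) /=.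
apply: eq_bigr => v _; rewrite -(big_ord_widen_cond N predT (fun=> 1%N)) ?se //=.
by rewrite sum1_card card_ord.
Qed.

Lemma cell_image_homogeneous (e : cell V) : small e -> homogeneous (degree e) (cell_image e).
Proof.
move=> se; apply: grid_sum_ind; [exact: homogeneous0|exact: homogeneousD|move=> s ss].
have := label_chain_homogeneous PsiP (l := map (fun t => lam (Phi (node_points (signs e) t))) s).
by rewrite size_map ss /= card_active.
Qed.

Lemma cell_image_level0 (e : cell V) : degree e = 0%N -> small e -> level_sum 0 (cell_image e) = 1.
Proof.
move=> e0 se; have A0 : active e = set0 by apply: cards0_eq; rewrite card_active.
by rewrite /cell_image A0 grid_sum0 // /cube_chain /= (label_chain1 PsiP).
Qed.

(** A flag has one point more than the degree, hence more than [m] labels. *)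
Lemma cell_image_top (e : cell V) : (m <= degree e)%N -> small e -> cell_image e = 0.
Proof.
move=> me se; apply: (@grid_sum_ind V _ M (fun z => z = 0)) => //.
  by move=> x y -> ->; rewrite addr0.
by move=> s ss; rewrite /cube_chain label_chain_long // size_map ss card_active.
Qed.

Definition cell_faces (e : cell V) : seq (cell V) :=
  [seq face e x.1 x.2 | x <- enum {: V * bool} & (0 < (e x.1).1)%N].

Lemma sum_cell_faces (F : cell V -> chain) e :
  \sum_(y <- cell_faces e) F y = \sum_(v | (0 < (e v).1)%N) \sum_(s : bool) F (face e v s).
Proof.
rewrite /cell_faces big_map big_filter big_enum_cond /= pair_big /=.
by apply: eq_big => [[v s]|[v s] _] //=; rewrite andbT.
Qed.

Lemma too_few_labels : ~ (m <= #|V| * N)%N.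
Proof.
move=> mle; have beta1 : (beta <= 1)%re.
  have h j : (0 < (/ 2) ^ j)%re by apply: pow_lt; lra.
  by elim: (N) => /= [|j IH]; have := h 0%N; [|have := h j]; lra.
pose top : cell V := level_cell N [ffun => true].
have top_small : small top by move=> v; rewrite ffunE.
have top_deg : degree top = (#|V| * N)%N.
  rewrite /degree (eq_bigr (fun=> N)) => [|v _]; last by rewrite ffunE.
  by rewrite sum_nat_const.
(* The case [dl = 1]: the inclusion and [cell_image] are augmented chain maps, and their sum modulo
   2 is contracted. *)
have [||||||||||||H HP] := @equivariant_extension V I GP (model_symmetry1 Phi)
  (@model_symmetryM _ _ _ _ Phi) (@model_symmetryV _ _ _ _ Phi) (cell V) (@degree V) cell_faces
  small (@cell_act V I) (@cell_act1 V I) (@cell_actM V I) (@cell_actK V I) _ _ _ _ _ _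
  (#|V| * N) (fun e => basis_chain e + cell_image e) 1.
- by move=> g e _ se v; rewrite ffunE; apply: se.
- exact: degree_act.
- by move=> g e Gg _ ge; apply: (leaf_trivial_chain Gg); apply: (cell_act_free beta1 Gg ge).
- move=> e y se /mapP[[v s]]; rewrite mem_filter => /andP[/= ev _] ->; split.
    by move=> w; rewrite /face ffunE; case: eqP => // _; have := se v => /=; lia.
  by rewrite degree_face.
- move=> g e F Gg se; rewrite !sum_cell_faces.
  rewrite [RHS](reindex_inj (@perm_inj _ (node_perm g))) /=; apply: eq_big => [v|v _].
    by rewrite ffunE.
  have sumb (b : bool) (f : bool -> chain) : \sum_(s : bool) f s = \sum_(s : bool) f (s (+) b).
    by rewrite !big_bool; case: b => //=; rewrite addrC.
  rewrite [RHS](sumb (node_sign g v)); apply: eq_bigr => s _.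
  by rewrite face_act.
- move=> e se F; rewrite sum_cell_faces.
  pose G v w := if (0 < (e v).1)%N && (0 < (e w).1)%N then
    (if v == w then 0 else \sum_(s : bool) \sum_(t : bool) F (face (face e v s) w t)) else 0.
  rewrite (eq_bigr (fun v => \sum_(w | (0 < (e w).1)%N) G v w)); last first.
    move=> v ev; rewrite (eq_bigr (fun s => \sum_(w | (0 < (face e v s w).1)%N)
       \sum_(t : bool) F (face (face e v s) w t))); last by move=> s _; rewrite sum_cell_faces.
    rewrite big_bool /=.
    have E s : \sum_(w | (0 < (face e v s w).1)%N) \sum_(t : bool) F (face (face e v s) w t) =
       (if (1 < (e v).1)%N then \sum_(t : bool) F (set_cell e v ((e v).1.-2, t)) else 0) +
       \sum_(w | (0 < (e w).1)%N && (w != v)) \sum_(t : bool) F (face (face e v s) w t).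
      rewrite big_mkcond (bigD1 v) //= (_ : (face e v s v).1 = (e v).1.-1); last by rewrite /face set_cellxx.
      congr (_ + _).
        have -> : (0 < (e v).1.-1)%N = (1 < (e v).1)%N by lia.
        case: ifP => // _; apply: eq_bigr => t _.
        by rewrite /face set_cellxx set_cellK /=.
      rewrite -big_mkcondl; apply: eq_bigl => w; rewrite andbC.
      have [->|wv] := eqVneq w v; first by rewrite andbF.
      by rewrite andbT /face set_cell_neq.
    rewrite !E addrACA chain_addxx add0r -big_split /= [RHS](bigD1 v) //=.
    rewrite {1}/G eqxx if_same add0r; apply: eq_bigr => w /andP[ew wv].
    by rewrite /G ev ew eq_sym (negbTE wv) /= [RHS]big_bool.
  rewrite (sum_symmetric (@chain_addxx V)).
    by rewrite big1 // => v _; rewrite /G eqxx if_same.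
  move=> v w vw; rewrite /G andbC eq_sym; case: ifP => // _; rewrite eq_sym (negbTE vw).
  rewrite exchange_big /=; apply: eq_bigr => s _; apply: eq_bigr => t _.
  by rewrite faceC.
- move=> e se; rewrite /degree -sum_nat_const; exact: leq_sum.
- move=> g e Gg se; rewrite chain_actD chain_act_basis cell_image_act //.
- move=> e se _; rewrite addn1 /=; apply: homogeneousD; first exact: homogeneous_basis.
  exact: cell_image_homogeneous.
- move=> e se; rewrite boundaryD boundary_basis cell_image_boundary // sum_cell_faces -big_split.
  by apply: eq_bigr => v _; rewrite -big_split.
- by move=> e _; lia.
- move=> e se; rewrite addn1 => -[e0]; rewrite addr0 level_sumD cell_image_level0 //.
  have -> : e = level_cell 0 [ffun v => (e v).2].
    apply/ffunP => v; rewrite !ffunE; have : ((e v).1 <= degree e)%N.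
      by rewrite /degree (bigD1 v) //= leq_addr.
    by rewrite e0 leqn0 => /eqP <-; rewrite -surjective_pairing.
  by rewrite level_sum_basis F2_addxx.
have [_ Htop _ _] := HP top top_small.
have := congr1 (level_sum N) Htop.
rewrite level_sum_boundary sum_cell_faces !level_sumD level_sum_basis.
rewrite cell_image_top ?top_deg // level_sum0 addr0 level_sum_sum big1 ?addr0.
  by move/eqP; rewrite eq_sym oner_eq0.
move=> v; rewrite ffunE /= => N0; rewrite level_sum_sum big_bool /=.
(* The flip of [v] may permute other nodes, but the top cell looks alike at all of them. It
   therefore exchanges just the two faces at [v], whose invariant counts agree. *)
have [g [Gg gv gs]] := flipP Phi v.
have fs s : small (face top v s).
  by move=> w; rewrite /face !ffunE; case: eqP => //= _; lia.
have -> : face top v false = cell_act g (face top v true).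
  apply/ffunP => w; rewrite !ffunE /= gs.
  have -> : (node_perm g w == v) = (w == v) by rewrite -{1}gv (inj_eq perm_inj).
  by case: eqP.
have [_ _ _ ->] := HP (face top v true) (fs true); last exact: Gg.
by rewrite level_sum_act F2_addxx.
Qed.

End Obstruction.

(** * Binary digit sums *)

Section BinaryDigits.

Lemma Nat_div2E k : Nat.div k 2 = (k %/ 2)%N.
Proof. by apply/esym/(@Nat.div_unique _ _ _ (k %% 2)%N); lia. Qed.

Lemma Nat_mod2E k : Nat.modulo k 2 = (k %% 2)%N.
Proof. by apply/esym/(@Nat.mod_unique _ _ (k %/ 2)%N); lia. Qed.

Lemma alpha_aux_fuel f f' k : (k <= f)%N -> (k <= f')%N -> alpha_aux f k = alpha_aux f' k.
Proof.
elim: f f' k => [|f IH] [|f'] [|k] // kf kf'.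
have E j : alpha_aux j.+1 k.+1 = (Nat.modulo k.+1 2 + alpha_aux j (Nat.div k.+1 2))%N by [].
by rewrite !E Nat_div2E (IH f') //; lia.
Qed.

Lemma alphaS k : (0 < k)%N -> alpha k = (k %% 2 + alpha (k %/ 2))%N.
Proof.
case: k => // k _; rewrite /alpha -Nat_mod2E -Nat_div2E.
rewrite (@alpha_aux_fuel (Nat.div k.+1 2) k) //; rewrite Nat_div2E; lia.
Qed.

End BinaryDigits.

(** * Construction of models with a given number of leaves *)

Section Models.
Local Open Scope R_scope.
Variables (n : nat) (beta : R).
Hypothesis beta_pos : 0 < beta <= 1.
Local Notation model := (model n.+1 beta).

Definition point_model : model unit void.
Proof.
apply: (@Model n.+1 beta unit void (fun _ _ _ => 0) 1 1 0) => //; try by lra.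
- by move=> x x' d _ d0 i c; rewrite Rminus_diag Rabs_R0; lra.
- by move=> x _ i c; rewrite Rabs_R0; lra.
- by move=> x x' _; apply/funext; case.
Defined.

Definition option_perm (I : finType) (s : {perm I}) : {perm option I}.
Proof.
refine (@perm _ (fun o : option I => if o is Some i then Some (s i) else None) _).
by move=> [i|] [j|] // [] /perm_inj ->.
Defined.

Definition spectator_model (I V : finType) (Phi : model I V) : model (option I) V.
Proof.
(* The absolute value is taken because [radius] is not assumed nonnegative; the extra point is then
   at distance at least 1. *)
pose far := Rabs (radius Phi) + 1.
apply: (@Model n.+1 beta (option I) V (fun x o => if o is Some i then Phi x i else fun=> far)
  (Rmin (separation Phi) 1) (lipschitz Phi) far).
- by apply: Rmin_pos; [apply: separation_pos|lra].
- exact: lipschitz_pos.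
- have r0 := Rle_abs (radius Phi).
  have sep x (ax : admissible beta x) i : 1 <= Rabs (far - Phi x i Fin.F1).
    have [h1 h2] := Rabs_le_inv (radiusP Phi ax i Fin.F1).
    by apply: Rle_trans (Rle_abs _); rewrite /far; lra.
  move=> x ax [i|] [j|] // ij.
  + have [c h] := separationP Phi ax (i := i) (j := j) ij; exists c.
    by apply: Rle_trans (Rmin_l _ _) h.
  + by exists Fin.F1; rewrite Rabs_minus_sym; apply: Rle_trans (Rmin_r _ _) (sep x ax i).
  + by exists Fin.F1; apply: Rle_trans (Rmin_r _ _) (sep x ax j).
- move=> x x' d h d0 [i|] c; first exact: lipschitzP.
  by rewrite Rminus_diag Rabs_R0; have := lipschitz_pos Phi; nra.
- have r0 := Rle_abs (radius Phi); have r1 := Rabs_pos (radius Phi).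
  move=> x ax [i|] c; last by rewrite Rabs_right /far; lra.
  by apply: Rle_trans (radiusP Phi ax i c) _; rewrite /far; lra.
- move=> x x' E; apply: (@configuration_inj _ _ _ _ Phi); apply/funext => i.
  by have := congr1 (fun f => f (Some i)) E.
- move=> v; have [g [g1 g2 g3]] := flipP Phi v.
  exists (Symmetry (node_perm g) (node_sign g) (option_perm (leaf_perm g))); split=> //.
  by move=> x [i|]; rewrite permE //= -g1.
Defined.

Definition flip_leaf (I : finType) (i : I) : {perm I * bool}.
Proof.
refine (@perm _ (fun p : I * bool => (p.1, p.2 (+) (p.1 == i))) _).
by move=> [j b] [j' b'] [<-] /addIb ->.
Defined.

Definition lift_leaf (I : finType) (s : {perm I}) : {perm I * bool}.
Proof.
refine (@perm _ (fun p : I * bool => (s p.1, p.2)) _).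
by move=> [j b] [j' b'] [/perm_inj -> ->].
Defined.

Definition sum_perm (I V : finType) (s : {perm I}) (q : {perm V}) : {perm I + V}.
Proof.
refine (@perm _ (fun w : I + V => match w with inl i => inl (s i) | inr v => inr (q v) end) _).
by move=> [i|v] [i'|v'] // [] /perm_inj ->.
Defined.

Definition double_model (I V : finType) (Phi : model I V) : model (I * bool)%type (I + V)%type.
Proof.
(* Old leaves are [4 * eps] apart and move by at most [eps], which leaves [2 * eps] between
   different pairs; within a pair the distance is at least [2 * eps * beta]. *)
pose eps := separation Phi / 4.
have eps0 : 0 < eps by have := separation_pos Phi; rewrite /eps; lra.
pose sg (b : bool) := if b then eps else - eps.
have sgE b : Rabs (sg b) = eps by rewrite /sg; case: b; rewrite ?Rabs_Ropp Rabs_right; lra.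
pose conf (x : I + V -> Pt n.+1) (p : I * bool) : Pt n.+1 :=
  fun c => Phi (fun v => x (inr v)) p.1 c + sg p.2 * x (inl p.1) c.
apply: (@Model n.+1 beta _ _ conf (Rmin (2 * eps) (2 * eps * beta)) (lipschitz Phi + eps)
  (radius Phi + eps)).
- by apply: Rmin_pos; nra.
- by have := lipschitz_pos Phi; lra.
- move=> x ax [i b] [j b'] ij; rewrite /conf /=.
  have axV : admissible beta (fun v => x (inr v)) by move=> v; apply: ax.
  have [E|ne] := eqVneq i j; last first.
    have [c h] := separationP Phi axV ne; exists c; apply: Rle_trans (Rmin_l _ _) _.
    have s1 : Rabs (sg b * x (inl i) c) <= eps.
      by rewrite Rabs_mult sgE; have := (ax (inl i)).1 c; nra.
    have s2 : Rabs (sg b' * x (inl j) c) <= eps.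
      by rewrite Rabs_mult sgE; have := (ax (inl j)).1 c; nra.
    move: h s1 s2; set u := Phi _ i c; set w := Phi _ j c; set p := sg b * _; set q := sg b' * _.
    move=> h s1 s2; have := Rabs_triang (u + p - (w + q)) (q - p).
    have -> : u + p - (w + q) + (q - p) = u - w by ring.
    have := Rabs_triang q (- p); rewrite Rabs_Ropp.
    by rewrite -/(q - p) => t1 t2; move: h; rewrite /eps in s1 s2 *; lra.
  move: ij; rewrite -E => ij; have [_ [c h]] := ax (inl i); exists c.
  apply: Rle_trans (Rmin_r _ _) _.
  have -> : Phi (fun v => x (inr v)) i c + sg b * x (inl i) c -
     (Phi (fun v => x (inr v)) i c + sg b' * x (inl i) c) = (sg b - sg b') * x (inl i) c by ring.
  have -> : Rabs ((sg b - sg b') * x (inl i) c) = 2 * eps * Rabs (x (inl i) c).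
    rewrite Rabs_mult; congr Rmult.
    move: ij; rewrite xpair_eqE eqxx /sg; case: b; case: b' => //= _.
      by rewrite Rabs_right; lra.
    by rewrite Rabs_left; lra.
  nra.
- move=> x x' d h d0 [i b] c; rewrite /conf /=.
  have := lipschitzP Phi (x := fun v => x (inr v)) (x' := fun v => x' (inr v))
    (fun v c => h (inr v) c) d0 i c.
  set u := Phi _ i c; set w := Phi _ i c => h1.
  have -> : u + sg b * x (inl i) c - (w + sg b * x' (inl i) c) =
     (u - w) + sg b * (x (inl i) c - x' (inl i) c) by ring.
  apply: Rle_trans (Rabs_triang _ _) _; rewrite Rabs_mult sgE.
  by have := h (inl i) c; nra.
- move=> x ax [i b] c; rewrite /conf /=.
  have axV : admissible beta (fun v => x (inr v)) by move=> v; apply: ax.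
  apply: Rle_trans (Rabs_triang _ _) _; rewrite Rabs_mult sgE.
  by have := radiusP Phi axV i c; have := (ax (inl i)).1 c; nra.
- move=> x x' E.
  have Ec i c : Phi (fun v => x (inr v)) i c = Phi (fun v => x' (inr v)) i c /\
     x (inl i) c = x' (inl i) c.
    have h1 := congr1 (fun f => f (i, true) c) E; have h2 := congr1 (fun f => f (i, false) c) E.
    move: h1 h2; rewrite /conf /sg /=.
    move=> h1 h2; split; first by lra.
    by apply: (@Rmult_eq_reg_l eps); lra.
  have EV : (fun v => x (inr v)) = (fun v => x' (inr v)).
    apply: (@configuration_inj _ _ _ _ Phi); apply/funext => i; apply/funext => c.
    by case: (Ec i c).
  apply/funext => -[i|v]; last by have := congr1 (fun f => f v) EV.
  by apply/funext => c; case: (Ec i c).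
- move=> [i|v].
    exists (Symmetry 1%g (fun w => w == inl i) (flip_leaf i)).
    split; [|by rewrite perm1|by []] => x [j b].
    rewrite permE /conf /=; apply/funext => c /=.
    have -> : (fun v => node_act (Symmetry 1%g (fun w => w == inl i) (flip_leaf i)) x (inr v)) =
       (fun v => x (inr v)) by apply/funext => v; rewrite /node_act /= perm1.
    rewrite /node_act /= perm1 /sg.
    have -> : (inl j == inl i :> I + V) = (j == i) by [].
    by case: (j == i); case: b => //=; ring.
  (* Flipping an old node permutes the old leaves and so the new nodes attached to them, without
     signs there. *)
  have [g [g1 g2 g3]] := flipP Phi v.
  pose g' := Symmetry (sum_perm (leaf_perm g) (node_perm g))
     (fun w : I + V => if w is inr u then node_sign g u else false) (lift_leaf (leaf_perm g)).
  exists g'; split.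
  + move=> x [j b]; rewrite permE /conf /=; apply/funext => c /=.
    have -> : (fun u => node_act g' x (inr u)) = node_act g (fun u => x (inr u)).
      by apply/funext => u; rewrite /node_act /= permE.
    by rewrite g1 /node_act /= permE.
  + by rewrite permE g2.
  + by move=> [j|u]; rewrite /= ?g3.
Defined.

Definition relabel_model (I J V : finType) (f : J -> I) (f' : I -> J) (fK : cancel f f')
  (fK' : cancel f' f) (Phi : model I V) : model J V.
Proof.
apply: (@Model n.+1 beta J V (fun x j => Phi x (f j)) (separation Phi) (lipschitz Phi) (radius Phi)).
- exact: separation_pos.
- exact: lipschitz_pos.
- by move=> x ax i j ij; apply: separationP => //; rewrite (can_eq fK).
- by move=> x x' d h d0 i c; apply: lipschitzP.
- by move=> x ax i c; apply: radiusP.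
- move=> x x' E; apply: (@configuration_inj _ _ _ _ Phi); apply/funext => i.
  by have := congr1 (fun h => h (f' i)) E; rewrite /= fK'.
- move=> v; have [g [g1 g2 g3]] := flipP Phi v.
  have pI : injective (fun j => f' (leaf_perm g (f j))).
    by move=> j j' /(can_inj fK')/perm_inj/(can_inj fK).
  exists (Symmetry (node_perm g) (node_sign g) (perm pI)); split=> //.
  by move=> x j; rewrite permE fK' -g1.
Defined.

(** Doubling adds as many nodes as there were leaves and keeps the digit sum; a last digit 1 adds a
    leaf and a digit but no node. *)
Lemma model_exists k : (0 < k)%N -> exists (I V : finType) (Phi : model I V),
  #|I| = k /\ (#|V| + alpha k = k)%N.
Proof.
elim/ltn_ind: k => k IH k0; have [k1|k1] := eqVneq k 1%N.
  by exists unit, void, point_model; rewrite card_unit card_void k1.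
have [||I [V [Phi [cI cV]]]] := IH (k %/ 2)%N; try lia.
have aE := alphaS k0; have kE := divn_eq k 2.
have [k2|k2] := eqVneq (k %% 2)%N 0%N.
  exists (I * bool)%type, (I + V)%type, (double_model Phi).
  by rewrite card_prod card_sum card_bool; split; lia.
exists (option (I * bool)), (I + V)%type, (spectator_model (double_model Phi)).
by rewrite card_option card_prod card_sum card_bool; split; lia.
Qed.

End Models.

(** * The index types as finite types *)

Lemma fin_ordK k : cancel (fun c : Fin.t k => Ordinal (coord_index_lt c))
  (fun i : 'I_k => Fin.of_nat_lt (elimT ltP (ltn_ord i))).
Proof.
move=> c; apply: coord_index_inj; rewrite /coord_index Fin.to_nat_of_nat /=.
by [].
Qed.

HB.instance Definition _ k := Finite.copy (Fin.t k) (can_type (@fin_ordK k)).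

Lemma card_fin k : #|{: Fin.t k}| = k.
Proof.
rewrite -[RHS](card_ord k); apply: (bij_eq_card (f := fun c : Fin.t k => Ordinal (coord_index_lt c))).
exists (fun i : 'I_k => Fin.of_nat_lt (elimT ltP (ltn_ord i))); first exact: fin_ordK.
by move=> i; apply/val_inj; rewrite /= /coord_index Fin.to_nat_of_nat.
Qed.

(** * Compactness of the interval and the cube *)

Section Compactness.
Local Open Scope R_scope.

(** Cousin's form of compactness: the supremum of the [t] with [S 0 t] is attained and cannot lie
    below 1. It serves for uniform bounds and for building lifts piece by piece. *)
Lemma cousin (S : R -> R -> Prop) :
  (forall a b c, 0 <= a <= b -> b <= c <= 1 -> S a b -> S b c -> S a c) ->
  (forall x, 0 <= x <= 1 -> exists2 r, 0 < r & forall a b, 0 <= a <= b -> b <= 1 ->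
     Rabs (a - x) < r -> Rabs (b - x) < r -> S a b) -> S 0 1.
Proof.
move=> St Sl.
have S00 : S 0 0.
  by have [|r r0 h] := Sl 0; [lra|apply: h; rewrite ?Rminus_diag ?Rabs_R0; lra].
pose E t := 0 <= t <= 1 /\ S 0 t.
have [||m [m1 m2]] := completeness E.
- by exists 1 => t [[]].
- by exists 0; split=> //; lra.
have m01 : 0 <= m <= 1.
  by split; [apply: m1; split=> //; lra|apply: m2 => t [[]]].
have [r r0 h] := Sl m m01.
have [t [[t01 St0] tm]] : exists t, E t /\ m - r < t.
  apply: contrapT => /forallNP nt; have : m <= m - r; last by lra.
  apply: m2 => t Et; apply: Rnot_lt_le => lt; exact: (nt t).
have tlem : t <= m by apply: m1.
pose t' := Rmin 1 (m + r / 2).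
have t'1 : t' <= 1 by apply: Rmin_l.
have t'm : t' <= m + r / 2 by apply: Rmin_r.
have mt' : m <= t' by apply: Rmin_glb; lra.
have St' : S 0 t'.
  apply: (St 0 t t') => //; try lra.
  by apply: h; try lra; apply: Rabs_def1; lra.
have : t' <= m by apply: m1; split=> //; lra.
rewrite /t' /Rmin; case: Rle_dec => [h1 _|]; last by lra.
by move: St'; rewrite /t' /Rmin; case: Rle_dec.
Qed.

Lemma interval_covering (P : nat -> R -> Prop) :
  (forall x, 0 <= x <= 1 -> exists2 r, 0 < r & exists n0, forall x', 0 <= x' <= 1 ->
     Rabs (x' - x) < r -> forall n, (n0 <= n)%N -> P n x') ->
  exists n0, forall n, (n0 <= n)%N -> forall x, 0 <= x <= 1 -> P n x.
Proof.
move=> loc; apply: (@cousin (fun a b => exists n0, forall n, (n0 <= n)%N ->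
  forall x, a <= x <= b -> P n x)).
  move=> a b c _ _ [n1 h1] [n2 h2]; exists (maxn n1 n2) => n; rewrite geq_max => /andP[nn1 nn2] x xac.
  by case: (Rle_dec x b) => xb; [apply: h1|apply: h2] => //; lra.
move=> x x01; have [r r0 [n0 h]] := loc x x01; exists r => // a b ab b1 ax bx.
exists n0 => n nn0 y yab; apply: h => //; first by lra.
by have [? ?] := Rabs_def2 _ _ ax; have [? ?] := Rabs_def2 _ _ bx; apply: Rabs_def1; lra.
Qed.

(** Coordinates are made uniform one at a time, as in the tube lemma; [cs] lists those on which the
    neighbourhood no longer depends. *)
Lemma cube_covering (T : finType) (P : nat -> (T -> R) -> Prop) :
  (forall t, unit_cube t -> exists2 r, 0 < r & exists n0, forall t', unit_cube t' ->
     (forall c, Rabs (t' c - t c) < r) -> forall n, (n0 <= n)%N -> P n t') ->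
  exists n0, forall n, (n0 <= n)%N -> forall t, unit_cube t -> P n t.
Proof.
move=> loc.
suff H (cs : seq T) : forall t, unit_cube t -> exists2 r, 0 < r & exists n0, forall t', unit_cube t' ->
     (forall c, c \notin cs -> Rabs (t' c - t c) < r) -> forall n, (n0 <= n)%N -> P n t'.
  have [|r r0 [n0 h]] := H (enum T) (fun=> 0); first by move=> c; lra.
  by exists n0 => n nn0 t t1; apply: h => // c; rewrite mem_enum.
elim: cs => [|c cs IH] t t1.
  have [r r0 [n0 h]] := loc t t1; exists r => //; exists n0 => t' t1' tt'; apply: h => // c.
  exact: tt'.
(* One index [m] serves as a bound and, through its inverse, as a radius, so that
   [interval_covering] makes both uniform. *)
pose Q m x := forall t', unit_cube t' ->
  (forall d, d \notin c :: cs -> Rabs (t' d - t d) < / INR m.+1) -> t' c = x ->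
  forall n, (m <= n)%N -> P n t'.
have [|n0 h] := @interval_covering Q; last first.
  exists (/ INR n0.+1); first by apply: Rinv_0_lt_compat; apply: lt_0_INR; lia.
  by exists n0 => t' t1' tt'; apply: (h n0 (leqnn _) (t' c)).
move=> x x01; have [|r r0 [n0 h]] := IH (set_coord t c x).
  by move=> d; rewrite /set_coord; case: eqP.
have [n1 [n1r n10]] := archimed_cor1 r r0.
exists r => //; exists (maxn n0 n1) => x' x01' xx' m; rewrite geq_max => /andP[mn0 mn1].
move=> t' t1' tt' tc n mn; apply: h => //; last exact: leq_trans mn.
move=> d dcs; rewrite /set_coord; case: eqP => [->|/eqP dc]; first by rewrite tc.
apply: Rlt_trans (tt' d _) _; first by rewrite inE negb_or dc.
apply: Rle_lt_trans n1r; apply: Rinv_le_contravar; first by apply: lt_0_INR.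
by apply: le_INR; lia.
Qed.

Lemma fin_uniform (J : finType) (Q : J -> R -> Prop) :
  (forall j r r', 0 < r' <= r -> Q j r -> Q j r') -> (forall j, exists2 r, 0 < r & Q j r) ->
  exists2 r, 0 < r & forall j, Q j r.
Proof.
move=> Qm Qex; suff [r r0 h] : exists2 r, 0 < r & forall j, j \in enum J -> Q j r.
  by exists r => // j; apply: h; rewrite mem_enum.
elim: (enum J) => [|j s [r r0 IH]]; first by exists 1 => //; lra.
have [r' r0' h] := Qex j; have m0 := Rmin_pos _ _ r0 r0'; exists (Rmin r r') => // i.
rewrite inE => /orP[/eqP ->|/IH Qi].
  by apply: (Qm _ _ _ _ h); split=> //; apply: Rmin_r.
by apply: (Qm _ _ _ _ Qi); split=> //; apply: Rmin_l.
Qed.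

End Compactness.

(** * Ordered and unordered configurations *)

Section Configurations.
Local Open Scope R_scope.
Variables (n k : nat).
Implicit Types (x y z : Conf n k) (b : UConf n k).

Definition close (r : R) x y := forall i c, Rabs (x i c - y i c) < r.

Lemma close_sym r x y : close r x y -> close r y x.
Proof. by move=> h i c; rewrite Rabs_minus_sym. Qed.

Lemma close_trans r r' x y z : close r x y -> close r' y z -> close (r + r') x z.
Proof.
move=> h h' i c; have -> : x i c - z i c = (x i c - y i c) + (y i c - z i c) by ring.
by apply: Rle_lt_trans (Rabs_triang _ _) _; apply: Rplus_lt_compat.
Qed.

Lemma close_le r r' x y : r <= r' -> close r x y -> close r' x y.
Proof. by move=> rr h i c; apply: Rlt_le_trans rr. Qed.

Lemma close_refl r x : 0 < r -> close r x x.
Proof. by move=> r0 i c; rewrite Rminus_diag Rabs_R0. Qed.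

Lemma close_perm r x y (s : {perm Fin.t k}) : close r x y -> close r (x \o s) (y \o s).
Proof. by move=> h i c; apply: h. Qed.

Lemma conf_separation x : inj_conf x ->
  exists2 r, 0 < r & forall i j, (forall c, Rabs (x i c - x j c) < r) -> i = j.
Proof.
move=> xi; have [||r r0 h] := @fin_uniform (Fin.t k * Fin.t k)%type
  (fun p r => (forall c, Rabs (x p.1 c - x p.2 c) < r) -> p.1 = p.2).
- by move=> p r r' rr h h'; apply: h => c; apply: Rlt_le_trans (h' c) _; lra.
- move=> [i j] /=; have [->|ij] := eqVneq i j; first by exists 1 => //; lra.
  have [c xc] : exists c, x i c <> x j c.
    apply: contrapT => /forallNP h; case/eqP: ij; apply: xi; apply/funext => c.
    by apply: contrapT; apply: h.
  exists (Rabs (x i c - x j c)); first by apply: Rabs_pos_lt; lra.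
  by move=> /(_ c) /Rlt_irrefl.
by exists r => // i j; apply: (h (i, j)).
Qed.

Lemma inj_conf_close x : inj_conf x -> exists2 r, 0 < r & forall y, close r y x -> inj_conf y.
Proof.
move=> /conf_separation[r r0 h]; exists (r / 2); first by lra.
move=> y yx i j yij; apply: h => c.
have -> : x i c - x j c = - (y i c - x i c) + (y j c - x j c) by rewrite yij; ring.
apply: Rle_lt_trans (Rabs_triang _ _) _; rewrite Rabs_Ropp.
by have := yx i c; have := yx j c; lra.
Qed.

Lemma open_ball r x : open_conf (fun y => close r y x).
Proof.
move=> y yx; have [||e e0 h] := @fin_uniform (Fin.t k * Fin.t n)%type
  (fun p e => forall z, (forall i j, Rabs (z i j - y i j) < e) ->
     Rabs (z p.1 p.2 - x p.1 p.2) < r).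
- by move=> p e e' ee h z zy; apply: h => i j; apply: Rlt_le_trans (zy i j) _; lra.
- move=> [i c]; exists (r - Rabs (y i c - x i c)); first by have := yx i c; lra.
  move=> z zy /=; have -> : z i c - x i c = (z i c - y i c) + (y i c - x i c) by ring.
  by apply: Rle_lt_trans (Rabs_triang _ _) _; have := zy i c; lra.
by exists e; split=> // z zy i c; apply: (h (i, c)).
Qed.

Lemma UConf_eq b b' : proj1_sig b = proj1_sig b' -> b = b'.
Proof. by case: b b' => [S hS] [S' hS'] E; apply: eq_exist. Qed.

Lemma piB_eq x y (hx : inj_conf x) (hy : inj_conf y) : pset x = pset y -> piB x hx = piB y hy.
Proof. by move=> E; apply: UConf_eq. Qed.

Lemma piB_surj b : exists x (hx : inj_conf x), b = piB x hx.
Proof. by case: b => S [x [hx E]]; exists x, hx; apply: UConf_eq. Qed.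

Lemma pset_perm x (s : {perm Fin.t k}) : pset (x \o s) = pset x.
Proof.
apply/funext => p; apply/propext; split=> -[i <-]; first by exists (s i).
by exists ((s^-1)%g i); rewrite /= permKV.
Qed.

Lemma inj_conf_perm x (s : {perm Fin.t k}) : inj_conf x -> inj_conf (x \o s).
Proof. by move=> xi i j /xi/perm_inj. Qed.

Lemma pset_eq_perm x y : inj_conf x -> pset x = pset y -> exists s : {perm Fin.t k}, x = y \o s.
Proof.
move=> xi E; have ex i : exists j, y j = x i by rewrite -/(pset y (x i)) -E; exists i.
pose f i := sval (cid (ex i)).
have fE i : y (f i) = x i by rewrite /f; case: cid.
have fI : injective f by move=> i j ij; apply: xi; rewrite -!fE ij.
by exists (perm fI); apply/funext => i; rewrite /= permE fE.
Qed.

(** Injectivity is an open condition, so the lifts of [W] can themselves serve as the open set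
    witnessing [openB]. *)
Lemma openBP (W : UConf n k -> Prop) : openB W <->
  forall x (h : inj_conf x), W (piB x h) ->
    exists2 r, 0 < r & forall y (h' : inj_conf y), close r y x -> W (piB y h').
Proof.
split=> [[O [Oo OW]] x h /OW /Oo[r [r0 hr]]|loc].
  by exists r => // y h' yx; apply/OW; apply: hr.
exists (fun x => exists h : inj_conf x, W (piB x h)); split.
  move=> x [h /loc[r r0 hr]]; have [r' r0' hr'] := inj_conf_close h.
  exists (Rmin r r'); split; first exact: Rmin_pos.
  move=> y yx; have yi : inj_conf y by apply: hr'; apply: close_le yx; apply: Rmin_r.
  by exists yi; apply: hr; apply: close_le yx; apply: Rmin_l.
move=> x h; split=> [[h' Wx]|Wx]; last by exists h.
by rewrite (piB_eq h h').
Qed.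

End Configurations.

Lemma card_eq_bij (I J : finType) : #|I| = #|J| ->
  exists (f : J -> I) (f' : I -> J), cancel f f' /\ cancel f' f.
Proof.
move=> E; exists (fun j => enum_val (cast_ord (esym E) (enum_rank j))).
exists (fun i => enum_val (cast_ord E (enum_rank i))).
by split=> x; rewrite enum_valK ?cast_ordK ?cast_ordKV enum_rankK.
Qed.

(** * Colours and permutations from local sections *)

Section SectionLabels.
Local Open Scope R_scope.
Variables (n k m : nat) (U : nat -> UConf n k -> Prop) (sec : nat -> UConf n k -> Conf n k).
Hypothesis U_open : forall i, (i <= m)%N -> openB (U i).
Hypothesis sec_cont : forall i, (i <= m)%N -> cont_on_BF (U i) (sec i).
Hypothesis secP : forall i b, (i <= m)%N -> U i b ->
  inj_conf (sec i b) /\ proj1_sig b = pset (sec i b).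
Implicit Types (x y : Conf n k).

Lemma section_label_ex i x : exists s : {perm Fin.t k}, forall h : inj_conf x,
  (i <= m)%N -> U i (piB x h) -> sec i (piB x h) = x \o s.
Proof.
have [[h [im Ux]]|nh] := pselect (exists h : inj_conf x, (i <= m)%N /\ U i (piB x h)); last first.
  by exists 1%g => h im Ux; case: nh; exists h.
have [si sE] := secP im Ux; have [s E] := pset_eq_perm si (esym sE).
by exists s => h' _ _; rewrite (Prop_irrelevance h' h).
Qed.

Definition section_label i x : {perm Fin.t k} := sval (cid (section_label_ex i x)).

Lemma section_labelP i x (h : inj_conf x) : (i <= m)%N -> U i (piB x h) ->
  sec i (piB x h) = x \o section_label i x.
Proof. by rewrite /section_label; case: cid => s /= /(_ h). Qed.

Lemma section_label_unique i x (h : inj_conf x) (s : {perm Fin.t k}) : (i <= m)%N ->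
  U i (piB x h) -> sec i (piB x h) = x \o s -> section_label i x = s.
Proof.
move=> im Ux E; apply/permP => a; apply: (h (section_label i x a) (s a)).
have := section_labelP im Ux; rewrite E => /(congr1 (fun f => f a)) /= ->; by [].
Qed.

Definition good_label (r : R) i x := exists2 h : inj_conf x, U i (piB x h) &
  forall y (h' : inj_conf y), close r y x -> U i (piB y h') /\ section_label i y = section_label i x.

Lemma good_label_le r r' i x : r' <= r -> good_label r i x -> good_label r' i x.
Proof. by move=> rr [h Ux H]; exists h => // y h' yx; apply: H; apply: close_le yx. Qed.

(** The points of [x] are separated, so continuity of the section leaves no room for the permutation
    to jump near [x]. *)
Lemma good_label_ex i x (h : inj_conf x) : (i <= m)%N -> U i (piB x h) ->
  exists2 r, 0 < r & good_label r i x.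
Proof.
move=> im Ux; have [r1 r10 h1] := conf_separation h.
have [V [Vo VE]] := sec_cont im (@open_ball n k (r1 / 2) (sec i (piB x h))).
have Vx : V (piB x h) by apply/VE => //; apply: close_refl; lra.
have [r2 r20 h2] := (openBP V).1 Vo x h Vx.
have [r3 r30 h3] := (openBP (U i)).1 (U_open im) x h Ux.
exists (Rmin (r1 / 2) (Rmin r2 r3)).
  by apply: Rmin_pos; [lra|apply: Rmin_pos].
exists h => // y h' yx.
have Uy : U i (piB y h').
  by apply: h3; apply: close_le yx; apply: Rle_trans (Rmin_r _ _) (Rmin_r _ _).
split=> //; have /VE : V (piB y h').
  by apply: h2; apply: close_le yx; apply: Rle_trans (Rmin_r _ _) (Rmin_l _ _).
move=> /(_ Uy); rewrite (section_labelP im Uy) (section_labelP im Ux) => near.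
apply/permP => a; apply: h1 => c.
set p := section_label i y a; set q := section_label i x a.
have -> : x p c - x q c = - (y p c - x p c) + (y p c - x q c) by ring.
apply: Rle_lt_trans (Rabs_triang _ _) _; rewrite Rabs_Ropp.
have e1 := near a c; have e2 := yx p c; have e3 := Rmin_l (r1 / 2) (Rmin r2 r3).
by rewrite /= in e1; rewrite -/p -/q in e1; lra.
Qed.

(** The section sees only the unordered configuration, so reordering [x] is compensated in the
    label; this is the origin of [label_act]. *)
Lemma section_label_perm i x (h : inj_conf x) (t : {perm Fin.t k}) : (i <= m)%N -> U i (piB x h) ->
  section_label i (x \o t) = (section_label i x * t^-1)%g.
Proof.
move=> im Ux; have ht := inj_conf_perm (s := t) h.
have E : piB (x \o t) ht = piB x h by apply: piB_eq; apply: pset_perm.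
apply: (section_label_unique (h := ht)) => //; rewrite E // (section_labelP im Ux).
by apply/funext => a; rewrite /= permM permKV.
Qed.

Lemma good_label_perm r i x (t : {perm Fin.t k}) : (i <= m)%N ->
  good_label r i x -> good_label r i (x \o t).
Proof.
move=> im [h Ux H]; have ht := inj_conf_perm (s := t) h; exists ht.
  by rewrite (piB_eq _ h (pset_perm x t)).
move=> y h' yx; have hy := inj_conf_perm (s := (t^-1)%g) h'.
have yx' : close r (y \o (t^-1)%g) x.
  by move=> a c; have := yx ((t^-1)%g a) c; rewrite /= permKV.
have [Uy Ly] := H _ hy yx'.
have Uy' : U i (piB y h') by rewrite -(piB_eq hy h' (pset_perm y _)).
split=> //; rewrite (section_label_perm t im Ux) -Ly (section_label_perm _ im Uy').
by rewrite invgK mulgK.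
Qed.

(** [pick] depends only on the set of good colours, which reordering [x] preserves. The default
    [ord0] occurs only where no colour is good. *)
Definition color (r : R) x : 'I_m.+1 := odflt ord0 [pick i : 'I_m.+1 | `[< good_label r i x >]].

Lemma color_perm r x (t : {perm Fin.t k}) : color r (x \o t) = color r x.
Proof.
rewrite /color; congr odflt; apply: eq_pick => i; apply/asboolP/asboolP; last first.
  by apply: good_label_perm; apply: (ltn_ord i).
move=> /(good_label_perm (t^-1)%g (ltn_ord i)).
have -> // : (x \o t) \o (t^-1)%g = x.
by apply/funext => a; rewrite /= permKV.
Qed.

Lemma good_color r x : (exists2 i, (i <= m)%N & good_label r i x) -> good_label r (color r x) x.
Proof.
move=> [i im gi]; rewrite /color; case: pickP => [j /asboolP //|/(_ (Ordinal (im : (i < m.+1)%N)))].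
by move=> /asboolP.
Qed.

End SectionLabels.

(** * The lower bound for the sectional category *)

Section LowerBound.
Local Open Scope R_scope.

Lemma node_points_lipschitz (N : nat) (V : finType) s (t t' : V * 'I_N -> R) d :
  unit_cube t -> unit_cube t' -> (forall c, Rabs (t c - t' c) <= d) -> 0 <= d ->
  forall v c, Rabs (node_points s t v c - node_points s t' v c) <= (4 * INR N + 4) * d.
Proof.
move=> t1 t1' td d0 v c; rewrite /node_points.
have h : Rabs (sphere_coord N (angles t v) (coord_index c) -
   sphere_coord N (angles t' v) (coord_index c)) <= (4 * INR N + 4) * d.
  apply: sphere_coord_lipschitz => i; [exact: angles_unit|exact: angles_unit|].
  by rewrite /angles; case: insub => [j|] //; rewrite Rminus_diag Rabs_R0.
have E a b : - a - - b = - (a - b) by ring.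
by case: (s v) => //; rewrite E Rabs_Ropp.
Qed.

Theorem secat_lower_bound (N k m : nat) : (0 < k)%N ->
  cover_by (n := N.+1) (k := k) local_section m -> ((k - alpha k) * N <= m)%N.
Proof.
move=> k0 [U [UP Ucov]]; rewrite leqNgt; apply/negP => mlt.
have betaP : 0 < (/ 2) ^ N <= 1.
  split; first by apply: pow_lt; lra.
  by elim: (N) => /= [|j]; lra.
have [I [V [Phi0 [cI cV]]]] := @model_exists N _ betaP k k0.
have [f [f' [fK fK']]] : exists (f : Fin.t k -> I) (f' : I -> Fin.t k), cancel f f' /\ cancel f' f.
  by apply: card_eq_bij; rewrite cI card_fin.
pose Phi := relabel_model fK fK' Phi0.
have Uo i : (i <= m)%N -> openB (U i) by move=> /leP /UP[].
have ex i : exists s, (i <= m)%N -> cont_on_BF (U i) s /\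
  forall b, U i b -> inj_conf (s b) /\ proj1_sig b = pset (s b).
  have [im|im] := boolP (i <= m)%N; last first.
    by exists (fun _ _ _ => 0).
  by have [_ [s sP]] := UP i (elimT leP im); exists s.
pose sec i := sval (cid (ex i)).
have secc i : (i <= m)%N -> cont_on_BF (U i) (sec i) by rewrite /sec; case: cid => s /= h /h[].
have secP i b : (i <= m)%N -> U i b -> inj_conf (sec i b) /\ proj1_sig b = pset (sec i b).
  by rewrite /sec; case: cid => s /= h /h[_]; apply.
pose good r i x := good_label secP r i x.
have PhiI s (t : V * 'I_N -> R) : unit_cube t -> inj_conf (Phi (node_points s t)).
  move=> t1 i j E; apply/eqP; apply: contraT => ij.
  have [c] := separationP Phi (node_points_admissible s t1) ij.
  by rewrite E Rminus_diag Rabs_R0; have := separation_pos Phi; lra.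
pose L := lipschitz Phi * (4 * INR N + 4).
have L0 : 0 < L by have := lipschitz_pos Phi; have := pos_INR N; rewrite /L; nra.
have PhiL s (t t' : V * 'I_N -> R) d r : unit_cube t -> unit_cube t' ->
  (forall c, Rabs (t c - t' c) <= d) -> 0 <= d -> L * d < r ->
  close r (Phi (node_points s t)) (Phi (node_points s t')).
  move=> t1 t1' td d0 dr i c; apply: Rle_lt_trans dr; rewrite /L Rmult_assoc.
  apply: lipschitzP; first exact: node_points_lipschitz.
  by have := pos_INR N; nra.
(* [rho] is a Lebesgue number for the cover on finitely many cubes, one for each choice of signs. *)
have [||rho rho0 rhoP] := @fin_uniform {ffun V -> bool} (fun s r =>
  forall t, unit_cube t -> exists2 i, (i <= m)%N & good r i (Phi (node_points s t))).
- move=> s r r' rr h t t1; have [i im gi] := h t t1; exists i => //; apply: good_label_le gi; lra.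
- move=> s; have [|n0 h] := @cube_covering (V * 'I_N)%type (fun n t =>
    exists2 i, (i <= m)%N & good (/ INR n.+1) i (Phi (node_points s t))); last first.
    exists (/ INR n0.+1); first by apply: Rinv_0_lt_compat; apply: lt_0_INR; lia.
    exact: h.
  move=> t t1; have [i [/leP im Ui]] := Ucov (piB _ (PhiI s t t1)).
  have [r r0 [h Ux H]] := good_label_ex Uo secc secP im Ui.
  (* The configuration moves by at most [r / 4], below [r / 2]; the other half of [r] is left for
     the ball about it. *)
  exists (r / 2 / (2 * L)); first by apply: Rdiv_lt_0_compat; lra.
  have [n1 [n1r n10]] : exists n, / INR n < r / 2 /\ (0 < n)%coq_nat by apply: archimed_cor1; lra.
  exists n1 => t' t1' tt' n nn1; exists i => //.
  have cl : close (r / 2) (Phi (node_points s t')) (Phi (node_points s t)).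
    apply: (PhiL s t' t (r / 2 / (2 * L))) => //; first by move=> c; apply: Rlt_le.
    + by apply: Rlt_le; apply: Rdiv_lt_0_compat; lra.
    have -> : L * (r / 2 / (2 * L)) = r / 4 by field; lra.
    lra.
  have [|Ut' Lt'] := H _ (PhiI s t' t1') (close_le _ cl); first by lra.
  exists (PhiI s t' t1') => // y hy yt'; have [|Uy Ly] := H _ hy; last by rewrite Ly Lt'.
  have : close (/ INR n.+1 + r / 2) y (Phi (node_points s t)) by apply: close_trans yt' cl.
  apply: close_le; suff : / INR n.+1 <= / INR n1 by lra.
  apply: Rinv_le_contravar; first exact: lt_0_INR.
  by apply: le_INR; lia.
have good_cube s (t : V * 'I_N -> R) : unit_cube t ->
  good rho (color secP rho (Phi (node_points s t))) (Phi (node_points s t)).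
  move=> t1; apply: good_color.
  have -> : node_points s t = node_points (finfun s) t.
    by apply/funext => v; apply/funext => c; rewrite /node_points ffunE.
  exact: rhoP.
have [j [jr j0]] : exists j, / INR j < rho / L /\ (0 < j)%coq_nat.
  by apply: archimed_cor1; apply: Rdiv_lt_0_compat.
(* [2 * mesh M] is the inverse of [M], and [M > j > L / rho], so configurations from one grid cube
   are less than [rho] apart. *)
pose M := (2 * j + 1)%N.
have M_odd : odd M by rewrite /M addn1 /= mul2n odd_double.
pose lam x := (color secP rho x, section_label secP (color secP rho x) x).
have lamG g s t : model_symmetry Phi g -> unit_cube t ->
  lam (fun i => Phi (node_points s t) (leaf_perm g i)) = label_act g (lam (Phi (node_points s t))).
  move=> Gg t1; have [h Ux _] := good_cube s t t1.
  rewrite /lam -[fun i => _]/(Phi (node_points s t) \o leaf_perm g) color_perm /label_act /=.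
  by rewrite (section_label_perm secP _ (ltn_ord (color secP rho _)) Ux).
have mM : 2 * mesh M * L < rho.
  have j0' : 0 < INR j by apply: lt_0_INR.
  have jL : L < rho * INR j.
    apply: (Rmult_lt_reg_l (/ L * / INR j)).
      by apply: Rmult_lt_0_compat; apply: Rinv_0_lt_compat.
    have -> : / L * / INR j * L = / INR j by field; lra.
    by have -> : / L * / INR j * (rho * INR j) = rho / L by field; lra.
  have mM := @meshM M M_odd; have m0 := @mesh_pos M M_odd.
  have ME : INR M = 2 * INR j + 1 by rewrite /M INR_addn INR_muln /=; ring.
  rewrite ME in mM.
  have : 2 * mesh M * L < 2 * mesh M * (rho * INR j) by apply: Rmult_lt_compat_l; lra.
  move=> h; apply: Rlt_le_trans h _; nra.
have lam_near s t t' : unit_cube t -> unit_cube t' ->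
  (forall c, Rabs (t c - t' c) <= 2 * mesh M) ->
  (lam (Phi (node_points s t))).1 = (lam (Phi (node_points s t'))).1 ->
  lam (Phi (node_points s t)) = lam (Phi (node_points s t')).
  move=> t1 t1' tt' E; have m0 := @mesh_pos M M_odd.
  have [h _ H] := good_cube s t t1; rewrite /lam -(E : color _ _ _ = color _ _ _).
  have [|_ ->//] := H _ (PhiI s t' t1'); apply: (PhiL s t' t (2 * mesh M)) => //; try lra.
  by move=> c; rewrite Rabs_minus_sym.
have [Psi PsiP] := label_chain_map m.+1 (@model_symmetry1 _ _ _ _ Phi) (@model_symmetryM _ _ _ _ Phi)
  (@model_symmetryV _ _ _ _ Phi) (@leaf_trivial_chain _ _ _ _ Phi).
apply: (too_few_labels M_odd lamG lam_near PsiP).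
by have -> : #|V| = (k - alpha k)%N by lia.
Qed.

End LowerBound.

(** * Lexicographic order and Fox-Neuwirth strata *)

Section Lexicographic.
Local Open Scope R_scope.
Variables (n k : nat).
Implicit Types (p q : Pt n) (x y z : Conf n k).

Definition prefix_eq (l : nat) p q := forall c, (coord_index c < l)%N -> p c = q c.
Definition lex_lt p q := exists2 c, prefix_eq (coord_index c) p q & p c < q c.
Definition lex_ordered x := forall i j, (coord_index i < coord_index j)%N -> lex_lt (x i) (x j).

Lemma lex_lt_irrefl p : ~ lex_lt p p.
Proof. by move=> [c _]; lra. Qed.

Lemma lex_lt_trans p q r : lex_lt p q -> lex_lt q r -> lex_lt p r.
Proof.
move=> [c pc lc] [d pd ld]; case: (ltngtP (coord_index c) (coord_index d)) => cd.
- exists c => [e ec|]; first by rewrite pc // pd // (ltn_trans ec).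
  by rewrite -(pd c).
- exists d => [e ed|]; first by rewrite pc ?pd // (ltn_trans ed).
  by rewrite (pc d).
- have E := coord_index_inj cd; rewrite -E in pd ld; exists c => [e ec|]; last by lra.
  by rewrite pc ?pd.
Qed.

Lemma lex_lt_total p q : p <> q -> lex_lt p q \/ lex_lt q p.
Proof.
move=> pq; have exd : exists l, [exists c : Fin.t n, (coord_index c == l) && `[< p c <> q c >]].
  have [c pc] : exists c, p c <> q c.
    apply: contrapT => /forallNP h; apply: pq; apply/funext => c.
    by apply: contrapT; apply: h.
  by exists (coord_index c); apply/existsP; exists c; rewrite eqxx; apply/asboolP.
case: (ex_minnP exd) => l /existsP[c /andP[/eqP cl /asboolP pc]] lmin.
have pre : prefix_eq (coord_index c) p q.
  move=> d dc; apply: contrapT => pd; have := lmin (coord_index d).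
  rewrite -cl leqNgt dc => h; suff : false by []; apply: h.
  by apply/existsP; exists d; rewrite eqxx; apply/asboolP.
case: (Rtotal_order (p c) (q c)) => [lt|[//|gt]]; first by left; exists c.
by right; exists c => // d dc; rewrite pre.
Qed.

Lemma lex_ordered_inj x : lex_ordered x -> inj_conf x.
Proof.
move=> xo i j E; case: (ltngtP (coord_index i) (coord_index j)) => [/xo|/xo|/coord_index_inj //];
  by rewrite E => /lex_lt_irrefl.
Qed.

Lemma lex_ordered_lt x i j : lex_ordered x -> lex_lt (x i) (x j) -> (coord_index i < coord_index j)%N.
Proof.
move=> xo ij; case: (ltngtP (coord_index i) (coord_index j)) => // [/xo ji|/coord_index_inj E].
  by case: (@lex_lt_irrefl (x i)); apply: lex_lt_trans ij ji.
by rewrite E in ij; case: (lex_lt_irrefl ij).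
Qed.

Lemma increasing_perm_ge (s : {perm Fin.t k}) :
  (forall i j, (coord_index i < coord_index j)%N -> (coord_index (s i) < coord_index (s j))%N) ->
  forall i, (coord_index i <= coord_index (s i))%N.
Proof.
move=> si i; move: {-2}(coord_index i) (erefl (coord_index i)) => l; elim: l i => // l IH i il.
have [j jl] : exists j : Fin.t k, coord_index j = l.
  by apply: coord_indexK; have := coord_index_lt i; lia.
have := IH j (esym jl); have := si j i; rewrite jl -il => /(_ (ltnSn _)); lia.
Qed.

Lemma lex_ordered_perm x (s : {perm Fin.t k}) : lex_ordered x -> lex_ordered (x \o s) -> s = 1%g.
Proof.
move=> xo xso.
have s1 i j : (coord_index i < coord_index j)%N -> (coord_index (s i) < coord_index (s j))%N.
  by move=> /xso; apply: (@lex_ordered_lt x (s i) (s j) xo).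
have s2 i j : (coord_index i < coord_index j)%N ->
  (coord_index ((s^-1)%g i) < coord_index ((s^-1)%g j))%N.
  by move=> /xo ij; apply: (lex_ordered_lt xso); rewrite /= !permKV.
apply/permP => i; rewrite perm1; apply: coord_index_inj; apply/eqP; rewrite eqn_leq.
rewrite (increasing_perm_ge s1) andbT.
by have := increasing_perm_ge s2 (s i); rewrite permK.
Qed.

(** The position of a point is the number of points below it. *)
Lemma lex_sort x : inj_conf x -> exists s : {perm Fin.t k}, lex_ordered (x \o s).
Proof.
move=> xi; pose below i := [set j | `[< lex_lt (x j) (x i) >]].
have belowk i : (#|below i| < k)%N.
  apply: (@leq_trans #|[set: Fin.t k]|); last by rewrite cardsT card_fin.
  apply: proper_card; rewrite properEneq subsetT andbT.
  apply/eqP => /setP /(_ i); rewrite !inE; have [/lex_lt_irrefl //|] := asboolP (lex_lt (x i) (x i)).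
  by [].
have below_lt i j : lex_lt (x i) (x j) -> (#|below i| < #|below j|)%N.
  move=> ij; apply: proper_card; apply/properP; split.
    apply/fintype.subsetP => u; rewrite !inE => /asboolP ui; apply/asboolP.
    exact: lex_lt_trans ui ij.
  exists i; rewrite inE; first exact/asboolP.
  by apply/negP => /asboolP /lex_lt_irrefl.
have ex i : exists j : Fin.t k, coord_index j = #|below i| by apply: coord_indexK.
pose r i := sval (cid (ex i)).
have rE i : coord_index (r i) = #|below i| by rewrite /r; case: cid.
have rI : injective r.
  move=> i j ij; apply: contrapT => nij; have : x i <> x j by move=> /xi.
  by move=> /lex_lt_total[] /below_lt; rewrite -!rE ij ltnn.
exists ((perm rI)^-1)%g => i j ij /=.
set i' := _ i; set j' := _ j.
have iE : i = r i' by rewrite /i' -(permE rI) permKV.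
have jE : j = r j' by rewrite /j' -(permE rI) permKV.
have [|//|/below_lt] := @lex_lt_total (x i') (x j').
  by move=> /xi E; move: ij; rewrite iE jE E ltnn.
by rewrite -!rE -iE -jE; lia.
Qed.

(* Codimension of the Fox-Neuwirth stratum of [x]: each coordinate but the last contributes the
   number of coincidences among the truncations of the points. *)
Definition prefix_class l x (i : Fin.t k) : {set Fin.t k} :=
  [set j | `[< prefix_eq l (x i) (x j) >]].
Definition prefix_count l x := #|prefix_class l x @: [set: Fin.t k]|.
Definition codim x := (\sum_(l < n.-1) (k - prefix_count l.+1 x))%N.

Lemma prefix_count_perm l x (s : {perm Fin.t k}) : prefix_count l (x \o s) = prefix_count l x.
Proof.
rewrite /prefix_count; pose f (A : {set Fin.t k}) := s @^-1: A.
have fI : injective f.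
  move=> A B /setP E; apply/setP => i; have := E ((s^-1)%g i); by rewrite !inE permKV.
have -> : prefix_class l (x \o s) @: [set: Fin.t k] = f @: (prefix_class l x @: [set: Fin.t k]).
  rewrite -imset_comp; apply/setP => A; apply/imsetP/imsetP => -[i _ ->].
    by exists (s i) => //; apply/setP => j; rewrite !inE.
  by exists ((s^-1)%g i) => //; apply/setP => j; rewrite !inE /= permKV.
by rewrite card_imset.
Qed.

Lemma codim_perm x (s : {perm Fin.t k}) : codim (x \o s) = codim x.
Proof. by apply: eq_bigr => l _; rewrite prefix_count_perm. Qed.

Lemma prefix_count_le l x : (prefix_count l x <= k)%N.
Proof.
by apply: leq_trans (leq_imset_card _ _) _; rewrite cardsT card_fin.
Qed.

Lemma codim_le x : (0 < k)%N -> (codim x <= (k - 1) * (n - 1))%N.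
Proof.
move=> k0; rewrite /codim -(subn1 n) mulnC.
apply: (@leq_trans (\sum_(l < n - 1) (k - 1))); last by rewrite sum_nat_const card_ord.
apply: leq_sum => l _; apply: leq_sub2l; rewrite card_gt0; apply/set0Pn.
have [i _] := @coord_indexK k 0 k0; exists (prefix_class l.+1 x i).
exact: imset_f.
Qed.

(** The classes of [z] map onto those of [x], and equal numbers of classes make this map
    injective. *)
Lemma prefix_count_refine l x z :
  (forall i j, prefix_eq l (z i) (z j) -> prefix_eq l (x i) (x j)) ->
  (prefix_count l x <= prefix_count l z)%N /\
  (prefix_count l x = prefix_count l z ->
     forall i j, prefix_eq l (x i) (x j) -> prefix_eq l (z i) (z j)).
Proof.
move=> zx; pose h (A : {set Fin.t k}) := if [pick i in A] is Some i then prefix_class l x i else set0.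
have eqc y i j : prefix_eq l (y i) (y j) -> prefix_class l y i = prefix_class l y j.
  move=> ij; apply/setP => u; rewrite !inE; apply/asboolP/asboolP => h1 c cl.
    by rewrite -ij ?h1.
  by rewrite ij ?h1.
have hE i : h (prefix_class l z i) = prefix_class l x i.
  rewrite /h; case: pickP => [j|/(_ i)]; last by rewrite inE => /asboolP[].
  by rewrite inE => /asboolP /zx /eqc.
have im : prefix_class l x @: [set: Fin.t k] = h @: (prefix_class l z @: [set: Fin.t k]).
  by rewrite -imset_comp; apply: eq_imset => i /=; rewrite hE.
rewrite /prefix_count im; split; first exact: leq_imset_card.
move=> /eqP /imset_injP hI i j ij.
have E : prefix_class l z i = prefix_class l z j.
  by apply: hI; rewrite ?imset_f // !hE; apply: eqc.
have : j \in prefix_class l z j by rewrite inE; apply/asboolP.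
by rewrite -E inE => /asboolP.
Qed.

(** A small perturbation can only destroy coincidences, which raises the prefix counts; equal
    codimension forces each of them to persist. Strict inequalities persist too, so the order is
    unchanged. *)
Lemma codim_lex_stable x : lex_ordered x -> exists2 r, 0 < r &
  forall z, close r z x -> codim z = codim x -> lex_ordered z.
Proof.
move=> xo; have [||r r0 h] := @fin_uniform ((Fin.t k * Fin.t k) * Fin.t n)%type
  (fun u r => x u.1.1 u.2 <> x u.1.2 u.2 -> 2 * r <= Rabs (x u.1.1 u.2 - x u.1.2 u.2)).
- by move=> u r r' rr h /h; lra.
- move=> [[i j] c] /=; have [E|ne] := pselect (x i c = x j c); first by exists 1 => //; lra.
  exists (Rabs (x i c - x j c) / 2); last by move=> _; lra.
  by have := Rabs_pos_lt (x i c - x j c); lra.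
exists r => // z zx cz.
have near i c := Rabs_def2 _ _ (zx i c).
have z_eq i j c : z i c = z j c -> x i c = x j c.
  move=> E; apply: contrapT => /(h ((i, j), c)) /=; rewrite /Rabs.
  by have := near i c; have := near j c; case: Rcase_abs; lra.
have z_lt i j c : x i c < x j c -> z i c < z j c.
  move=> lt; have : x i c <> x j c by lra.
  move=> /(h ((i, j), c)) /=; rewrite /Rabs.
  by have := near i c; have := near j c; case: Rcase_abs; lra.
have pz l i j : prefix_eq l (z i) (z j) -> prefix_eq l (x i) (x j).
  by move=> p c cl; apply: z_eq; apply: p.
(* A comparison at a coordinate involves only earlier ones, so prefixes shorter than [n] suffice:
   the empty one and those counted by [codim]. *)
have cnt l : (l < n)%N -> forall i j, prefix_eq l (x i) (x j) -> prefix_eq l (z i) (z j).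
  case: l => [|l] ln; first by move=> i j _ c.
  have [_ ] := prefix_count_refine (pz l.+1); apply.
  have ln' : (l < n.-1)%N by lia.
  have le (u : 'I_n.-1) : (k - prefix_count u.+1 z <= k - prefix_count u.+1 x)%N.
    by apply: leq_sub2l; case: (prefix_count_refine (pz u.+1)).
  have := leqif_sum (fun (u : 'I_n.-1) (_ : true) => leqif_eq (le u)).
  move=> [_]; rewrite -/(codim z) -/(codim x) cz eqxx => /esym/forallP /(_ (Ordinal ln')) /= /eqP.
  by have := prefix_count_le l.+1 x; have := prefix_count_le l.+1 z; lia.
move=> i j /xo[c pc lc]; exists c; last exact: z_lt.
by apply: cnt => //; apply: coord_index_lt.
Qed.

(** Inside the segment the earlier of the two deciding coordinates decides; at the ends one weight
    vanishes, so they are treated separately. *)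
Lemma lex_lt_convex p q p' q' t : 0 <= t <= 1 -> lex_lt p q -> lex_lt p' q' ->
  lex_lt (fun c => (1 - t) * p c + t * p' c) (fun c => (1 - t) * q c + t * q' c).
Proof.
move=> t01 [c pc lc] [d pd ld].
have [t0|t0] := Req_dec t 0.
  by exists c => [e ec|]; rewrite t0; [rewrite (pc e ec)|]; lra.
have [t1|t1] := Req_dec t 1.
  by exists d => [e ed|]; rewrite t1; [rewrite (pd e ed)|]; lra.
case: (ltngtP (coord_index c) (coord_index d)) => cd.
- exists c => [e ec|]; first by rewrite pc // pd // (ltn_trans ec).
  by rewrite (pd c cd); apply: Rplus_lt_compat_r; apply: Rmult_lt_compat_l; lra.
- exists d => [e ed|]; first by rewrite pc ?pd // (ltn_trans ed).
  by rewrite (pc d cd); apply: Rplus_lt_compat_l; apply: Rmult_lt_compat_l; lra.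
- have E := coord_index_inj cd; rewrite -E in pd ld; exists c => [e ec|]; last by apply: Rplus_lt_compat; apply: Rmult_lt_compat_l; lra.
  by rewrite pc ?pd.
Qed.

Definition axis_conf : Conf n k := fun i c => if coord_index c == 0%N then INR (coord_index i) else 0.
Definition segment x (t : R) : Conf n k := fun i c => (1 - t) * x i c + t * axis_conf i c.

Lemma axis_conf_ordered : (0 < n)%N -> lex_ordered axis_conf.
Proof.
move=> n0 i j ij; have [c c0] := @coord_indexK n 0 n0; exists c.
  by move=> d; rewrite c0.
by rewrite /axis_conf c0 eqxx; apply: lt_INR; lia.
Qed.

Lemma segment_inj x t : (0 < n)%N -> lex_ordered x -> 0 <= t <= 1 -> inj_conf (segment x t).
Proof.
move=> n0 xo t01; apply: lex_ordered_inj => i j ij; apply: lex_lt_convex => //; first exact: xo.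
exact: axis_conf_ordered.
Qed.

Lemma segment_close x t r : 0 <= t <= 1 -> 0 < r -> exists2 e, 0 < e &
  forall y t', 0 <= t' <= 1 -> close e y x -> Rabs (t' - t) < e ->
    close r (segment y t') (segment x t).
Proof.
move=> t01 r0; have [||e e0 h] := @fin_uniform (Fin.t k * Fin.t n)%type
  (fun u e => e * (1 + Rabs (axis_conf u.1 u.2 - x u.1 u.2)) < r).
- by move=> u e e' ee; have := Rabs_pos (axis_conf u.1 u.2 - x u.1 u.2); nra.
- move=> [i c] /=; set a := Rabs _; have a0 : 0 <= a by apply: Rabs_pos.
  exists (r / (2 * (1 + a))); first by apply: Rdiv_lt_0_compat; lra.
  have -> : r / (2 * (1 + a)) * (1 + a) = r / 2 by field; lra.
  lra.
exists e => // y t' t01' yx tt' i c; rewrite /segment.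
have := h (i, c) => /=; have := yx i c.
set a := axis_conf i c; set u := x i c; set w := y i c => wu ha.
have -> : (1 - t') * w + t' * a - ((1 - t) * u + t * a) =
  (1 - t') * (w - u) + (t' - t) * (a - u) by ring.
apply: Rle_lt_trans (Rabs_triang _ _) _; rewrite !Rabs_mult.
have c1 : Rabs (1 - t') <= 1 by apply: Rabs_le; lra.
have p1 := Rabs_pos (1 - t'); have p2 := Rabs_pos (w - u); have p3 := Rabs_pos (a - u).
have e1 : Rabs (1 - t') * Rabs (w - u) <= e by nra.
have e2 : Rabs (t' - t) * Rabs (a - u) <= e * Rabs (a - u) by nra.
lra.
Qed.

Lemma segment_open x : (0 < n)%N -> lex_ordered x -> exists2 r, 0 < r &
  forall y, close r y x -> forall t, 0 <= t <= 1 -> inj_conf (segment y t).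
Proof.
move=> n0 xo; have [|m h] := @interval_covering (fun m t =>
  forall y, close (/ INR m.+1) y x -> inj_conf (segment y t)); last first.
  exists (/ INR m.+1); first by apply: Rinv_0_lt_compat; apply: lt_0_INR; lia.
  by move=> y yx t t01; apply: (h m (leqnn m)).
move=> t t01; have [r r0 hr] := inj_conf_close (segment_inj n0 xo t01).
have [e e0 he] := segment_close x t01 r0; exists e => //.
have [m [me m0]] := archimed_cor1 e e0; exists m => t' t01' tt' j mj y yx; apply: hr.
apply: he => //; apply: close_le yx; apply: Rle_trans (Rlt_le _ _ me).
apply: Rinv_le_contravar; first exact: lt_0_INR.
by apply: le_INR; lia.
Qed.

End Lexicographic.

(** * The categorical cover by neighbourhoods of strata *)

Section CategoryCover.
Local Open Scope R_scope.
Variables (n k j : nat).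
Hypothesis n_pos : (0 < n)%N.
Implicit Types (x y z : Conf n k) (b : UConf n k).

Definition tame_ball x (r : R) := [/\ 0 < r, lex_ordered x, codim x = j,
  forall z, close r z x -> codim z = j -> lex_ordered z &
  forall y, close r y x -> forall t, 0 <= t <= 1 -> inj_conf (segment y t)].
(** The radius is halved so that centres of two meeting balls are closer than the larger full
    radius. *)
Definition sheet y := exists x r, tame_ball x r /\ close (r / 2) y x.

Lemma tame_ball_ex x : lex_ordered x -> codim x = j -> exists r, tame_ball x r.
Proof.
move=> xo cx; have [r r0 h] := codim_lex_stable xo; have [r' r0' h'] := segment_open n_pos xo.
have m0 := Rmin_pos _ _ r0 r0'; exists (Rmin r r'); split=> //.
  by move=> z zx cz; apply: h; [apply: close_le zx; apply: Rmin_l|rewrite cx].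
by move=> y yx; apply: h'; apply: close_le yx; apply: Rmin_r.
Qed.

Lemma sheet_segment y : sheet y -> forall t, 0 <= t <= 1 -> inj_conf (segment y t).
Proof. by move=> [x [r [[r0 _ _ _ h] yx]]]; apply: h; apply: close_le yx; lra. Qed.

Lemma segment0 y : segment y 0 = y.
Proof. by apply/funext => i; apply/funext => c; rewrite /segment; lra. Qed.

Lemma segment1 y : segment y 1 = @axis_conf n k.
Proof. by apply/funext => i; apply/funext => c; rewrite /segment; lra. Qed.

Lemma sheet_inj y : sheet y -> inj_conf y.
Proof. by move=> /sheet_segment/(_ 0); rewrite segment0; apply; lra. Qed.

Lemma sheet_open y : sheet y -> exists2 e, 0 < e & forall z, close e z y -> sheet z.
Proof.
move=> [x [r [tx yx]]]; have [e [e0 h]] := @open_ball n k (r / 2) x y yx.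
by exists e => // z zy; exists x, r; split=> //; apply: h.
Qed.

(** The centre of the smaller ball, suitably reordered, lies in the larger ball and has the same
    codimension. It is therefore still ordered, and only the identity keeps an ordered configuration
    ordered. *)
Lemma sheet_perm y (s : {perm Fin.t k}) : sheet y -> sheet (y \o s) -> s = 1%g.
Proof.
move=> [x [r [[r0 xo cx hx _] yx]]] [x' [r' [[r0' xo' cx' hx' _] yx']]].
have [rr|rr] := Rle_dec r' r.
  have E : lex_ordered (x' \o (s^-1)%g).
    apply: hx; last by rewrite codim_perm.
    apply: (@close_le _ _ (r' / 2 + r / 2)); first by lra.
    apply: close_trans yx => i c.
    by have := close_sym yx' ((s^-1)%g i) c; rewrite /= permKV.
  by apply: invg_inj; rewrite (lex_ordered_perm xo' E) invg1.
apply: (lex_ordered_perm xo); apply: hx'; last by rewrite codim_perm.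
apply: (@close_le _ _ (r / 2 + r' / 2)); first by lra.
by apply: close_trans yx'; apply: close_perm; apply: close_sym.
Qed.

Lemma sheet_unique y y' : sheet y -> sheet y' -> pset y = pset y' -> y = y'.
Proof.
move=> sy sy' E; have [s yE] := pset_eq_perm (sheet_inj sy) E.
have s1 : s = 1%g by apply: (sheet_perm sy'); rewrite -yE.
by rewrite yE s1; apply/funext => i; rewrite /= perm1.
Qed.

Definition stratum b := exists2 y, sheet y & proj1_sig b = pset y.

Lemma near_sheet x y (hx : inj_conf x) : sheet y -> pset x = pset y -> forall r, 0 < r ->
  exists2 e, 0 < e & forall z (hz : inj_conf z), close e z x ->
    exists y', [/\ sheet y', close r y' y & pset z = pset y'].
Proof.
move=> sy E r r0; have [s xE] := pset_eq_perm hx E.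
have [e e0 h] := sheet_open sy; have m0 := Rmin_pos _ _ r0 e0.
exists (Rmin r e) => // z hz zx; exists (z \o (s^-1)%g).
have cl : close (Rmin r e) (z \o (s^-1)%g) y.
  by move=> i c; have := zx ((s^-1)%g i) c; rewrite xE /= permKV.
split; [|by apply: close_le cl; apply: Rmin_l|by rewrite pset_perm].
by apply: h; apply: close_le cl; apply: Rmin_r.
Qed.

Lemma stratum_open : openB stratum.
Proof.
apply/openBP => x hx [y sy E]; have [e e0 h] := near_sheet hx sy E Rlt_0_1.
by exists e => // z hz /(h z hz)[y' [sy' _ Ez]]; exists y'.
Qed.

(** Extends the homotopy to all real times, because [openBR] tests neighbourhoods in the whole
    line. *)
Definition clamp (t : R) := Rmax 0 (Rmin 1 t).

Lemma clampP t : 0 <= clamp t <= 1.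
Proof. by rewrite /clamp /Rmax /Rmin; repeat case: Rle_dec; lra. Qed.

Lemma clamp_id t : 0 <= t <= 1 -> clamp t = t.
Proof. by rewrite /clamp /Rmax /Rmin; repeat case: Rle_dec; lra. Qed.

Lemma clamp_lipschitz t t' : Rabs (clamp t' - clamp t) <= Rabs (t' - t).
Proof.
by rewrite /clamp /Rmax /Rmin /Rabs; repeat (case: Rle_dec || case: Rcase_abs); lra.
Qed.

Lemma stratum_contractible : contractible_in stratum.
Proof.
have ai : inj_conf (@axis_conf n k) := lex_ordered_inj (axis_conf_ordered n_pos).
have exs b : exists y, stratum b -> sheet y /\ proj1_sig b = pset y.
  by have [[y sy E]|nb] := pselect (stratum b); [exists y|exists (@axis_conf n k)].
pose s b := sval (cid (exs b)).
have sP b : stratum b -> sheet (s b) /\ proj1_sig b = pset (s b) by rewrite /s; case: cid.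
(* The default [b] makes [H] total; over the stratum the segment is always injective. *)
pose H b t := if pselect (inj_conf (segment (s b) (clamp t))) is left h then piB _ h else b.
have HE b t (h : inj_conf (segment (s b) (clamp t))) : H b t = piB _ h.
  by rewrite /H; case: pselect => // h'; rewrite (Prop_irrelevance h h').
have Hi b t : stratum b -> inj_conf (segment (s b) (clamp t)).
  by move=> /sP[sb _]; apply: sheet_segment => //; apply: clampP.
exists H, (piB _ ai); split; last first.
  move=> b sb; have [sh E] := sP b sb; split.
    rewrite (HE b 0 (Hi b 0 sb)); apply: UConf_eq => /=.
    by rewrite clamp_id; [rewrite segment0|lra].
  by rewrite (HE b 1 (Hi b 1 sb)); apply: piB_eq; rewrite clamp_id; [rewrite segment1|lra].
move=> W Wo; exists (fun b t => stratum b /\ W (H b t)); split; last first.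
  by move=> b t [sb _]; split=> [|[]].
move=> b t [sb]; rewrite (HE b t (Hi b t sb)) => Wb.
have [r r0 hr] := (openBP W).1 Wo _ _ Wb.
have [e e0 he] := segment_close (s b) (clampP t) r0.
exists (fun b' => stratum b' /\ close e (s b') (s b)), e; split; last first.
  split; first by split=> //; apply: close_refl.
  split=> // b' t' [sb' cl] tt'; split=> //.
  rewrite (HE b' t' (Hi b' t' sb')); apply: hr; apply: he => //; first exact: clampP.
  exact: Rle_lt_trans (clamp_lipschitz _ _) tt'.
apply/openBP => x hx [sx cl]; have [shx Ex] := sP _ sx.
have [d [d0 hd]] := @open_ball n k e (s b) _ cl.
have [e' e0' h] := near_sheet hx shx Ex d0.
exists e' => // z hz /(h z hz)[y' [sy' cy' Ez]].
have sz : stratum (piB z hz) by exists y'.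
split=> //; have [shz Ez'] := sP _ sz.
(* At most one ordering lies in the sheet, so the choice made by [s] agrees with the nearby lift and
   is continuous. *)
have -> : s (piB z hz) = y' by apply: sheet_unique => //; rewrite -Ez' -Ez.
exact: hd.
Qed.

End CategoryCover.

Lemma category_cover (n k : nat) : (0 < n)%N -> (0 < k)%N ->
  cover_by (n := n) (k := k) contractible_in ((k - 1) * (n - 1))%N.
Proof.
move=> n0 k0; exists (fun j => @stratum n k j); split.
  by move=> j _; split; [apply: stratum_open|apply: stratum_contractible].
move=> b; have [x [hx ->]] := piB_surj b; have [s xo] := lex_sort hx.
exists (codim (x \o s)); split; first by apply/leP; apply: codim_le.
have [r tb] := tame_ball_ex n0 xo erefl.
exists (x \o s); last by rewrite pset_perm.
have [r0 _ _ _ _] := tb; exists (x \o s), r; split=> //; apply: close_refl; lra.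
Qed.

(** * Lifting contractions to ordered configurations *)

Section HomotopyLifting.
Local Open Scope R_scope.
Variables (n k : nat).
Implicit Types (x y z : Conf n k) (b : UConf n k).

Definition separated (r : R) x := forall i j, (forall c, Rabs (x i c - x j c) < r) -> i = j.

(** Within half the separation of [x], a point of [z] can match only the point of [y] with the same
    index. *)
Lemma near_lift_unique r x y z : separated r x -> close (r / 2) y x -> close (r / 2) z x ->
  inj_conf z -> pset z = pset y -> z = y.
Proof.
move=> sx yx zx zi E; have [s zE] := pset_eq_perm zi E.
have s1 i : s i = i.
  apply: sx => c; have -> : x (s i) c - x i c = - (y (s i) c - x (s i) c) + (z i c - x i c).
    by rewrite zE /=; ring.
  apply: Rle_lt_trans (Rabs_triang _ _) _; rewrite Rabs_Ropp.
  by have := yx (s i) c; have := zx i c; lra.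
by rewrite zE; apply/funext => i; rewrite /= s1.
Qed.

Lemma openB_local (W : UConf n k -> Prop) :
  (forall b, W b -> exists V, [/\ openB V, V b & forall b', V b' -> W b']) -> openB W.
Proof.
move=> loc; apply/openBP => x h /loc[V [/openBP Vo Vx VW]].
by have [r r0 hr] := Vo x h Vx; exists r => // y h' yx; apply: VW; apply: hr.
Qed.

Lemma openB_inter (V W : UConf n k -> Prop) : openB V -> openB W -> openB (fun b => V b /\ W b).
Proof.
move=> /openBP Vo /openBP Wo; apply/openBP => x h [Vx Wx].
have [r r0 hr] := Vo x h Vx; have [r' r0' hr'] := Wo x h Wx.
exists (Rmin r r'); first exact: Rmin_pos.
by move=> y h' yx; split; [apply: hr|apply: hr']; apply: close_le yx; [apply: Rmin_l|apply: Rmin_r].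
Qed.

Variables (U : UConf n k -> Prop) (H : UConf n k -> R -> UConf n k).
Hypothesis U_open : openB U.
Hypothesis H_cont : cont_on_BRB (fun b t => U b /\ 0 <= t <= 1) H.

Definition over b t y := inj_conf y /\ proj1_sig (H b t) = pset y.

Lemma over_ex b t : exists y, over b t y.
Proof. by have [y [h E]] := piB_surj (H b t); exists y; split=> //; rewrite E. Qed.

(** Continuity of [H] read on lifts: the unordered configurations with an ordering close to [y] form
    an open set. *)
Lemma homotopy_near b t y r : U b -> 0 <= t <= 1 -> over b t y -> 0 < r ->
  exists V e, [/\ openB V, V b, 0 < e & forall b' t', V b' -> U b' -> 0 <= t' <= 1 ->
    Rabs (t' - t) < e -> exists2 y', over b' t' y' & close r y' y].
Proof.
move=> Ub t01 [yi yE] r0.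
pose W b' := exists2 y', inj_conf y' /\ proj1_sig b' = pset y' & close r y' y.
have Wo : openB W.
  apply/openBP => x h [y' [y'i E] cl]; have [s xE] := pset_eq_perm h E.
  have [e [e0 he]] := @open_ball n k r y y' cl.
  exists e => // z hz zx; exists (z \o (s^-1)%g); first split.
  - exact: inj_conf_perm.
  - by rewrite pset_perm.
  by apply: he => i c; have := zx ((s^-1)%g i) c; rewrite xE /= permKV.
have [O [Oo OE]] := H_cont Wo.
have /Oo[V [e [Vo [Vb [e0 hV]]]]] : O b t by apply/OE => //; exists y => //; apply: close_refl.
exists V, e; split=> // b' t' Vb' Ub' t01' tt'.
by have /OE[] : O b' t' by [apply: hV]; [split|move=> y'; exists y'].
Qed.

Definition lift b (a e : R) (g : R -> Conf n k) :=
  (forall t, a <= t <= e -> over b t (g t)) /\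
  forall t, a <= t <= e -> forall r, 0 < r -> exists2 d, 0 < d &
    forall t', a <= t' <= e -> Rabs (t' - t) < d -> close r (g t') (g t).

Lemma lift_perm b a e g (s : {perm Fin.t k}) : lift b a e g -> lift b a e (fun t => g t \o s).
Proof.
move=> [g1 g2]; split=> t tae.
  by have [gi gE] := g1 t tae; split; [apply: inj_conf_perm|rewrite pset_perm].
move=> r r0; have [d d0 h] := g2 t tae r r0; exists d => // t' tae' tt'.
by apply: close_perm; apply: h.
Qed.

Lemma lift_glue b a m e g g' : a <= m <= e -> lift b a m g -> lift b m e g' -> g m = g' m ->
  lift b a e (fun t => if Rle_dec t m then g t else g' t).
Proof.
move=> ame [g1 g2] [g1' g2'] gm; split=> t tae.
  by case: Rle_dec => tm; [apply: g1|apply: g1']; lra.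
move=> r r0; case: Rle_dec => tm /=.
  have [|d d0 h] := g2 t _ r r0; first by lra.
  have [tm'|tm'] := Req_dec t m.
    have [|d' d0' h'] := g2' m _ r r0; first by lra.
    exists (Rmin d d'); first exact: Rmin_pos.
    move=> t' tae' tt'; have l1 := Rmin_l d d'; have l2 := Rmin_r d d'.
    case: Rle_dec => t'm /=; first by apply: h; lra.
    by rewrite tm' gm; apply: h'; rewrite -?tm'; lra.
  exists (Rmin d (m - t)); first by apply: Rmin_pos; lra.
  move=> t' tae' tt'; have l1 := Rmin_l d (m - t); have l2 := Rmin_r d (m - t).
  have [u1 u2] := Rabs_def2 _ _ (Rlt_le_trans _ _ _ tt' l2).
  by case: Rle_dec => t'm /=; [apply: h|]; lra.
have [|d d0 h] := g2' t _ r r0; first by lra.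
exists (Rmin d (t - m)); first by apply: Rmin_pos; lra.
move=> t' tae' tt'; have l1 := Rmin_l d (t - m); have l2 := Rmin_r d (t - m).
have [u1 u2] := Rabs_def2 _ _ (Rlt_le_trans _ _ _ tt' l2).
by case: Rle_dec => t'm /=; [|apply: h]; lra.
Qed.

(** Lifts near a separated continuous path are unique, so any pointwise choice [g] is continuous.
    Three distances of [r / 8] stay below the [r / 2] of [near_lift_unique]. *)
Lemma lift_near b a e (g0 : R -> Conf n k) r : U b -> 0 <= a -> e <= 1 -> 0 < r ->
  (forall t, a <= t <= e -> separated r (g0 t)) ->
  (forall t, a <= t <= e -> exists2 d, 0 < d &
     forall t', a <= t' <= e -> Rabs (t' - t) < d -> close (r / 8) (g0 t') (g0 t)) ->
  forall g, (forall t, a <= t <= e -> over b t (g t) /\ close (r / 8) (g t) (g0 t)) -> lift b a e g.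
Proof.
move=> Ub a0 e1 r0 sep cont g gP; split=> t tae; first by case: (gP t tae).
move=> r' r0'; have [go gc] := gP t tae.
have m0 : 0 < Rmin r' (r / 8) by apply: Rmin_pos; lra.
have [|V [d [_ Vb d0 h]]] := homotopy_near Ub _ go m0; first by lra.
have [d' d0' h'] := cont t tae.
exists (Rmin d d'); first exact: Rmin_pos.
move=> t' tae' tt'; have l1 := Rmin_l d d'; have l2 := Rmin_r d d'.
have [|y yo yc] := h b t' Vb Ub _ (Rlt_le_trans _ _ _ tt' l1); first by lra.
have [go' gc'] := gP t' tae'.
have -> : g t' = y.
  apply: (@near_lift_unique r (g0 t')); [exact: sep| |by apply: close_le gc'; lra|by case: go'|].
    apply: (@close_le _ _ (r / 8 + (r / 8 + r / 8))); first by lra.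
    apply: (close_trans (close_le (Rmin_r _ _) yc)); apply: (close_trans gc).
    by apply: close_sym; apply: h' => //; lra.
  by case: go' => _ <-; case: yo.
by apply: close_le yc; apply: Rmin_l.
Qed.

(** Lifts run backwards from time 1. The end point is quantified inside the interval property, so
    that the right piece provides the end point of the left one. *)
Lemma lift_ex b y : U b -> over b 1 y -> exists2 g, lift b 0 1 g & g 1 = y.
Proof.
move=> Ub; move: y; apply: (@cousin (fun a e => forall y, over b e y ->
  exists2 g, lift b a e g & g e = y)).
  move=> a m e am me h1 h2 y yo; have [g2 l2 gE] := h2 y yo.
  have [|g1 l1 gE1] := h1 (g2 m); first by apply: l2.1; lra.
  exists (fun t => if Rle_dec t m then g1 t else g2 t); first by apply: lift_glue => //; lra.
  case: Rle_dec => //= em; have E : e = m by lra.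
  by rewrite -gE E.
move=> x x01; have [y0 y0o] := over_ex b x; have [r r0 sep] := conf_separation y0o.1.
have [|V [d [_ Vb d0 h]]] := homotopy_near (r := r / 8) Ub x01 y0o; first by lra.
exists d => // a e ae e1 ax ex y yo.
have near t : a <= t <= e -> exists z, over b t z /\ close (r / 8) z y0.
  move=> tae; have [| |z zo zc] := h b t Vb Ub; [lra| |by exists z].
  by have [? ?] := Rabs_def2 _ _ ax; have [? ?] := Rabs_def2 _ _ ex; apply: Rabs_def1; lra.
have exg t : exists z, a <= t <= e -> over b t z /\ close (r / 8) z y0.
  have [tae|nt] := pselect (a <= t <= e); last by exists y0.
  by have [z zP] := near t tae; exists z.
pose g t := sval (cid (exg t)).
have gP t : a <= t <= e -> over b t (g t) /\ close (r / 8) (g t) y0 by rewrite /g; case: cid.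
have lg : lift b a e g.
  apply: (@lift_near b a e (fun=> y0) r) => //; first by lra.
  by move=> t tae; exists 1; [lra|move=> *; apply: close_refl; lra].
have [|[_ gE] _] := gP e; first by lra.
(* The local lift ends at some ordering of the right configuration; a permutation moves its end to
   [y]. *)
have [s yE] : exists s : {perm Fin.t k}, y = g e \o s.
  by apply: pset_eq_perm; [case: yo|rewrite -gE; case: yo].
by exists (fun t => g t \o s) => //; apply: lift_perm.
Qed.

Lemma lift_unique b g g' : lift b 0 1 g -> lift b 0 1 g' -> g 1 = g' 1 -> g 0 = g' 0.
Proof.
move=> [g1 g2] [g1' g2']; apply: (@cousin (fun a e => g e = g' e -> g a = g' a)).
  by move=> a m e _ _ h1 h2 /h2.
move=> x x01; have [gi gE] := g1 x x01; have [gi' gE'] := g1' x x01.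
have [r r0 sep] := conf_separation gi.
have [s sE] : exists s : {perm Fin.t k}, g' x = g x \o s.
  by apply: pset_eq_perm => //; rewrite -gE' gE.
have [|d d0 h] := g2 x x01 (r / 4); first by lra.
have [|d' d0' h'] := g2' x x01 (r / 4); first by lra.
exists (Rmin d d'); first exact: Rmin_pos.
have l1 := Rmin_l d d'; have l2 := Rmin_r d d'.
move=> a e ae e1 ax ex E.
have c1 : close (r / 4) (g e) (g x) by apply: h; lra.
have c2 : close (r / 4) (g e) (g' x) by rewrite E; apply: h'; lra.
have s1 i : s i = i.
  apply: sep => c; have := c1 i c; have := c2 i c; rewrite sE /= => u1 u2.
  have -> : g x (s i) c - g x i c = - (g e i c - g x (s i) c) + (g e i c - g x i c) by ring.
  by apply: Rle_lt_trans (Rabs_triang _ _) _; rewrite Rabs_Ropp; lra.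
have gx : g' x = g x by rewrite sE; apply/funext => i; rewrite /= s1.
have [gai gaE] := g1 a ltac:(lra); have [gai' gaE'] := g1' a ltac:(lra).
apply: (@near_lift_unique r (g x)) => //; last by rewrite -gaE -gaE'.
  by rewrite -gx; apply: (@close_le _ _ (r / 4)); [lra|apply: h'; lra].
by apply: (@close_le _ _ (r / 4)); [lra|apply: h; lra].
Qed.

(** By compactness [g0] is uniformly separated and has lifts close to it at all times for base
    points near [b0]; these end at [ct] because the contraction has a fixed end point. *)
Lemma lift_stable b0 g0 c0 ct r : U b0 -> lift b0 0 1 g0 -> g0 1 = ct -> 0 < r ->
  (forall b, U b -> H b 1 = c0) ->
  exists V, [/\ openB V, V b0 & forall b, V b -> U b ->
    exists g, [/\ lift b 0 1 g, g 1 = ct & close r (g 0) (g0 0)]].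
Proof.
move=> Ub0 [g1 g2] gct r0 H1.
have [|m hm] := @interval_covering (fun m t => separated (/ INR m.+1) (g0 t)).
  move=> t t01; have [s s0 sep] := conf_separation (g1 t t01).1.
  have [|d d0 h] := g2 t t01 (s / 4); first by lra.
  exists d => //; have [|m [ms m0]] := archimed_cor1 (s / 4); first by lra.
  exists m => t' t01' tt' m' mm' i j near; apply: sep => c.
  have cl := h t' t01' tt'; have := near c; have := cl i c; have := cl j c => u1 u2 u3.
  have -> : g0 t i c - g0 t j c = - (g0 t' i c - g0 t i c) + (g0 t' j c - g0 t j c) +
    (g0 t' i c - g0 t' j c) by ring.
  apply: Rle_lt_trans (Rabs_triang _ _) _.
  have := Rabs_triang (- (g0 t' i c - g0 t i c)) (g0 t' j c - g0 t j c); rewrite Rabs_Ropp.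
  have : / INR m'.+1 <= / INR m.
    by apply: Rinv_le_contravar; [exact: lt_0_INR|apply: le_INR; lia].
  lra.
pose q := / INR m.+1.
have q0 : 0 < q by apply: Rinv_0_lt_compat; apply: lt_0_INR; lia.
have sep t : 0 <= t <= 1 -> separated q (g0 t) by apply: hm.
pose rho := Rmin r (q / 8).
have rho0 : 0 < rho by apply: Rmin_pos; lra.
have rhoq : rho <= q / 8 by apply: Rmin_r.
have [V [Vo Vb0 VP]] : exists V, [/\ openB V, V b0 & forall b t, V b -> U b -> 0 <= t <= 1 ->
    exists2 y, over b t y & close rho y (g0 t)].
  apply: (@cousin (fun a e => exists V, [/\ openB V, V b0 & forall b t, V b -> U b -> a <= t <= e ->
    exists2 y, over b t y & close rho y (g0 t)])).
    move=> a p e _ _ [V1 [o1 v1 h1]] [V2 [o2 v2 h2]].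
    exists (fun b => V1 b /\ V2 b); split; [exact: openB_inter|by []|].
    by move=> b t [V1b V2b] Ub tae; have [tp|tp] := Rle_dec t p; [apply: h1|apply: h2] => //; lra.
  move=> x x01.
  have [|V [d [Vo Vb d0 h]]] := homotopy_near (r := rho / 2) Ub0 x01 (g1 x x01); first by lra.
  have [|d' d0' h'] := g2 x x01 (rho / 2); first by lra.
  exists (Rmin d d'); first exact: Rmin_pos.
  have l1 := Rmin_l d d'; have l2 := Rmin_r d d'.
  move=> a e ae e1 ax ex; exists V; split=> // b t Vb' Ub tae.
  have tx : Rabs (t - x) < Rmin d d'.
    by have [? ?] := Rabs_def2 _ _ ax; have [? ?] := Rabs_def2 _ _ ex; apply: Rabs_def1; lra.
  have [||y yo yc] := h b t Vb' Ub; [lra|lra|exists y => //].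
  apply: (@close_le _ _ (rho / 2 + rho / 2)); first by lra.
  by apply: close_trans yc _; apply: close_sym; apply: h'; lra.
exists V; split=> // b Vb Ub.
have exg t : exists z, 0 <= t <= 1 -> over b t z /\ close rho z (g0 t).
  have [t01|nt] := pselect (0 <= t <= 1); last by exists ct.
  by have [z zo zc] := VP b t Vb Ub t01; exists z.
pose g t := sval (cid (exg t)).
have gP t : 0 <= t <= 1 -> over b t (g t) /\ close rho (g t) (g0 t) by rewrite /g; case: cid.
exists g; split.
- apply: (@lift_near b 0 1 g0 q) => //; [lra|lra| |].
    by move=> t t01; apply: g2 => //; lra.
  by move=> t t01; have [go gc] := gP t t01; split=> //; apply: close_le gc.
- have [|go gc] := gP 1; first by lra.
  have [|ci cE] := g1 1; first by lra.
  apply: (@near_lift_unique q (g0 1)); [apply: sep; lra| |by apply: close_le gc; lra|by case: go|].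
    by rewrite gct; apply: close_refl; lra.
  by case: go => _ <-; rewrite H1 // -(H1 b0) // cE gct.
by have [|_ gc] := gP 0; [lra|apply: close_le gc; apply: Rmin_l].
Qed.

(** All lifts end at the same ordering [ct], and their starting points form the section. Uniqueness
    identifies the chosen lift with the one from [lift_stable], which gives continuity. *)
Lemma contraction_section c0 : (forall b, U b -> H b 0 = b /\ H b 1 = c0) -> local_section U.
Proof.
move=> HU; have [ct [cti cE]] := piB_surj c0.
have exg b : exists g, U b -> lift b 0 1 g /\ g 1 = ct.
  have [Ub|nU] := pselect (U b); last by exists (fun=> ct).
  have [|g lg gE] := @lift_ex b ct Ub; last by exists g.
  by split=> //; rewrite (HU b Ub).2 cE.
pose g b := sval (cid (exg b)).
have gP b : U b -> lift b 0 1 (g b) /\ g b 1 = ct by rewrite /g; case: cid.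
exists (fun b => g b 0); split; last first.
  move=> b Ub; have [[lo _] _] := gP b Ub; have [|gi gE] := lo 0; first by lra.
  by split=> //; rewrite -gE (HU b Ub).1.
move=> O Oo; exists (fun b => U b /\ O (g b 0)); split; last by move=> b Ub; split=> [|[]].
apply: openB_local => b [Ub Ob]; have [e [e0 he]] := Oo _ Ob.
have [lg gE] := gP b Ub.
have [V [Vo Vb VP]] := lift_stable Ub lg gE e0 (fun b' Ub' => (HU b' Ub').2).
exists (fun b' => V b' /\ U b'); split; [exact: openB_inter|by []|move=> b' [Vb' Ub']].
split=> //; have [g' [lg' gE' cl]] := VP b' Vb' Ub'; have [lb bE] := gP b' Ub'.
have -> : g b' 0 = g' 0 by apply: (lift_unique lb lg'); rewrite bE gE'.
exact: he.
Qed.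

End HomotopyLifting.

(** * Comparison of the two invariants and their bounds *)

Lemma contractible_in_local_section (n k : nat) (U : UConf n k -> Prop) :
  openB U -> contractible_in U -> local_section U.
Proof. by move=> Uo [H [c0 [Hc HU]]]; apply: (contraction_section Uo Hc HU). Qed.

Lemma least_nat (P : nat -> Prop) m : P m -> exists2 l, P l & forall i, P i -> (l <= i)%coq_nat.
Proof.
move=> Pm; have ex : exists i, `[< P i >] by exists m; apply/asboolP.
case: (ex_minnP ex) => l /asboolP Pl lmin; exists l => // i Pi.
by apply/leP; apply: lmin; apply/asboolP.
Qed.

(** Both minima exist because the categorical cover is finite and its members also admit
    sections. *)
Theorem secat_cat_bounds (n k : nat) : (1 <= n)%coq_nat -> (1 <= k)%coq_nat ->
  exists s c : nat, is_secat n k s /\ is_cat n k c /\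
    ((k - alpha k) * (n - 1) <= s)%coq_nat /\ (s <= c)%coq_nat /\ (c <= (k - 1) * (n - 1))%coq_nat.
Proof.
move=> /leP n0 /leP k0.
have cov := category_cover n0 k0.
have cat_secat m : cover_by (n := n) (k := k) contractible_in m ->
  cover_by (n := n) (k := k) local_section m.
  move=> [U [UP Uc]]; exists U; split=> // i im; have [Uo Ui] := UP i im; split=> //.
  exact: contractible_in_local_section.
have [c c_cov c_min] := least_nat cov.
have [s s_cov s_min] := least_nat (cat_secat _ cov).
exists s, c; split; first by [].
split; first by [].
split; last by split; [apply: s_min; apply: cat_secat|apply: c_min].
case: n n0 s_cov {cov cat_secat c_cov c_min s_min} => // N _ s_cov.
by apply/leP; rewrite subn1; apply: secat_lower_bound.
Qed.

End ConfigurationSpaces.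

Theorem theorem3 (n k : nat) (hn : (1 <= n)%nat) (hk : (1 <= k)%nat) :
  exists s c : nat, is_secat n k s /\ is_cat n k c /\
    ((k - alpha k) * (n - 1) <= s)%nat /\ (s <= c)%nat /\ (c <= (k - 1) * (n - 1))%nat.
Proof. exact (ConfigurationSpaces.secat_cat_bounds hn hk). Qed.
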